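(* Let $K$ be an irreducible and reversible Markov kernel on a finite set $\mathcal X$ with stationary probability measure $\pi$, and let $\mathbf 1\in\mathscr P(\mathcal X)$ denote the density identically equal to $1$. \begin{enumerate} \item If $\mathrm{Ric}(K)\ge\kappa$ for some $\kappa\in\mathbb R$, then for all $\rho\in\mathscr P(\mathcal X)$ $$\mathcal H(\rho)\le\mathcal W(\rho,\mathbf 1)\sqrt{\mathcal I(\rho)}-\frac\kappa2\mathcal W(\rho,\mathbf 1)^2 .$$ \item If $\mathrm{Ric}(K)\ge\lambda$ for some $\lambda>0$, then the modified logarithmic Sobolev inequality $\mathcal H(\rho)\le\frac1{2\lambda}\mathcal I(\rho)$ holds for all $\rho\in\mathscr P(\mathcal X)$. \item If for some $\lambda>0$ the inequality $\mathcal H(\rho)\le\frac1{2\lambda}\mathcal I(\rho)$ holds for all $\rho\in\mathscr P(\mathcal X)$, then the modified Talagrand inequality $\mathcal W(\rho,\mathbf 1)\le\sqrt{\frac2\lambda\mathcal H(\rho)}$ holds for all $\rho\in\mathscr P(\mathcal X)$. \item If for some $\lambda>0$ the inequality $\mathcal W(\rho,\mathbf 1)\le\sqrt{\frac2\lambda\mathcal H(\rho)}$ holds for all $\rho\in\mathscr P(\mathcal X)$, then the Poincar\'e inequality $\|\varphi\|^2_{L^2(\mathcal X,\pi)}\le\frac1\lambda\mathcal E(\varphi,\varphi)$ holds for all functions $\varphi:\mathcal X\to\mathbb R$ with $\sum_{x}\varphi(x)\pi(x)=0$. \end{enumerate}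
   Context: $\mathbb R_+=[0,\infty)$. A Markov kernel satisfies $K:\mathcal X\times\mathcal X\to\mathbb R_+$, $\sum_yK(x,y)=1$ for all $x$; reversible means $K(x,y)\pi(x)=K(y,x)\pi(y)$. Probability densities: $\mathscr P(\mathcal X)=\{\rho:\mathcal X\to\mathbb R_+ : \sum_x\pi(x)\rho(x)=1\}$; $\mathscr P_*(\mathcal X)$ is the subset of strictly positive densities. Logarithmic mean: $\theta(s,t)=\int_0^1s^{1-p}t^p\,dp$ for $s,t\ge0$ (equal to $0$ if $s=0$ or $t=0$). For a density $\rho$ write $\hat\rho(x,y)=\theta(\rho(x),\rho(y))$. Metric $\mathcal W$: for $\bar\rho_0,\bar\rho_1\in\mathscr P(\mathcal X)$, $$\mathcal W(\bar\rho_0,\bar\rho_1)^2=\inf\int_0^1\frac12\sum_{x,y}(\psi_t(y)-\psi_t(x))^2\hat\rho_t(x,y)K(x,y)\pi(x)\,dt,$$ where the infimum runs over pairs $(\rho,\psi)$ with $\rho:[0,1]\to\mathbb R^{\mathcal X}$ of class $C^\infty$, $\rho_t\in\mathscr P(\mathcal X)$ for all $t$, $\rho_0=\bar\rho_0$, $\rho_1=\bar\rho_1$, $\psi:[0,1]\to\mathbb R^{\mathcal X}$ measurable, and $\dot\rho_t(x)+\sum_y(\psi_t(y)-\psi_t(x))\hat\rho_t(x,y)K(x,y)=0$ for all $x\in\mathcal X$, $t\in(0,1)$. Entropy: $\mathcal H(\rho)=\sum_x\pi(x)\rho(x)\log\rho(x)$ (with $0\log0=0$). Dirichlet form: $\mathcal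 E(\varphi,\psi)=\frac12\sum_{x,y}(\varphi(x)-\varphi(y))(\psi(x)-\psi(y))K(x,y)\pi(x)$. Discrete Fisher information: $\mathcal I(\rho)=\mathcal E(\rho,\log\rho)$ for $\rho\in\mathscr P_*(\mathcal X)$ and $\mathcal I(\rho)=+\infty$ if $\rho\in\mathscr P(\mathcal X)\setminus\mathscr P_*(\mathcal X)$. $\|\varphi\|^2_{L^2(\mathcal X,\pi)}=\sum_x\varphi(x)^2\pi(x)$. A constant speed geodesic is a curve $(\rho_t)_{t\in[0,1]}$ in $\mathscr P(\mathcal X)$ with $\mathcal W(\rho_s,\rho_t)=|s-t|\mathcal W(\rho_0,\rho_1)$ for all $s,t$. $\mathrm{Ric}(K)\ge\kappa$ means: for every constant speed geodesic $(\rho_t)_{t\in[0,1]}$ in $(\mathscr P(\mathcal X),\mathcal W)$ and every $t\in[0,1]$, $\mathcal H(\rho_t)\le(1-t)\mathcal H(\rho_0)+t\mathcal H(\rho_1)-\frac\kappa2t(1-t)\mathcal W(\rho_0,\rho_1)^2$. *)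

(* Defs.v *)
From HB Require Import structures.
From mathcomp Require Import all_boot all_order all_algebra.
From mathcomp Require Import all_classical all_reals all_analysis.
Import numFieldNormedType.Exports.
Import Order.TTheory GRing.Theory Num.Theory.
Set Implicit Arguments.
Unset Strict Implicit.
Unset Printing Implicit Defensive.
Local Open Scope classical_set_scope.
Local Open Scope ring_scope.

Definition markov_kernel (R : realType) (X : finType) (K : X -> X -> R) : Prop :=
  (forall x y, 0 <= K x y) /\ (forall x, \sum_y K x y = 1).

(* [connect] also admits the empty path; this is immaterial for a Markov
   kernel, since on a one-point set [K x x = 1 > 0]. *)
Definition irreducible_kernel (R : realType) (X : finType) (K : X -> X -> R) :
    Prop :=
  forall x y, connect (fun a b => 0 < K a b) x y.

Definition prob_vector (R : realType) (X : finType) (pi : X -> R) : Prop :=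
  (forall x, 0 <= pi x) /\ \sum_x pi x = 1.

Definition stationary (R : realType) (X : finType) (K : X -> X -> R)
    (pi : X -> R) : Prop :=
  forall y, \sum_x pi x * K x y = pi y.

Definition reversible (R : realType) (X : finType) (K : X -> X -> R)
    (pi : X -> R) : Prop :=
  forall x y, K x y * pi x = K y x * pi y.

Definition density (R : realType) (X : finType) (pi : X -> R) : set (X -> R) :=
  [set rho | (forall x, 0 <= rho x) /\ \sum_x pi x * rho x = 1].

(* For [s = 0] or [t = 0] the integrand vanishes for every [p] in the open
   interval ]0, 1[ (recall [0 `^ 0 = 1]), so the integral is 0. *)
Definition log_mean (R : realType) (s t : R) : R :=
  \int[lebesgue_measure]_(p in `[0, 1]) (s `^ (1 - p) * t `^ p).

Definition rho_hat (R : realType) (X : finType) (rho : X -> R) (x y : X) : R :=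
  log_mean (rho x) (rho y).

(* C^oo on the closed interval [0, 1], i.e. restriction to [0, 1] of a C^oo
   function on the real line. *)
Definition smooth01 (R : realType) (f : R -> R) : Prop :=
  exists2 g : R -> R,
    forall (n : nat) (t : R), derivable (derive1n n g) t 1 &
    forall t : R, 0 <= t <= 1 -> f t = g t.

Definition continuity_pair (R : realType) (X : finType) (K : X -> X -> R)
    (pi : X -> R) (rho0 rho1 : X -> R) (rho psi : R -> X -> R) : Prop :=
  [/\ forall x, smooth01 (rho ^~ x),
      forall t : R, 0 <= t <= 1 -> density pi (rho t),
      rho 0 = rho0 /\ rho 1 = rho1,
      forall x, measurable_fun (`[0, 1] : set R) (psi ^~ x : R -> R) &
      forall (x : X) (t : R), 0 < t < 1 ->
        derive1 (rho ^~ x) t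
        + \sum_y (psi t y - psi t x) * rho_hat (rho t) x y * K x y = 0].

Definition action_density (R : realType) (X : finType) (K : X -> X -> R)
    (pi : X -> R) (rho psi : X -> R) : R :=
  2^-1 * \sum_x \sum_y (psi y - psi x) ^+ 2 * rho_hat rho x y * K x y * pi x.

Definition W2 (R : realType) (X : finType) (K : X -> X -> R) (pi : X -> R)
    (rho0 rho1 : X -> R) : \bar R :=
  ereal_inf [set a | exists rho psi : R -> X -> R,
    continuity_pair K pi rho0 rho1 rho psi /\
    a = (\int[lebesgue_measure]_(t in `[0%R, 1%R])
           (action_density K pi (rho t) (psi t))%:E)%E].

(* Extended-real valued: no finiteness is built into the definition. *)
Definition W (R : realType) (X : finType) (K : X -> X -> R) (pi : X -> R)
    (rho0 rho1 : X -> R) : \bar R :=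
  sqrte (W2 K pi rho0 rho1).

(* [ln 0 = 0] in the library, which yields the convention 0 log 0 = 0. *)
Definition entropy (R : realType) (X : finType) (pi rho : X -> R) : R :=
  \sum_x pi x * rho x * ln (rho x).

Definition dirichlet (R : realType) (X : finType) (K : X -> X -> R)
    (pi : X -> R) (phi psi : X -> R) : R :=
  2^-1 * \sum_x \sum_y (phi x - phi y) * (psi x - psi y) * K x y * pi x.

Definition fisher (R : realType) (X : finType) (K : X -> X -> R) (pi : X -> R)
    (rho : X -> R) : \bar R :=
  if [forall x, 0 < rho x]
  then (dirichlet K pi rho (fun x => ln (rho x)))%:E else +oo%E.

Definition L2norm2 (R : realType) (X : finType) (pi phi : X -> R) : R :=
  \sum_x phi x ^+ 2 * pi x.

Definition constant_speed_geodesic (R : realType) (X : finType)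
    (K : X -> X -> R) (pi : X -> R) (rho : R -> X -> R) : Prop :=
  (forall t : R, 0 <= t <= 1 -> density pi (rho t)) /\
  (forall s t : R, 0 <= s <= 1 -> 0 <= t <= 1 ->
    W K pi (rho s) (rho t) = (`|s - t|%R%:E * W K pi (rho 0%R) (rho 1%R))%E).

Definition Ric_ge (R : realType) (X : finType) (K : X -> X -> R) (pi : X -> R)
    (kappa : R) : Prop :=
  forall rho : R -> X -> R, constant_speed_geodesic K pi rho ->
  forall t : R, 0 <= t <= 1 ->
    ((entropy pi (rho t))%:E <=
      ((1 - t) * entropy pi (rho 0%R) + t * entropy pi (rho 1%R))%:E
      - (kappa / 2 * t * (1 - t))%:E * W K pi (rho 0%R) (rho 1%R) ^+ 2)%E.

Definition density_one (R : realType) (X : finType) : X -> R := fun=> 1.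
Arguments density_one {R X}.

Definition HWI (R : realType) (X : finType) (K : X -> X -> R) (pi : X -> R)
    (kappa : R) : Prop :=
  forall rho, density pi rho ->
    ((entropy pi rho)%:E <=
      W K pi rho density_one * sqrte (fisher K pi rho)
      - (kappa / 2)%:E * W K pi rho density_one ^+ 2)%E.

Definition MLSI (R : realType) (X : finType) (K : X -> X -> R) (pi : X -> R)
    (lambda : R) : Prop :=
  forall rho, density pi rho ->
    ((entropy pi rho)%:E <= (1 / (2 * lambda))%:E * fisher K pi rho)%E.

Definition modified_Talagrand (R : realType) (X : finType) (K : X -> X -> R)
    (pi : X -> R) (lambda : R) : Prop :=
  forall rho, density pi rho ->
    (W K pi rho density_one <=
      (Num.sqrt (2 / lambda * entropy pi rho))%:E)%E.

Definition Poincare (R : realType) (X : finType) (K : X -> X -> R)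
    (pi : X -> R) (lambda : R) : Prop :=
  forall phi : X -> R, \sum_x phi x * pi x = 0 ->
    L2norm2 pi phi <= 1 / lambda * dirichlet K pi phi phi.

(* Main.v *)
(* The metric W is handled by duality. If a curve rho_t has kinetic form
   Gamma_t (phi) = 1/2 sum (phi y - phi x)^2 hat rho_t (x, y) K (x, y) pi (x), then
   (sum pi (rho_1 - rho_0) phi)^2 <= sup_t Gamma_t (phi) * energy by
   Cauchy-Schwarz, and conversely W (rho_0, rho_1)^2 <= A as soon as
   (sum pi d/dt rho_t phi)^2 <= A * Gamma_t (phi) along a segment, because the
   weighted graph Laplacian can be inverted. Smooth curves can be glued after
   a reparametrization that is flat at the endpoints, hence W is a finite distance,
   continuous for the sup norm, with approximate midpoints; cluster points of chains
   of almost equidistant points are constant speed geodesics.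

   (1) Differentiate the convexity inequality at time 0 of a geodesic from rho to 1;
   by duality the entropy decreases there at most at the rate
   sqrt (I rho) * W (rho, 1), since log is the derivative of the entropy and
   Gamma_rho (log rho) = I rho thanks to theta (s, t) (log s - log t) = s - t.
   (2) Complete the square in (1).
   (3) In place of the heat flow, minimize
   sigma |-> sqrt (2 H sigma / lambda) + (1 - eps) W (rho, sigma)
   over the densities bounded below by min rho. One explicit Euler step of the
   heat equation has length at most h sqrt (I sigma) and lowers H by h I sigma
   to first order, so that the inequality of (2) excludes every minimizer but 1.
   (4) Apply the hypothesis to 1 + eps phi and expand to second order, bounding W from
   below by duality against phi. *)
From HB Require Import structures.
Require Import Defs.
From mathcomp Require Import all_boot all_order all_algebra.
From mathcomp Require Import all_classical all_reals all_analysis.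
From mathcomp Require Import measurable_realfun ring lra.
Import numFieldNormedType.Exports.
Import Order.TTheory GRing.Theory Num.Theory.
Set Implicit Arguments.
Unset Strict Implicit.
Unset Printing Implicit Defensive.
Local Open Scope classical_set_scope.
Local Open Scope ring_scope.

(** * Logarithmic mean *)

(** Two obstacles shape the curves. Admissible curves are smooth but their potentials are only
    measurable in time, so a change of clock needs a substitution rule for measurable integrands,
    and gluing needs smooth clocks whose slope exceeds the ideal one by a factor arbitrarily close
    to 1. Moreover the mobility [rho_hat] degenerates where a density vanishes; a segment leaving
    such a density is run with the clock [t * t], whose vanishing speed compensates the vanishing
    mobility. In (3) the two terms of the minimized functional balance to first order: by [MLSI] a
    heat step of size [h] lowers [sqrt (2 H / lambda)] by about [h * sqrt I] or more, and its length
    is about [h * sqrt I] or less. The factor [1 - eps] leaves a first-order gain that beats the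
    second-order errors of one Euler step, so a single step does the work of the whole heat flow.
    The lower bound [min rho] keeps the logarithm Lipschitz on the region of minimization, and a
    Markov step preserves it. *)

Lemma integral_derivative (R : realType) (F f : R -> R) (a b : R) :
  a <= b -> (forall x : R, is_derive x 1 F (f x)) -> continuous f ->
  (\int[lebesgue_measure]_(x in `[a, b]) (f x)%:E = (F b - F a)%:E)%E.
Proof.
move=> ab dF cf; move: ab; rewrite le_eqVlt => /predU1P[->|ab].
  by rewrite set_itv1 integral_set1 subrr.
rewrite (continuous_FTC2 ab _ (F := F)) ?EFinB//.
- exact: continuous_subspaceT.
- have cF x : {for x, continuous F}.
    by apply: differentiable_continuous; apply/derivable1_diffP.
  split.
  + by move=> x _; exact: ex_derive.
  + exact: (cvg_at_right_filter (cF a)).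
  + exact: (cvg_at_left_filter (cF b)).
- by move=> x _; rewrite derive1E; exact: derive_val.
Qed.

(** The inverse is [x] times the real power -1 of [x ^+ 2]; at 0 the factor [x] matches the
    convention that the inverse of 0 is 0. *)
Lemma measurable_invr (R : realType) :
  measurable_fun setT (GRing.inv : R -> R).
Proof.
apply: (eq_measurable_fun (fun x : R => x * (x ^+ 2) `^ (- 1))).
  move=> x _; have [->|x0] := eqVneq x 0; first by rewrite mul0r invr0.
  by rewrite powR_inv1 ?sqr_ge0// expr2 invfM mulrA divff// mul1r.
apply: measurable_funM => //.
apply: (measurableT_comp (f := @powR R ^~ (-1))); first exact: measurable_powR.
exact: measurable_funX.
Qed.

Section LogMean.
Variable R : realType.
Implicit Types s t : R.

Lemma powR_exp_mean s t p : 0 < s -> 0 < t ->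
  s `^ (1 - p) * t `^ p = expR (ln s + p * (ln t - ln s)).
Proof.
move=> s0 t0; rewrite /powR !gt_eqF// -expRD; congr expR; ring.
Qed.

Lemma continuous_exp_mean s t :
  continuous (fun p : R => expR (ln s + p * (ln t - ln s))).
Proof.
move=> p; apply: (@continuous_comp R R R (fun p => ln s + p * (ln t - ln s)) expR).
  apply: cvgD; first exact: cvg_cst.
  by apply: cvgM; [exact: cvg_id | exact: cvg_cst].
exact: continuous_expR.
Qed.

Lemma log_mean_pos s t : 0 < s -> 0 < t ->
  log_mean s t =
  \int[lebesgue_measure]_(p in `[0, 1]) expR (ln s + p * (ln t - ln s)).
Proof.
by move=> s0 t0; apply: eq_Rintegral => p _; rewrite powR_exp_mean.
Qed.

Lemma integrable_exp_mean s t :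
  lebesgue_measure.-integrable `[0, 1]
    (EFin \o (fun p : R => expR (ln s + p * (ln t - ln s)))).
Proof.
apply: continuous_compact_integrable; first exact: segment_compact.
exact/continuous_subspaceT/continuous_exp_mean.
Qed.

Lemma log_mean_ge0 s t : 0 <= log_mean s t.
Proof. by apply: Rintegral_ge0 => p _; rewrite mulr_ge0// powR_ge0. Qed.

Lemma log_mean_id s : 0 < s -> log_mean s s = s.
Proof.
move=> s0; rewrite log_mean_pos//.
under eq_Rintegral do rewrite subrr mulr0 addr0 lnK ?posrE//.
rewrite Rintegral_cst//= lebesgue_measure_itv/= lte_fin ltr01 oppr0 adde0.
by rewrite mulr1.
Qed.

(** For [s != t] the integrand is exponential in [p] with rate [ln t - ln s], which gives an
    explicit antiderivative. Positivity, symmetry and the closed form of the mean are read off this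
    identity. *)
Lemma log_meanMln s t : 0 < s -> 0 < t ->
  log_mean s t * (ln s - ln t) = s - t.
Proof.
move=> s0 t0; have [->|st] := eqVneq s t; first by rewrite !subrr mulr0.
have dl : ln t - ln s != 0 by rewrite subr_eq0 eq_sym; apply: contra st => /eqP /ln_inj ->.
have dF (x : R) : is_derive x 1
    (fun p => (ln t - ln s)^-1 *: expR (ln s + p * (ln t - ln s)))
    (expR (ln s + x * (ln t - ln s))).
  have dg : is_derive x 1 (fun p : R => ln s + p * (ln t - ln s)) (ln t - ln s).
    apply: (is_derive_eq (is_deriveD (is_derive_cst (ln s) x 1)
      (is_deriveM (is_derive_id x 1) (is_derive_cst (ln t - ln s) x 1)))).
    by rewrite scaler0 !add0r /GRing.scale/= mulr1.
  apply: (is_derive_eq (is_deriveZ (ln t - ln s)^-1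
    (is_derive1_comp (is_derive_expR _) dg))).
  by rewrite /GRing.scale/= mulrCA mulVf// mulr1.
rewrite log_mean_pos// /Rintegral (integral_derivative ler01 dF); last first.
  exact: continuous_exp_mean.
rewrite /= mul1r mul0r addr0 addrCA subrr addr0 !lnK ?posrE//.
rewrite -scalerBr /GRing.scale /= mulrAC -[ln s - ln t]opprB mulrN mulVf// mulN1r.
by rewrite opprB.
Qed.

Lemma log_mean_eq0 s t : s = 0 \/ t = 0 -> log_mean s t = 0.
Proof.
move=> st; pose f p := s `^ (1 - p) * t `^ p.
have st0 p : `]0, 1[%classic p -> f p = 0.
  rewrite /= in_itv/= => /andP[p0 p1].
  by rewrite /f; case: st => ->; rewrite powR0 ?(mulr0, mul0r) ?gt_eqF ?subr_gt0.
have mf : measurable_fun (`]0, 1[ : set R) (EFin \o f).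
  apply: (eq_measurable_fun (cst 0%E)); last exact: measurable_cst.
  by move=> p /set_mem pI /=; rewrite st0.
rewrite /log_mean /Rintegral.
(* The end points are removed because there the power 0 of 0, which is 1, can make the integrand
   nonzero. *)
rewrite (integral_itv_bndoo true false mf) integral0_eq// => p pI.
by rewrite /= st0.
Qed.

Lemma log_mean_gt0 s t : 0 < s -> 0 < t -> 0 < log_mean s t.
Proof.
move=> s0 t0; have [<-|st] := eqVneq s t; first by rewrite log_mean_id.
rewrite lt0r log_mean_ge0 andbT; apply/eqP => l0.
have := log_meanMln s0 t0; rewrite l0 mul0r => /esym/eqP.
by rewrite subr_eq0 (negbTE st).
Qed.

Lemma log_mean_mono s t s' t' : 0 <= s -> 0 <= t -> s <= s' -> t <= t' ->
  log_mean s t <= log_mean s' t'.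
Proof.
rewrite le_eqVlt => /predU1P[<-|s0] t0 ss tt.
  by rewrite log_mean_eq0 ?log_mean_ge0//; left.
move: t0; rewrite le_eqVlt => /predU1P[t0|t0].
  by rewrite -t0 log_mean_eq0 ?log_mean_ge0//; right.
have s'0 := lt_le_trans s0 ss; have t'0 := lt_le_trans t0 tt.
rewrite !log_mean_pos//; apply: le_Rintegral => //.
- exact: integrable_exp_mean.
- exact: integrable_exp_mean.
move=> p /=; rewrite in_itv/= => /andP[p0 p1].
rewrite -!powR_exp_mean//; apply: ler_pM; rewrite ?powR_ge0//.
  by apply: ge0_ler_powR; rewrite ?nnegrE ?subr_ge0// ltW.
by apply: ge0_ler_powR; rewrite ?nnegrE// ltW.
Qed.

Lemma log_meanZ c s t : 0 <= c -> 0 <= s -> 0 <= t ->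
  log_mean (c * s) (c * t) = c * log_mean s t.
Proof.
rewrite le_eqVlt => /predU1P[<-|c0].
  by rewrite !mul0r log_mean_eq0//; left.
rewrite le_eqVlt => /predU1P[<-|s0].
  by rewrite mulr0 !log_mean_eq0 ?mulr0//; left.
rewrite le_eqVlt => /predU1P[<-|t0].
  by rewrite mulr0 !log_mean_eq0 ?mulr0//; right.
rewrite !log_mean_pos ?mulr_gt0// -RintegralZl//; last exact: integrable_exp_mean.
apply: eq_Rintegral => p _; rewrite !lnM ?posrE//.
rewrite -[c in RHS]lnK ?posrE// -expRD; congr expR; ring.
Qed.

#[local] Opaque log_mean.

(** Both sides of [log_meanMln] change sign when [s] and [t] are exchanged; dividing by the nonzero
    [ln s - ln t] gives symmetry without a substitution in the integral. *)
Lemma log_meanC s t : 0 <= s -> 0 <= t -> log_mean s t = log_mean t s.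
Proof.
rewrite le_eqVlt => /predU1P[<-|s0].
  by rewrite !log_mean_eq0//; [right|left].
rewrite le_eqVlt => /predU1P[<-|t0].
  by rewrite !log_mean_eq0//; [left|right].
have [->//|st] := eqVneq s t.
have dl : ln s - ln t != 0.
  by rewrite subr_eq0; apply: contra st => /eqP /ln_inj ->.
have e : log_mean s t * (ln s - ln t) = log_mean t s * (ln s - ln t).
  move: (log_meanMln s0 t0) (log_meanMln t0 s0).
  by move: (log_mean s t) (log_mean t s) (ln s) (ln t) => a b c d; lra.
exact: (mulIf dl e).
Qed.

Lemma log_meanE s t : 0 <= s -> 0 <= t ->
  log_mean s t = if (0 < s) && (0 < t) then
    (if s == t then s else (s - t) / (ln s - ln t)) else 0.
Proof.
rewrite le_eqVlt => /predU1P[<-|s0].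
  by rewrite ltxx log_mean_eq0//; left.
rewrite le_eqVlt => /predU1P[<-|t0].
  by rewrite ltxx andbF log_mean_eq0//; right.
rewrite s0 t0; case: eqVneq => [->|st]; first by rewrite log_mean_id.
have dl : ln s - ln t != 0.
  by rewrite subr_eq0; apply: contra st => /eqP /ln_inj ->.
by rewrite -log_meanMln// mulfK.
Qed.

(** The closed form [log_meanE] replaces the parameter integral by a measurable case distinction. *)
Lemma measurable_log_mean d (T : measurableType d) (D : set T) (f g : T -> R) :
  measurable D -> (forall x, D x -> 0 <= f x) -> (forall x, D x -> 0 <= g x) ->
  measurable_fun D f -> measurable_fun D g ->
  measurable_fun D (fun x => log_mean (f x) (g x)).
Proof.
move=> mD f0 g0 mf mg.
apply: (eq_measurable_fun (fun x => if (0 < f x) && (0 < g x) then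
    (if f x == g x then f x else (f x - g x) / (ln (f x) - ln (g x))) else 0)).
  by move=> x /set_mem Dx; rewrite log_meanE ?f0 ?g0.
apply: measurable_fun_if => //.
- by apply: measurable_and; apply: measurable_fun_ltr.
- set D' := _ `&` _.
  have mD' : measurable D'.
    have mb : measurable_fun D (fun x => (0 < f x) && (0 < g x)).
      by apply: measurable_and; exact: measurable_fun_ltr.
    exact: mb.
  have D'D : D' `<=` D by move=> x [].
  have {}mf := measurable_funS mD D'D mf.
  have {}mg := measurable_funS mD D'D mg.
  apply: measurable_fun_if => //; first exact: measurable_fun_eqr.
    by apply: measurable_funS mf => // x [].
  set D2 := _ `&` _.
  have D2D : D2 `<=` D' by move=> x [].
  have {}mf := measurable_funS mD' D2D mf.
  have {}mg := measurable_funS mD' D2D mg.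
  apply: measurable_funM; first exact: measurable_funB.
  apply: (measurableT_comp (@measurable_invr R)).
  apply: measurable_funB.
    exact: (measurableT_comp (@measurable_ln R)).
  exact: (measurableT_comp (@measurable_ln R)).
Qed.
End LogMean.

#[local] Opaque log_mean.

(** * Smooth functions *)

Section Smooth.
Variable R : realType.
Implicit Types f g : R -> R.

Variant smooth f : Prop :=
  Smooth of forall (n : nat) (t : R), derivable (derive1n n f) t 1.

(** Recursion through [derive1 f] turns the product and chain rules into inductions on [n], in which
    [diff_orderS] lowers the order of the undifferentiated factor. *)
Fixpoint diff_order (n : nat) f : Prop :=
  if n is m.+1 then (forall t : R, derivable f t 1) /\ diff_order m (derive1 f) else True.

Lemma smooth_diff_order f : smooth f <-> forall n, diff_order n f.
Proof.
split=> [[sf] n | df]; last split=> n.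
  elim: n f sf => [//|n IH] f sf /=; split; first exact: (sf 0%N).
  by apply: IH => k t; have := sf k.+1 t; rewrite derive1Sn.
elim: n f df => [|n IH] f df t; first by have [] := df 1%N.
rewrite derive1Sn; apply: IH => k; by have [] := df k.+1.
Qed.

Lemma diff_orderS n f : diff_order n.+1 f -> diff_order n f.
Proof.
elim: n f => [//|n IH] f [df dfn]; split => //; exact: IH.
Qed.

Lemma derive1D f g : (forall t : R, derivable f t 1) -> (forall t : R, derivable g t 1) ->
  derive1 (fun x => f x + g x) = (fun x => (derive1 f) x + (derive1 g) x).
Proof.
by move=> df dg; apply/funext => x; rewrite !derive1E (@deriveD _ _ _ f g).
Qed.

Lemma derive1M f g : (forall t : R, derivable f t 1) -> (forall t : R, derivable g t 1) ->
  derive1 (fun x => f x * g x) = (fun x => f x * (derive1 g) x + g x * (derive1 f) x).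
Proof.
by move=> df dg; apply/funext => x; rewrite !derive1E (@deriveM _ _ f g).
Qed.

Lemma derive1_compE f g : (forall t : R, derivable f t 1) -> (forall t : R, derivable g t 1) ->
  derive1 (fun x => g (f x)) = (fun x => (derive1 g) (f x) * (derive1 f) x).
Proof.
by move=> df dg; apply/funext => x; rewrite -derive1_comp.
Qed.

Lemma diff_orderD n f g : diff_order n f -> diff_order n g ->
  diff_order n (fun x => f x + g x).
Proof.
elim: n f g => [//|n IH] f g [df dfn] [dg dgn]; split.
  by move=> t; exact: (@derivableD _ _ _ f g).
by rewrite derive1D//; apply: IH.
Qed.

Lemma diff_orderM n f g : diff_order n f -> diff_order n g ->
  diff_order n (fun x => f x * g x).
Proof.
elim: n f g => [//|n IH] f g [df dfn] [dg dgn]; split.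
  by move=> t; exact: (@derivableM _ _ f g).
rewrite derive1M//; apply: diff_orderD; apply: IH => //; exact: diff_orderS.
Qed.

Lemma diff_order_comp n f g : diff_order n f -> diff_order n g ->
  diff_order n (fun x => g (f x)).
Proof.
elim: n f g => [//|n IH] f g [df dfn] [dg dgn]; split.
  by move=> t; apply/derivable1_diffP/differentiable_comp; exact/derivable1_diffP.
rewrite derive1_compE//; apply: diff_orderM => //.
by apply: IH => //; exact: diff_orderS.
Qed.

Lemma smoothD f g : smooth f -> smooth g -> smooth (fun x => f x + g x).
Proof.
by move=> /smooth_diff_order sf /smooth_diff_order sg;
  apply/smooth_diff_order => n; exact: diff_orderD.
Qed.

Lemma smoothM f g : smooth f -> smooth g -> smooth (fun x => f x * g x).
Proof.
by move=> /smooth_diff_order sf /smooth_diff_order sg;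
  apply/smooth_diff_order => n; exact: diff_orderM.
Qed.

Lemma smooth_comp f g : smooth f -> smooth g -> smooth (fun x => g (f x)).
Proof.
by move=> /smooth_diff_order sf /smooth_diff_order sg;
  apply/smooth_diff_order => n; exact: diff_order_comp.
Qed.

Lemma smooth_cst (a : R) : smooth (fun=> a).
Proof.
apply/smooth_diff_order => n; elim: n a => [//|n IH] a; split.
  by move=> t; exact: derivable_cst.
have -> : derive1 (fun=> a) = (fun=> 0 : R) by apply/funext => x; rewrite derive1_cst.
exact: IH.
Qed.

Lemma smooth_id : smooth (fun x => x).
Proof.
apply/smooth_diff_order => -[//|n]; split.
  by move=> t; exact: derivable_id.
have -> : derive1 (fun x : R => x) = (fun=> 1 : R) by apply/funext => x; rewrite derive1_id.
by have /smooth_diff_order/(_ n) := @smooth_cst 1.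
Qed.

Lemma smooth_derivable f t : smooth f -> derivable f t 1.
Proof. by move=> [/(_ 0%N t)]. Qed.

Lemma smooth_continuous f : smooth f -> continuous f.
Proof.
by move=> sf t; apply/differentiable_continuous/derivable1_diffP/smooth_derivable.
Qed.

Lemma smooth_derive1 f : smooth f -> smooth (derive1 f).
Proof. by move=> [sf]; split=> n t; rewrite -derive1Sn; exact: sf. Qed.

Lemma smooth_is_derive f (t : R) : smooth f -> is_derive t 1 f (derive1 f t).
Proof.
by move=> sf; rewrite derive1E; apply: DeriveDef => //; exact: smooth_derivable.
Qed.

Lemma smooth_sum (I : Type) (r : seq I) (F : I -> R -> R) :
  (forall i, smooth (F i)) -> smooth (fun x => \sum_(i <- r) F i x).
Proof.
move=> sF; elim: r => [|i r IH].
  have -> : (fun x => \sum_(i <- [::]) F i x) = fun=> 0.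
    by apply/funext => x; rewrite big_nil.
  exact: smooth_cst.
have h := @smoothD (F i) _ (sF i) IH.
have <- : (fun x => F i x + \sum_(j <- r) F j x) =
    fun x => \sum_(j <- i :: r) F j x.
  by apply/funext => x; rewrite big_cons.
exact: h.
Qed.

(** For [n = 0] this is the classical flat function exp(-1/x). The powers of 1/x are carried along
    because differentiation maps the family into its own span, so smoothness follows by
    induction. *)
Definition flat_exp (n : nat) (x : R) : R :=
  if 0 < x then x^-1 ^+ n * expR (- x^-1) else 0.

Lemma flat_exp_bound n x : 0 <= flat_exp n x <= (n.+1)`!%:R * `|x|.
Proof.
rewrite /flat_exp; case: ifPn => x0; last by rewrite lexx mulr_ge0.
have [u ux] : exists u, x = u^-1 by exists x^-1; rewrite invrK.
move: x0; rewrite {}ux invr_gt0 invrK => u0.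
rewrite mulr_ge0 ?expR_ge0 ?exprn_ge0 ?(ltW u0)//= gtr0_norm ?invr_gt0//.
(* With [u = 1/x], the bound [u^(n+1) / (n+1)! <= exp u] gives [u^n exp(-u) <= (n+1)! / u]. *)
have := expR_ge1Dxn n (ltW u0); rewrite expRN -lerBrDl => h.
rewrite ler_pdivrMr ?expR_gt0// mulrAC ler_pdivlMr// -exprSr.
rewrite mulrC -ler_pdivrMr ?ltr0n ?fact_gt0// (le_trans h)//.
by rewrite lerBlDr lerDl.
Qed.

Lemma flat_exp_is_derive n (x : R) :
  is_derive x 1 (flat_exp n) (flat_exp n.+2 x - n%:R * flat_exp n.+1 x).
Proof.
have [x0|x0|->] := ltgtP x 0.
- rewrite /flat_exp !ltNge (ltW x0)/= mulr0 subr0.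
  apply: (near_eq_is_derive _ (is_derive_cst (0 : R) x 1)).
  near=> y; rewrite ifF//; apply/negbTE; rewrite -leNgt ltW//.
  by near: y; exact: lt_nbhsl.
- pose G (u : R) := u ^+ n * expR (- u).
  have nG : \forall y \near x, (G \o GRing.inv) y = flat_exp n y.
    near=> y; rewrite /flat_exp ifT//; near: y; exact: lt_nbhsr.
  apply: (near_eq_is_derive nG).
  have dV := is_deriveV (lt0r_neq0 x0) (is_derive_id x 1).
  have dE := is_derive1_comp (is_derive_expR (- x^-1)) (is_deriveN (is_derive_id x^-1 1)).
  have dX := is_deriveX n (is_derive_id x^-1 1).
  have dG := is_deriveM dX dE.
  have GE : id ^+ n * (expR \o -%R) = G by apply/funext => u; rewrite /G /= !fctE.
  rewrite GE in dG.
  apply: (is_derive_eq (is_derive1_comp (f := G) (g := GRing.inv) dG dV)).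
  rewrite /flat_exp x0 /GRing.scale /= fctE expr2 invfM.
  set E := expR _; set u := x^-1.
  case: (n) => [|m]; rewrite /= ?exprS ?expr0; ring.
- rewrite {2 3}/flat_exp ltxx mulr0 subr0.
  have : h^-1 *: ((flat_exp n \o shift (0 : R)) (h *: (1 : R)) - flat_exp n 0) @[h --> 0^'] --> (0 : R).
    apply: (@squeeze_cvgr _ _ _ _ (fun=> 0) (fun h => (n.+2)`!%:R * `|h|)).
    + near=> h.
      (* The difference quotient at 0 is the next function of the family, to which the linear bound
         applies. *)
      have -> : h^-1 *: ((flat_exp n \o shift (0 : R)) (h *: (1 : R)) - flat_exp n 0) = flat_exp n.+1 h.
        rewrite /flat_exp /= ltxx subr0 addr0 /GRing.scale /= mulr1.
        by case: ifP; rewrite ?mulr0// exprS mulrA.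
      exact: flat_exp_bound.
    + exact: cvg_cst.
    + rewrite -[X in _ --> X](mulr0 ((n.+2)`!%:R : R)).
      apply: cvgMr.
      have c0 : (h : R) @[h --> (0 : R)^'] --> (0 : R) by exact: nbhs_dnbhs.
      have := cvg_norm c0; rewrite normr0; apply.
  move=> h; apply: DeriveDef; first by apply/cvgP; exact: h.
  exact: cvg_lim h.
Unshelve. all: by end_near.
Qed.

Lemma derive1_flat_exp n : derive1 (flat_exp n) =
  (fun x => flat_exp n.+2 x + (- n%:R) * flat_exp n.+1 x).
Proof.
apply/funext => x; rewrite derive1E (derive_val (is_derive := flat_exp_is_derive n x)).
by rewrite mulNr.
Qed.

Lemma smooth_flat_exp n : smooth (flat_exp n).
Proof.
apply/smooth_diff_order => m; elim: m n => [//|m IH] n; split.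
  by move=> x; have [] := flat_exp_is_derive n x.
rewrite derive1_flat_exp; apply: diff_orderD => //.
apply: (@diff_orderM _ (fun=> - n%:R)) => //.
have := @smooth_cst (- n%:R); move=> /smooth_diff_order; exact.
Qed.

(* A smooth version of [max 0]; its slope is [(1 + v) exp (- v)] at
   [v = e / t], which lies in [0, 1]. *)
Definition smooth_ramp (e t : R) : R := t * flat_exp 0 (t / e).

Lemma smooth_smooth_ramp e : smooth (smooth_ramp e).
Proof.
apply: (smoothM (@smooth_id)).
apply: (@smooth_comp (fun t => t / e) (flat_exp 0)); last exact: smooth_flat_exp.
by apply: (smoothM (@smooth_id)); exact: smooth_cst.
Qed.

Section Ramp.
Variable e : R.
Hypothesis e0 : 0 < e.

Lemma smooth_ramp_le0 t : t <= 0 -> smooth_ramp e t = 0.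
Proof.
by move=> t0; rewrite /smooth_ramp /flat_exp ltNge pmulr_lle0 ?invr_gt0// t0 mulr0.
Qed.

Lemma smooth_ramp_ge0 t : 0 <= smooth_ramp e t.
Proof.
have [t0|t0] := leP t 0; first by rewrite smooth_ramp_le0.
rewrite mulr_ge0 ?(ltW t0)//.
by have /andP[] := flat_exp_bound 0 (t / e).
Qed.

Lemma smooth_ramp_gt0 t : 0 < t -> smooth_ramp e t = t * expR (- (e / t)).
Proof. by move=> t0; rewrite /smooth_ramp /flat_exp divr_gt0// expr0 mul1r invf_div. Qed.

Lemma smooth_ramp_slope (t : R) : 0 <= derive1 (smooth_ramp e) t <= 1.
Proof.
have -> : derive1 (smooth_ramp e) t = flat_exp 0 (t / e) + t / e * flat_exp 2 (t / e).
  rewrite /smooth_ramp.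
  rewrite (derive1M (g := fun t => flat_exp 0 (t / e)))//; last 1 first.
  - move=> x; apply: smooth_derivable.
    apply: (@smooth_comp (fun t => t / e) (flat_exp 0)); last exact: smooth_flat_exp.
    by apply: (smoothM (@smooth_id)); exact: smooth_cst.
  have sd : smooth (fun t => t / e).
    by apply: (smoothM (@smooth_id)); exact: smooth_cst.
  rewrite (@derive1_compE (fun t => t / e) (flat_exp 0)); last 2 first.
  - by move=> x; exact: smooth_derivable.
  - by move=> x; exact/smooth_derivable/smooth_flat_exp.
  rewrite derive1_flat_exp oppr0 mul0r addr0 derive1_id mulr1 addrC; congr (_ + _).
  rewrite (@derive1M (fun t => t) (fun=> e^-1))//.
  by rewrite derive1_cst derive1_id mulr0 add0r mulr1 mulrAC mulrA.
rewrite /flat_exp; case: ifPn => u0; last by rewrite mulr0 addr0 lexx ler01.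
rewrite expr0 mul1r expr2; set u := t / e in u0 *.
have -> : expR (- u^-1) + u * (u^-1 * u^-1 * expR (- u^-1)) =
    (1 + u^-1) / expR (u^-1).
  by rewrite expRN mulrDl mul1r; congr (_ + _); rewrite !mulrA divff ?gt_eqF// mul1r.
rewrite divr_ge0 ?expR_ge0 ?addr_ge0 ?invr_ge0 ?(ltW u0)//=.
by rewrite ler_pdivrMr ?expR_gt0// mul1r expR_ge1Dx.
Qed.

Lemma smooth_ramp_ndecr : {homo smooth_ramp e : s t / s <= t}.
Proof.
move=> s t st; apply: (@ger0_derive1_ndecr _ (smooth_ramp e) s t) => //.
- by move=> x _; exact/smooth_derivable/smooth_smooth_ramp.
- by move=> x _; have /andP[] := smooth_ramp_slope x.
- exact/continuous_subspaceT/smooth_continuous/smooth_smooth_ramp.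
Qed.
End Ramp.

Lemma derive1_affine (a b : R) f : (forall t : R, derivable f t 1) ->
  derive1 (fun x => a + b * f x) = (fun x => b * derive1 f x).
Proof.
move=> df; have dc (d t : R) : derivable (fun=> d : R) t 1 by exact: derivable_cst.
have db : forall t : R, derivable (fun x => b * f x) t 1.
  by move=> t; exact: (@derivableM _ _ (fun=> b) f _ _ (dc b t) (df t)).
rewrite (derive1D (dc a) db); apply/funext => x.
rewrite (derive1M (dc b) df) !derive1_cst add0r mulr0 addr0.
by [].
Qed.

Lemma smooth_affine (a b : R) f : smooth f -> smooth (fun x => a + b * f x).
Proof.
move=> sf; have h := @smoothM _ _ (@smooth_cst b) sf.
exact: (@smoothD _ _ (@smooth_cst a) h).
Qed.

(** Fermat's rule at a global extremum. It is applied to clocks with values in [0, 1]: where such a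
    clock sits at 0 or 1 its speed is zero, so the continuity equation is never called at the end
    points. *)
Lemma derive1_extremum f (a b t : R) : smooth f ->
  (forall t, a <= f t <= b) -> f t = a \/ f t = b -> derive1 f t = 0.
Proof.
move=> sf fab ft.
have tt : t - 1 <= t + 1 by lra.
have df : forall u : R, u \in `]t - 1, t + 1[ -> derivable f u 1.
  by move=> u _; exact: smooth_derivable.
have tI : t \in `]t - 1, t + 1[ by rewrite in_itv/=; lra.
rewrite derive1E; case: ft => ft.
  by apply: (derive_val (is_derive := derive1_at_min tt df tI _)) => u _;
    rewrite ft; have /andP[] := fab u.
by apply: (derive_val (is_derive := derive1_at_max tt df tI _)) => u _;
  rewrite ft; have /andP[] := fab u.
Qed.

(** With [k] the ramp, the step is [1 - k (1 - k ((1 + e) t)) / k 1]. The inner ramp is 0 for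
    [t <= 0] and at least 1 for [t >= 1], so the outer one is [k 1], respectively 0. The slope is at
    most [(1 + e) / k 1] with [k 1 = exp (- e) >= 1 - e], and [e] is chosen so that
    [(1 + e) / (1 - e) = c]. *)
Lemma smooth_step (c : R) : 1 < c -> exists phi : R -> R,
  [/\ smooth phi, forall t, 0 <= derive1 phi t <= c,
      forall t, 0 <= phi t <= 1, forall t, t <= 0 -> phi t = 0 &
      forall t, 1 <= t -> phi t = 1].
Proof.
move=> c1; pose e := (c - 1) / (c + 1).
have e0 : 0 < e by rewrite divr_gt0; lra.
have e1 : e < 1 by rewrite /e ltr_pdivrMr; lra.
have ec : 1 + e <= c * (1 - e).
  have : e * (c + 1) = c - 1 by rewrite /e divfK//; lra.
  lra.
pose k := smooth_ramp e.
have sk : smooth k := @smooth_smooth_ramp e.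
have dk (t : R) : derivable k t 1 by exact: smooth_derivable.
have k1E : k 1 = expR (- e) by rewrite /k (smooth_ramp_gt0 e0)// invr1 mulr1 mul1r.
have k1 : 1 - e <= k 1 by rewrite k1E -[e]opprK opprK expR_ge1Dx.
have k10 : 0 < k 1 by rewrite k1E expR_gt0.
have ke : 1 <= k (1 + e).
  rewrite /k (smooth_ramp_gt0 e0); last lra.
  have := expR_ge1Dx (- (e / (1 + e))) => h.
  have {1}-> : 1 = (1 + e) * (1 + - (e / (1 + e))) :> R by field; lra.
  by rewrite ler_pM2l //; lra.
pose aff (t : R) : R := 0 + (1 + e) * t.
pose refl (t : R) : R := 1 + -1 * k t.
pose krefl (t : R) : R := k (refl t).
pose eta (t : R) : R := 1 + (- (k 1)^-1) * krefl t.
pose phi (t : R) : R := eta (aff t).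
have saff : smooth aff by exact: (@smooth_affine 0 (1 + e) _ (@smooth_id)).
have srefl : smooth refl by exact: (@smooth_affine 1 (-1) _ sk).
have skrefl : smooth krefl by exact: (@smooth_comp _ _ srefl sk).
have seta : smooth eta by exact: (@smooth_affine 1 (- (k 1)^-1) _ skrefl).
have sphi : smooth phi by exact: (@smooth_comp _ _ saff seta).
have sd f (t : R) : smooth f -> derivable f t 1 by exact: smooth_derivable.
have dphi t : derive1 phi t =
   (k 1)^-1 * derive1 k (1 - k ((1 + e) * t)) * derive1 k ((1 + e) * t) * (1 + e).
  have -> := @derive1_compE aff eta (fun t => sd _ t saff) (fun t => sd _ t seta).
  have -> := @derive1_affine 0 (1 + e) _ (fun t => sd _ t (@smooth_id)).
  have -> := @derive1_affine 1 (- (k 1)^-1) _ (fun t => sd _ t skrefl).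
  have -> := @derive1_compE refl k (fun t => sd _ t srefl) dk.
  have -> := @derive1_affine 1 (-1) _ dk.
  rewrite derive1_id mulr1 /refl /aff add0r mulN1r; congr (_ * _).
  set a := derive1 k _; set b := derive1 k _; set c' := _^-1; ring.
have k0 x : 0 <= k x by exact: (smooth_ramp_ge0 e0).
exists phi; split; first exact: sphi.
- move=> t; rewrite dphi.
  have /andP[a0 a1] := smooth_ramp_slope e (1 - k ((1 + e) * t)).
  have /andP[b0 b1] := smooth_ramp_slope e ((1 + e) * t).
  rewrite -/k in a0 a1 b0 b1; move: a0 a1 b0 b1 k1 k10.
  move: (derive1 k _) (derive1 k _) (k 1) => a b k1' a0 a1 b0 b1 k1 k10.
  apply/andP; split.
    by apply: mulr_ge0; [apply: mulr_ge0; [apply: mulr_ge0|]|]; rewrite ?invr_ge0; lra.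
  have ab : a * b <= 1 by apply: mulr_ile1.
  have ab0 : 0 <= a * b by apply: mulr_ge0.
  rewrite -!mulrA mulrC ler_pdivrMr// mulrA.
  have : a * b * (1 + e) <= 1 + e by rewrite ler_piMl//; lra.
  have : c * (1 - e) <= c * k1' by rewrite ler_pM2l; lra.
  lra.
- move=> t; rewrite /phi /eta /krefl /refl /aff mulN1r.
  have : k (1 - k (0 + (1 + e) * t)) <= k 1.
    by apply: smooth_ramp_ndecr => //; rewrite lerBlDr lerDl.
  move: (k0 (1 - k (0 + (1 + e) * t))); move: (k (1 - _)) (k 1) k10 => a b b0 a0 ab.
  have h : 0 <= a / b by rewrite divr_ge0// ltW.
  have : a / b <= 1 by rewrite ler_pdivrMr// mul1r.
  lra.
- move=> t t0; rewrite /phi /eta /krefl /refl /aff /k (smooth_ramp_le0 e0 (t := 0 + _)).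
    rewrite mulr0 addr0 mulNr mulVf ?subrr// gt_eqF//.
  by rewrite add0r pmulr_rle0//; lra.
- move=> t t1; rewrite /phi /eta /krefl /refl /aff [k (1 + _)](smooth_ramp_le0 e0) ?mulr0 ?addr0//.
  rewrite mulN1r subr_le0 (le_trans ke)//; apply: smooth_ramp_ndecr => //.
  by rewrite add0r ler_peMr//; lra.
Qed.

End Smooth.

(** * Change of variables *)

Section Weighted.
Context d (T : measurableType d) (R : realType).
Variables (mu : {measure set T -> \bar R}) (w : T -> R).

(** The measure with density [w]. The two properties of [w] are arguments so that the measure
    structure can be attached to this term. *)
Definition weighted (mw : measurable_fun setT w) (w0 : forall x, 0 <= w x) :
    set T -> \bar R :=
  fun U => (\int[mu]_(x in U) (w x)%:E)%E.

Hypotheses (mw : measurable_fun setT w) (w0 : forall x, 0 <= w x).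

Let weighted0 : weighted mw w0 set0 = 0%E.
Proof. by rewrite /weighted integral_set0. Qed.

Let weighted_ge0 U : (0 <= weighted mw w0 U)%E.
Proof. by apply: integral_ge0 => x _; rewrite lee_fin. Qed.

Let weighted_sigma_additive : semi_sigma_additive (weighted mw w0).
Proof.
move=> /= F mF tF mUF; rewrite /weighted; apply: cvg_toP.
  apply: ereal_nondecreasing_is_cvgn => m n mn.
  apply: lee_sum_nneg_natr => // k _ _.
  by apply: integral_ge0 => x _; rewrite lee_fin.
rewrite ge0_integral_bigcup//=.
- by apply: measurable_funTS; apply: measurableT_comp.
- by move=> x _; rewrite lee_fin.
Qed.

HB.instance Definition _ := isMeasure.Build _ _ _ (weighted mw w0)
  weighted0 weighted_ge0 weighted_sigma_additive.

Import HBNNSimple.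

Let integral_weighted_nnsfun (f : {nnsfun T >-> R}) :
  (\int[weighted mw w0]_x (f x)%:E = \int[mu]_x ((f x)%:E * (w x)%:E))%E.
Proof.
have mwE : measurable_fun setT (EFin \o w) by exact/measurable_EFinP.
under [LHS]eq_integral do rewrite fimfunE -fsumEFin//.
rewrite [LHS]ge0_integral_fsum//; last 2 first.
  - by move=> r; exact/measurable_EFinP/measurableT_comp.
  - by move=> n x _; rewrite EFinM nnfun_muleindic_ge0.
under [RHS]eq_integral.
  move=> x xD; rewrite fimfunE -fsumEFin// muleC ge0_mule_fsumr; last first.
    by move=> r; rewrite EFinM nnfun_muleindic_ge0.
  over.
rewrite [RHS]ge0_integral_fsum//; last 2 first.
  - move=> r; apply: emeasurable_funM => //.
    by apply/measurable_EFinP; do 2 apply/measurableT_comp => //.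
  - by move=> n x _; rewrite EFinM mule_ge0// ?nnfun_muleindic_ge0// lee_fin.
apply: eq_fsbigr => r rf; rewrite integralZl_indic_nnsfun//= integral_indic//= setIT.
under [RHS]eq_integral do rewrite EFinM muleCA.
rewrite ge0_integralZl//; last 3 first.
- by apply: emeasurable_funM => //; exact/measurable_EFinP.
- by move=> t _; rewrite mule_ge0// lee_fin.
- by move: rf; rewrite inE => -[t _ <-]; rewrite lee_fin.
congr (_ * _)%E; rewrite /weighted [LHS]integral_mkcond.
by apply: eq_integral => x _; rewrite epatch_indic.
Qed.

(** Known for simple functions, the formula passes to [f] by monotone convergence on both sides. *)
Lemma integral_weighted (f : T -> \bar R) :
  measurable_fun setT f -> (forall x, 0 <= f x)%E ->
  (\int[weighted mw w0]_x f x = \int[mu]_x (f x * (w x)%:E))%E.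
Proof.
move=> mf f0; pose f_ := nnsfun_approx measurableT mf.
have mwE : measurable_fun setT (EFin \o w) by exact/measurable_EFinP.
have fl x : (f_ n x)%:E @[n --> \oo] --> f x by exact: cvg_nnsfun_approx.
transitivity (lim (\int[weighted mw w0]_x (f_ n x)%:E @[n --> \oo])%E).
  rewrite -monotone_convergence//=.
  - by apply: eq_integral => x _; apply/esym/cvg_lim => //=; exact: fl.
  - by move=> n; exact/measurable_EFinP/measurable_funTS.
  - by move=> n x _; rewrite lee_fin.
  - by move=> x _ m n mn; rewrite lee_fin; exact/lefP/nd_nnsfun_approx.
under eq_fun do rewrite integral_weighted_nnsfun.
rewrite -monotone_convergence//=.
- apply: eq_integral => x _; apply/cvg_lim => //.
  by apply: cvgeZr => //; exact: fl.
- move=> n; apply: emeasurable_funM => //.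
  by apply/measurable_EFinP.
- by move=> n x _; rewrite mule_ge0 ?lee_fin.
- move=> x _ m n mn; rewrite lee_wpmul2r ?lee_fin//.
  exact/lefP/nd_nnsfun_approx.
Qed.

End Weighted.

Section Substitution.
Variable R : realType.
Variables (phi : R -> R) (a b : R).
Hypotheses (ab : a <= b) (sphi : smooth phi) (dphi0 : forall t, 0 <= derive1 phi t).
Notation mu := (@lebesgue_measure R).
Notation c := (phi a).
Notation d := (phi b).

Lemma smooth_measurable (f : R -> R) : smooth f -> measurable_fun setT f.
Proof. by move=> sf; apply: continuous_measurable_fun; exact: smooth_continuous. Qed.

Lemma smooth_ndecr (f : R -> R) : smooth f -> (forall t, 0 <= derive1 f t) ->
  {homo f : s t / s <= t}.
Proof.
move=> sf df s t st; apply: (@ger0_derive1_ndecr _ f s t) => //.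
- by move=> x _; exact: smooth_derivable.
- exact/continuous_subspaceT/smooth_continuous.
Qed.

Lemma integral_smooth_derive (f : R -> R) (s t : R) : smooth f -> s <= t ->
  (\int[mu]_(x in `[s, t]) (derive1 f x)%:E = (f t - f s)%:E)%E.
Proof.
move=> sf st; apply: integral_derivative => //.
- by move=> x; exact: smooth_is_derive.
- exact/smooth_continuous/smooth_derive1.
Qed.

Let w (t : R) : R := derive1 phi t * \1_(`[a, b] : set R) t.

Let mdphi : measurable_fun setT (derive1 phi).
Proof. by apply: smooth_measurable; exact: smooth_derive1. Qed.

Let mw : measurable_fun setT w.
Proof.
by rewrite /w; apply: measurable_funM.
Qed.

Let w0 t : 0 <= w t.
Proof. by rewrite mulr_ge0. Qed.

Let W := weighted mu mw w0.

Let WE (D : set R) : measurable D ->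
  W D = (\int[mu]_(x in D `&` `[a, b]) (derive1 phi x)%:E)%E.
Proof.
move=> mD; rewrite /W /weighted integral_mkcondr; apply: eq_integral => x _.
by rewrite epatch_indic /w EFinM.
Qed.

Let mphi : measurable_fun setT phi.
Proof. exact: smooth_measurable. Qed.

Let mphi_pre (D : set R) : measurable D -> measurable (phi @^-1` D).
Proof. by move=> mD; rewrite -[_ @^-1` _]setTI; exact: mphi. Qed.

Let W_itv s t : a <= s -> s <= t -> t <= b -> W `[s, t] = (phi t - phi s)%:E.
Proof.
move=> as_ st tb; rewrite WE// setIidl; first exact: integral_smooth_derive.
by move=> x /=; rewrite !in_itv/=; lra.
Qed.

Let ivt x : c <= x <= d -> exists2 s, a <= s <= b & phi s = x.
Proof.
move=> /andP[cx xd].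
have [||s sI sx] := @IVT _ phi a b x ab.
- exact/continuous_subspaceT/smooth_continuous.
- have cd := le_trans cx xd.
  by rewrite (min_idPl cd) (max_idPr cd) cx xd.
- by exists s => //; move: sI; rewrite in_itv.
Qed.

Let W_pre x : W (phi @^-1` `[x, +oo[) = mu (`[c, d] `&` `[x, +oo[).
Proof.
have phim := smooth_ndecr sphi dphi0.
have mpre z : measurable (phi @^-1` `[z, +oo[ : set R) by apply: mphi_pre.
have [xc|cx] := leP x c.
  rewrite setIidl; last by move=> y /=; rewrite !in_itv/=; lra.
  rewrite lebesgue_measure_itv/= lte_fin.
  have -> : W (phi @^-1` `[x, +oo[) = W `[a, b].
    rewrite !WE//; congr (integral _ _ _); apply/seteqP; split => t /=.
      by move=> [_ tab].
    rewrite !in_itv/= => -[tab _]; split => //; rewrite andbT.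
    by rewrite (le_trans xc)// phim//; case/andP: tab.
  rewrite W_itv//; case: ltP => // dc.
  by have := phim _ _ ab; move=> cd; rewrite (@le_anti _ _ c d) ?subrr// cd dc.
have [xd|dx] := leP x d; last first.
  rewrite (_ : _ `&` _ = set0) ?measure0; last first.
    by apply/seteqP; split => y //=; rewrite !in_itv/=; lra.
  rewrite WE// (_ : _ `&` _ = set0) ?integral_set0//.
  apply/seteqP; split => y //=; rewrite !in_itv/= andbT => -[xy /andP[ay yb]].
  by have := phim _ _ yb; lra.
have cxd : c <= x <= d by rewrite (ltW cx) xd.
have -> : `[c, d] `&` `[x, +oo[ = `[x, d]%classic.
  by apply/seteqP; split => y /=; rewrite !in_itv/=; lra.
have -> : mu `[x, d] = (d - x)%:E.
  rewrite lebesgue_measure_itv/= lte_fin; case: ltP => // dx.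
  by rewrite (@le_anti _ _ x d) ?subrr// xd dx.
apply/eqP; rewrite eq_le; apply/andP; split; last first.
  have [s /andP[as_ sb] sx] := ivt cxd.
  rewrite -sx -W_itv//; apply: le_measure; rewrite ?inE//; first exact: mpre.
  by move=> t /=; rewrite !in_itv/= sx andbT => /andP[st _]; rewrite -sx phim.
(* A flat stretch of [phi] at level [x] may extend the preimage to the left of a chosen [s] with
   [phi s = x]; it is therefore enclosed by a slightly lower level [x'], at the price of [e]. *)
apply/lee_addgt0Pr => e e0.
pose x' := Num.max c (x - e).
have x'x : x' < x by rewrite /x' gt_max cx/=; lra.
have cx' : c <= x' by rewrite /x' le_max lexx.
have xex' : x - e <= x' by rewrite /x' le_max lexx orbT.
have [|s /andP[as_ sb] sx] := @ivt x'; first by rewrite cx' (le_trans (ltW x'x)).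
apply: (@le_trans _ _ (W `[s, b])); last by rewrite W_itv// sx -EFinD lee_fin; lra.
rewrite WE// [leRHS]WE//; apply: ge0_subset_integral => //.
- by apply: measurableI => //; exact: mpre.
- exact: measurableI.
- exact/measurable_EFinP/measurable_funTS.
- by move=> t _; rewrite lee_fin.
move=> t /=; rewrite !in_itv/= andbT => -[xt /andP[at_ tb]]; rewrite at_ tb.
split => //; rewrite andbT leNgt; apply/negP => ts.
by have := phim _ _ (ltW ts); rewrite sx; lra.
Qed.

(** [phi] may be constant on intervals and [f] is only measurable, so measures are compared instead
    of functions: Lebesgue measure on the image interval and the pushforward of [phi' dt] agree on
    closed half-lines, a generating family stable under intersection. *)
Lemma integral_substitution (f : R -> \bar R) :
  measurable_fun `[c, d] f -> (forall x, `[c, d]%classic x -> (0 <= f x)%E) ->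
  (\int[mu]_(t in `[a, b]) (f (phi t) * (derive1 phi t)%:E) =
   \int[mu]_(x in `[c, d]) f x)%E.
Proof.
move=> mf f0; have mcd : measurable (`[c, d] : set R) by [].
have mI : measurable_fun setT (\1_(`[c, d] : set R) : R -> R) by [].
have I0 x : 0 <= (\1_(`[c, d] : set R) : R -> R) x by [].
pose m1 : {measure set (measurableTypeR R) -> \bar R} := weighted mu mI I0.
have m1E A : measurable A -> m1 A = mu (A `&` `[c, d]).
  by move=> mA; rewrite /m1/= /weighted integral_indic// setIC.
have mphiR : @measurable_fun _ _ (measurableTypeR R) (measurableTypeR R) setT phi.
  exact: mphi.
pose m2 : {measure set (measurableTypeR R) -> \bar R} :=
  measure_function_pushforward__canonical__measure_function_Measure
    (weighted mu mw w0) mphiR.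
have GI : setI_closed (@RGenCInfty.G R).
  move=> _ _ [x ->] [y ->]; exists (Num.max x y).
  by apply/seteqP; split => z /=; rewrite !in_itv/= !andbT ge_max => /andP.
pose g (k : nat) : set R := `[- k%:R, +oo[%classic.
have Gg k : RGenCInfty.G (g k) by exists (- k%:R).
have g_cover : \bigcup_k g k = setT.
  apply/seteqP; split => // x _.
  exists (Num.bound `|x|) => //; rewrite /g /= in_itv/= andbT lerNl.
  apply: le_trans (ltW (archi_boundP (normr_ge0 x))).
  by rewrite -normrN ler_norm.
have m12G A : RGenCInfty.G A -> m1 A = m2 A.
  by move=> [x ->]; rewrite m1E// setIC -W_pre.
have m1oo k : (m1 (g k) < +oo)%E.
  have gcd : (mu (g k `&` `[c, d]) <= mu `[c, d])%E.
    have mg : measurable (g k `&` `[c, d]) by apply: measurableI => //; rewrite /g.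
    by apply: le_measure; rewrite ?inE//; exact: subIsetr.
  have mgk : measurable (g k) by rewrite /g.
  rewrite (m1E _ mgk); apply: (le_lt_trans gcd).
  by rewrite lebesgue_measure_itv/=; case: ifP => _; rewrite ltry.
have m12 A : measurable A -> m1 A = m2 A.
  exact: (@measure_unique _ R (measurableTypeR R) _ g (@RGenCInfty.measurableE R)
    GI Gg g_cover m1 m2 m12G m1oo).
pose f1 := f \_ `[c, d].
have mf1 : measurable_fun setT f1.
  have mcd' : measurable (`[c, d] : set R) by [].
  exact: (measurable_restrictT f mcd').1 mf.
have f10 x : (0 <= f1 x)%E by apply: erestrict_ge0.
rewrite [RHS]integral_mkcond -/f1.
have -> : (\int[mu]_x f1 x = \int[m1]_x f1 x)%E.
  rewrite integral_weighted//; apply: eq_integral => x _.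
  rewrite /f1 patchE indicE; case: ifPn => xcd; rewrite ?mule0//.
  by rewrite mule1.
transitivity (\int[m2]_x f1 x)%E; last first.
  by apply: eq_measure_integral => A mA _; rewrite m12.
rewrite ge0_integral_pushforward//= preimage_setT integral_weighted//; last first.
  exact: measurableT_comp.
rewrite [LHS]integral_mkcond; apply: eq_integral => t _.
rewrite patchE /w indicE /f1 /= patchE; case: ifPn => tab; last first.
  by rewrite mulr0 mule0.
rewrite mulr1 ifT//; move: tab; rewrite !inE/= !in_itv/= => /andP[at_ tb].
by rewrite !smooth_ndecr.
Qed.

End Substitution.

(** * Weighted graphs *)

Section WeightedGraph.
Variables (R : realType) (X : finType).
Implicit Types (c : X -> X -> R) (phi psi f : X -> R).

Lemma sum_CauchySchwarz (I : finType) (w a b : I -> R) : (forall i, 0 <= w i) ->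
  (\sum_i w i * (a i * b i)) ^+ 2 <=
  (\sum_i w i * a i ^+ 2) * (\sum_i w i * b i ^+ 2).
Proof.
move=> w0; set S := \sum_i w i * (a i * b i).
set P := \sum_i w i * a i ^+ 2; set Q := \sum_i w i * b i ^+ 2.
have Q0 : 0 <= Q by apply: sumr_ge0 => i _; rewrite mulr_ge0// sqr_ge0.
have [QE|Qn] := eqVneq Q 0.
  have S0 : S = 0.
    apply: big1 => i _.
    have /eqP := psumr_eq0P (fun i _ => mulr_ge0 (w0 i) (sqr_ge0 (b i))) QE (erefl : xpredT i).
    by rewrite mulf_eq0 sqrf_eq0 => /orP[] /eqP ->; rewrite ?mul0r// !mulr0.
  by rewrite S0 QE mulr0 expr0n.
have Qp : 0 < Q by rewrite lt0r Qn.
(* The weighted sum of squares of [Q a - S b] expands to [Q (P Q - S^2)], and [Q > 0] can be divided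
   out. *)
have : 0 <= \sum_i w i * (Q * a i - S * b i) ^+ 2.
  by apply: sumr_ge0 => i _; rewrite mulr_ge0// sqr_ge0.
have E q r : \sum_i w i * (q * a i - r * b i) ^+ 2 =
    q ^+ 2 * P - 2 * q * r * S + r ^+ 2 * Q.
  rewrite /P /S /Q !mulr_sumr -sumrN -!big_split/=.
  by apply: eq_bigr => i _; ring.
have -> : \sum_i w i * (Q * a i - S * b i) ^+ 2 = Q * (P * Q - S ^+ 2).
  by rewrite E; ring.
by rewrite pmulr_rge0// subr_ge0.
Qed.

Definition graph_form c phi psi : R :=
  2^-1 * \sum_x \sum_y (phi y - phi x) * (psi y - psi x) * c x y.

Definition graph_div c psi (x : X) : R := \sum_y (psi y - psi x) * c x y.

(** Discrete integration by parts: exchange [x] and [y] in the double sum, which symmetry of [c]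
    allows, and average the two expressions. *)
Lemma graph_form_green c phi psi : (forall x y, c x y = c y x) ->
  \sum_x phi x * graph_div c psi x = - graph_form c phi psi.
Proof.
move=> cC; rewrite /graph_form /graph_div.
set A := \sum_x phi x * _.
have AE : A = \sum_x \sum_y phi x * ((psi y - psi x) * c x y).
  by apply: eq_bigr => x _; rewrite mulr_sumr.
have AE' : A = \sum_x \sum_y - (phi y * ((psi y - psi x) * c x y)).
  rewrite AE exchange_big/=; apply: eq_bigr => x _; apply: eq_bigr => y _.
  by rewrite (cC y x); ring.
have A2 : A + A = - \sum_x \sum_y (phi y - phi x) * (psi y - psi x) * c x y.
  rewrite {1}AE AE' -big_split -sumrN; apply: eq_bigr => x _ /=.
  by rewrite -big_split -sumrN; apply: eq_bigr => y _ /=; ring.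
lra.
Qed.

Lemma graph_form_ge0 c phi : (forall x y, 0 <= c x y) -> 0 <= graph_form c phi phi.
Proof.
move=> c0; rewrite mulr_ge0// sumr_ge0// => x _; rewrite sumr_ge0// => y _.
by rewrite mulr_ge0// -expr2 sqr_ge0.
Qed.

Lemma graph_form_CauchySchwarz c phi psi : (forall x y, 0 <= c x y) ->
  graph_form c phi psi ^+ 2 <= graph_form c phi phi * graph_form c psi psi.
Proof.
move=> c0.
have E f g : graph_form c f g = \sum_(p : X * X)
    2^-1 * c p.1 p.2 * ((f p.2 - f p.1) * (g p.2 - g p.1)).
  rewrite -(pair_bigA _ (fun x y => 2^-1 * c x y * ((f y - f x) * (g y - g x))))/=.
  rewrite /graph_form mulr_sumr; apply: eq_bigr => x _; rewrite mulr_sumr.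
  by apply: eq_bigr => y _; ring.
rewrite !E; under [X in _ <= X * _]eq_bigr do rewrite -expr2.
under [X in _ <= _ * X]eq_bigr do rewrite -expr2.
by apply: sum_CauchySchwarz => p; rewrite mulr_ge0.
Qed.

Lemma graph_form_mono c c' phi : (forall x y, c x y <= c' x y) ->
  graph_form c phi phi <= graph_form c' phi phi.
Proof.
move=> cc; rewrite ler_wpM2l// ler_sum// => x _; rewrite ler_sum// => y _.
by rewrite ler_wpM2l// -expr2 sqr_ge0.
Qed.

Lemma graph_formZ (m : R) c phi psi :
  graph_form (fun x y => m * c x y) phi psi = m * graph_form c phi psi.
Proof.
rewrite /graph_form mulrCA; congr (_ * _); rewrite mulr_sumr; apply: eq_bigr => x _.
by rewrite mulr_sumr; apply: eq_bigr => y _; ring.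
Qed.

Lemma graph_form_edge c phi x y : (forall x y, 0 <= c x y) ->
  (phi x - phi y) ^+ 2 * c x y <= 2 * graph_form c phi phi.
Proof.
move=> c0; rewrite /graph_form mulrA divff ?mul1r ?pnatr_eq0//.
rewrite (bigD1 x)//= (bigD1 y)//= -addrA -expr2 -[phi y - phi x]opprB sqrrN lerDl.
rewrite addr_ge0// sumr_ge0// => z _; first by rewrite mulr_ge0// -expr2 sqr_ge0.
by rewrite sumr_ge0// => u _; rewrite mulr_ge0// -expr2 sqr_ge0.
Qed.

(** Induction along a path with [(a - b)^2 <= 2 (a - z)^2 + 2 (z - b)^2]; the first edge costs
    [2 / c x z] by [graph_form_edge], hence the constant [4 / c x z + 2 C]. *)
Lemma graph_form_pair c x y : (forall x y, 0 <= c x y) ->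
  connect (fun a b => 0 < c a b) x y ->
  exists2 C, 0 <= C & forall phi, (phi x - phi y) ^+ 2 <= C * graph_form c phi phi.
Proof.
move=> c0 /connectP[p]; elim: p x => [|z p IH] x /=.
  by move=> _ ->; exists 0 => // phi; rewrite subrr expr0n mul0r.
move=> /andP[xz zp] yl; have [C C0 HC] := IH z zp yl.
exists (4 / c x z + 2 * C) => [|phi].
  by rewrite addr_ge0// ?mulr_ge0// ?invr_ge0 ?ltW.
have h1 := graph_form_edge phi x z c0; have h2 := HC phi.
have h1' : (phi x - phi z) ^+ 2 <= 2 / c x z * graph_form c phi phi.
  by rewrite mulrAC ler_pdivlMr.
have h3 := sqr_ge0 ((phi x - phi z) - (phi z - phi y)).
have -> : (4 / c x z + 2 * C) * graph_form c phi phi =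
    2 * (2 / c x z * graph_form c phi phi) + 2 * (C * graph_form c phi phi) by ring.
move: h1' h2 h3; move: (2 / c x z * _) (C * _) => u v.
move: (phi x) (phi y) (phi z) => a b d; nra.
Qed.

(** Since [f] sums to 0, [phi] may be recentred at a base point, and the sum of all pair constants
    bounds every difference. This dual form of a Poincare inequality is what bounds the speed of a
    segment. *)
Lemma graph_form_poincare c : (forall x y, 0 <= c x y) ->
  (forall x y, connect (fun a b => 0 < c a b) x y) ->
  exists2 C, 0 <= C & forall phi f, \sum_x f x = 0 ->
    (\sum_x f x * phi x) ^+ 2 <= C * (\sum_x `|f x|) ^+ 2 * graph_form c phi phi.
Proof.
move=> c0 cc.
have /choice[C HC] : forall p : X * X, exists C : R, 0 <= C /\ forall phi,
    (phi p.1 - phi p.2) ^+ 2 <= C * graph_form c phi phi.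
  by move=> [x y]; have [C C0 h] := graph_form_pair c0 (cc x y); exists C.
pose M := \sum_p C p; exists M => [|phi f f0].
  by apply: sumr_ge0 => p _; have [] := HC p.
have F0 := graph_form_ge0 phi c0.
have hM x y : (phi x - phi y) ^+ 2 <= M * graph_form c phi phi.
  apply: le_trans ((HC (x, y)).2 phi) _; rewrite ler_wpM2r//.
  rewrite /M (bigD1 (x, y))//= lerDl sumr_ge0// => p _.
  by have [] := HC p.
have M0 : 0 <= M by apply: sumr_ge0 => p _; have [] := HC p.
case: (pickP X) => [x0 _|noX]; last first.
  have -> : \sum_x f x * phi x = 0 by apply: big1 => x _; have := noX x.
  rewrite expr0n/=; apply: mulr_ge0 => //; apply: mulr_ge0 => //; exact: sqr_ge0.
have -> : \sum_x f x * phi x = \sum_x f x * (phi x - phi x0).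
  under [RHS]eq_bigr do rewrite mulrBr.
  by rewrite sumrB -mulr_suml f0 mul0r subr0.
set s := Num.sqrt (M * graph_form c phi phi).
have : `|\sum_x f x * (phi x - phi x0)| <= (\sum_x `|f x|) * s.
  apply: le_trans (ler_norm_sum _ _ _) _.
  rewrite mulr_suml ler_sum// => x _; rewrite normrM ler_wpM2l//.
  by rewrite -sqrtr_sqr ler_sqrt// mulr_ge0.
move=> h; rewrite -real_normK ?num_real//.
have -> : M * (\sum_x `|f x|) ^+ 2 * graph_form c phi phi =
   ((\sum_x `|f x|) * s) ^+ 2.
  have s2 : s ^+ 2 = M * graph_form c phi phi by rewrite sqr_sqrtr// mulr_ge0.
  by rewrite exprMn s2; ring.
by rewrite lerXn2r// ?nnegrE// mulr_ge0 ?sqrtr_ge0// sumr_ge0.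
Qed.

(* Adding the all-ones matrix to the graph Laplacian makes it invertible. *)
Definition laplace_mx c : 'M[R]_#|X| := \matrix_(i, j)
  ((i == j)%:R * (\sum_y c (enum_val i) y) - c (enum_val i) (enum_val j) + 1).

Lemma sum_enum_val (F : X -> R) : \sum_(i < #|X|) F (enum_val i) = \sum_x F x.
Proof.
rewrite (reindex (@enum_rank X)) /=; last exact/onW_bij/enum_rank_bij.
by apply: eq_bigr => x _; rewrite enum_rankK.
Qed.

Lemma laplace_mxE c psi i : \sum_j laplace_mx c i j * psi (enum_val j) =
  - graph_div c psi (enum_val i) + \sum_x psi x.
Proof.
under eq_bigr do rewrite mxE mulrDl mulrBl mul1r.
rewrite big_split sumrB/= (sum_enum_val psi); congr (_ + _).
have -> : \sum_(j < #|X|) (i == j)%:R * (\sum_y c (enum_val i) y) * psi (enum_val j)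
    = (\sum_y c (enum_val i) y) * psi (enum_val i).
  rewrite (bigD1 i)//= eqxx mul1r -[RHS]addr0; congr (_ + _).
  by apply: big1 => j ji; rewrite eq_sym (negbTE ji) !mul0r.
rewrite (sum_enum_val (fun y => c (enum_val i) y * psi y)) mulr_suml.
rewrite /graph_div -sumrB -sumrN.
by apply: eq_bigr => y _; ring.
Qed.

Section Connected.
Variable c : X -> X -> R.
Hypotheses (c0 : forall x y, 0 <= c x y) (cC : forall x y, c x y = c y x).
Hypothesis cc : forall x y, connect (fun a b => 0 < c a b) x y.

Lemma sum_graph_div psi : \sum_x graph_div c psi x = 0.
Proof.
have := graph_form_green (fun=> 1) psi cC.
under eq_bigr do rewrite mul1r; move=> ->.
rewrite /graph_form big1 ?mulr0 ?oppr0// => x _; rewrite big1// => y _.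
by rewrite subrr !mul0r.
Qed.

(** Summing the equation over [x] kills the divergence and leaves [#|X|] times the sum of [psi]; so
    the all-ones shift contributes nothing. *)
Lemma laplace_eq psi f : \sum_x f x = 0 ->
  (forall x, - graph_div c psi x + \sum_x psi x = f x) ->
  \sum_x psi x = 0 /\ forall x, graph_div c psi x = - f x.
Proof.
move=> f0 E.
have s0 : \sum_x psi x = 0.
  have : \sum_x (- graph_div c psi x + \sum_x psi x) = 0.
    by rewrite -[RHS]f0; apply: eq_bigr => x _; exact: E.
  rewrite big_split sumrN/= sum_graph_div oppr0 add0r sumr_const => /eqP.
  case: (pickP X) => [x0 _|noX]; last first.
    by move=> _; apply: big1 => x _; have := noX x.
  rewrite mulrn_eq0 => /orP[|/eqP//]; rewrite -leqn0 leqNgt => /negP[].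
  by apply/card_gt0P; exists x0.
by split=> // x; rewrite -E s0 addr0 opprK.
Qed.

(** A kernel vector is divergence free with zero sum, so its form vanishes, it is constant on the
    connected graph, and it is 0. Since [det0P] gives a left kernel vector, symmetry of the matrix
    is used. *)
Lemma laplace_mx_det : \det (laplace_mx c) != 0.
Proof.
apply/negP => /det0P[v v0 vA]; move/negP: v0; apply.
pose psi x := v 0 (enum_rank x).
have LC : (laplace_mx c)^T = laplace_mx c.
  apply/matrixP => i j; rewrite !mxE (cC (enum_val j)) eq_sym.
  by case: eqVneq => [->//|_]; rewrite !mul0r.
have z0 : \sum_(x : X) (0 : R) = 0 by rewrite big1.
have [|s0 d0] := @laplace_eq psi (fun=> 0) z0.
  move=> x; have /matrixP/(_ 0 (enum_rank x)) := vA; rewrite !mxE => vx.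
  rewrite -[x in graph_div _ _ x]enum_rankK -laplace_mxE -[RHS]vx.
  by apply: eq_bigr => j _; rewrite -{1}LC mxE /psi enum_valK mulrC.
have F0 : graph_form c psi psi = 0.
  apply/eqP; rewrite -oppr_eq0 -graph_form_green// big1// => x _.
  by rewrite d0 oppr0 mulr0.
have psic x y : psi x = psi y.
  have [C C0 h] := graph_form_pair c0 (cc x y).
  have := h psi; rewrite F0 mulr0 => h'.
  have : (psi x - psi y) ^+ 2 == 0 by rewrite eq_le h' sqr_ge0.
  by rewrite sqrf_eq0 subr_eq0 => /eqP.
apply/eqP/rowP => i; rewrite mxE.
have := s0; rewrite (eq_bigr (fun=> psi (enum_val i))) => [|x _]; last exact: psic.
rewrite sumr_const /psi enum_valK => /eqP; rewrite mulrn_eq0 => /orP[|/eqP//].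
rewrite -leqn0 leqNgt => /negP[].
by apply/card_gt0P; exists (enum_val i).
Qed.

(** Cramer's rule: determinant and adjugate are polynomials in the weights, which makes the
    potential measurable in time. *)
Definition laplace_sol f (x : X) : R :=
  (\det (laplace_mx c))^-1 *
    \sum_j (\adj (laplace_mx c)) (enum_rank x) j * f (enum_val j).

Lemma laplace_solP f x : \sum_x f x = 0 -> graph_div c (laplace_sol f) x = - f x.
Proof.
move=> f0; have [|_ ->//] := @laplace_eq (laplace_sol f) f f0.
move=> {}x; rewrite -[in LHS](enum_rankK x) -laplace_mxE.
set L := laplace_mx c; pose F : 'cV[R]_#|X| := \col_j f (enum_val j).
have := mul_mx_adj L; move/(congr1 (fun M => M *m F)).
rewrite -mulmxA mul_scalar_mx => /matrixP/(_ (enum_rank x) 0).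
rewrite !mxE enum_rankK => h.
apply: (mulfI laplace_mx_det); rewrite -h mulr_sumr; apply: eq_bigr => j _.
rewrite /laplace_sol -/L mulrCA mulVKf ?laplace_mx_det// !mxE; congr (_ * _).
by rewrite enum_valK; apply: eq_bigr => k _; rewrite [F k 0]mxE.
Qed.

End Connected.

End WeightedGraph.

(** * Transport along segments *)

Lemma measurable_det d (T : measurableType d) (R : realType) (D : set T) n
    (A : T -> 'M[R]_n) : (forall i j, measurable_fun D (fun t => A t i j)) ->
  measurable_fun D (fun t => \det (A t)).
Proof.
move=> mA; apply: measurable_sum => s.
by apply: measurable_funM => //; apply: measurable_prod => i _.
Qed.

Lemma measurable_adj d (T : measurableType d) (R : realType) (D : set T) n
    (A : T -> 'M[R]_n) i j : (forall i j, measurable_fun D (fun t => A t i j)) ->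
  measurable_fun D (fun t => (\adj (A t)) i j).
Proof.
move=> mA.
have -> : (fun t => (\adj (A t)) i j) =
    fun t => (-1) ^+ (j + i) * \det (row' j (col' i (A t))).
  by apply/funext => t; rewrite mxE.
apply: measurable_funM => //; apply: measurable_det => k l.
have -> : (fun t => row' j (col' i (A t)) k l) = fun t => A t (lift j k) (lift i l).
  by apply/funext => t; rewrite !mxE.
exact: mA.
Qed.

Lemma measurable_laplace_sol d (T : measurableType d) (R : realType) (X : finType)
    (D : set T) (c : T -> X -> X -> R) (f : T -> X -> R) x :
  (forall x y, measurable_fun D (fun t => c t x y)) ->
  (forall x, measurable_fun D (f ^~ x)) ->
  measurable_fun D (fun t => laplace_sol (c t) (f t) x).
Proof.
move=> mc mf.
have mL i j : measurable_fun D (fun t => laplace_mx (c t) i j).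
  have -> : (fun t => laplace_mx (c t) i j) = fun t => (i == j)%:R *
      (\sum_y c t (enum_val i) y) - c t (enum_val i) (enum_val j) + 1.
    by apply/funext => t; rewrite mxE.
  apply: measurable_funD => //; apply: measurable_funB => //.
  by apply: measurable_funM => //; exact: measurable_sum.
apply: measurable_funM.
  by apply: (measurableT_comp (@measurable_invr R)); exact: measurable_det.
apply: measurable_sum => j; apply: measurable_funM => //.
exact: measurable_adj.
Qed.

Section Chain.
Variables (R : realType) (X : finType) (K : X -> X -> R) (pi : X -> R).
Implicit Types (rho phi psi : X -> R).

Definition edge rho (x y : X) : R := rho_hat rho x y * K x y * pi x.

Lemma action_densityE rho psi :
  action_density K pi rho psi = graph_form (edge rho) psi psi.
Proof.
congr (_ * _); apply: eq_bigr => x _; apply: eq_bigr => y _.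
by rewrite /edge expr2 !mulrA.
Qed.

Hypotheses (hK : markov_kernel K) (hirr : irreducible_kernel K)
  (hpi : prob_vector pi) (hstat : stationary K pi) (hrev : reversible K pi).

Lemma kernel_ge0 x y : 0 <= K x y.
Proof. by case: hK. Qed.

(** Some point has positive mass, and stationarity carries it along each edge of a path. *)
Lemma stationary_gt0 x : 0 < pi x.
Proof.
have [pi0 pi1] := hpi.
have [x0 x00] : exists x0, 0 < pi x0.
  apply: contrapT => npi; have : \sum_x pi x = 0.
    apply: big1 => y _; apply/eqP; rewrite eq_le pi0 andbT leNgt; apply/negP => py.
    by apply: npi; exists y.
  by rewrite pi1 => /eqP; rewrite oner_eq0.
have /connectP[p] := hirr x0 x; elim: p x0 x00 => [|z p IH] y y0 /=.
  by move=> _ ->.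
move=> /andP[yz zp] xl; apply: (IH z) => //.
rewrite -(hstat z) (bigD1 y)//= ltr_wpDr ?mulr_gt0//.
by apply: sumr_ge0 => u _; rewrite mulr_ge0 ?kernel_ge0.
Qed.

Lemma edge_ge0 rho x y : 0 <= edge rho x y.
Proof. by rewrite !mulr_ge0 ?kernel_ge0 ?log_mean_ge0// ltW ?stationary_gt0. Qed.

Lemma edgeC rho : (forall x, 0 <= rho x) -> forall x y, edge rho x y = edge rho y x.
Proof.
by move=> r0 x y; rewrite /edge /rho_hat -!mulrA hrev log_meanC.
Qed.

(** The logarithmic mean is monotone and homogeneous of degree 1. Through this comparison the
    kinetic form of a moving density is replaced by that of a fixed one. *)
Lemma edge_mono (m : R) rho rho' : 0 <= m -> (forall x, 0 <= rho' x) ->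
  (forall x, m * rho' x <= rho x) ->
  forall x y, m * edge rho' x y <= edge rho x y.
Proof.
move=> m0 r'0 rr x y; rewrite /edge !mulrA.
rewrite ler_wpM2r ?(ltW (stationary_gt0 _))// ler_wpM2r ?kernel_ge0//.
by rewrite /rho_hat -log_meanZ// log_mean_mono// mulr_ge0.
Qed.

Lemma connect_edge rho : (forall x, 0 < rho x) ->
  forall x y, connect (fun a b => 0 < edge rho a b) x y.
Proof.
move=> r0 x y; have := hirr x y; apply: connect_sub => a b ab; apply: connect1.
by rewrite !mulr_gt0 ?stationary_gt0// log_mean_gt0.
Qed.

Lemma edge_one x y : edge density_one x y = K x y * pi x.
Proof. by rewrite /edge /rho_hat /density_one log_mean_id// mul1r. Qed.

Lemma dirichletE phi psi : dirichlet K pi phi psi = graph_form (edge density_one) phi psi.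
Proof.
congr (_ * _); apply: eq_bigr => x _; apply: eq_bigr => y _.
by rewrite edge_one; ring.
Qed.

Lemma measurable_edge (D : set R) (rho : R -> X -> R) x y : measurable D ->
  (forall t z, D t -> 0 <= rho t z) -> (forall z, measurable_fun D (rho ^~ z)) ->
  measurable_fun D (fun t => edge (rho t) x y).
Proof.
move=> mD r0 mr; apply: measurable_funM => //; apply: measurable_funM => //.
by apply: measurable_log_mean => // t Dt; exact: r0.
Qed.

Lemma measurable_action (D : set R) (rho psi : R -> X -> R) : measurable D ->
  (forall t z, D t -> 0 <= rho t z) -> (forall z, measurable_fun D (rho ^~ z)) ->
  (forall z, measurable_fun D (psi ^~ z)) ->
  measurable_fun D (fun t => action_density K pi (rho t) (psi t)).
Proof.
move=> mD r0 mr mp; under eq_fun do rewrite action_densityE.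
apply: measurable_funM => //; apply: measurable_sum => x; apply: measurable_sum => y.
apply: measurable_funM; last exact: measurable_edge.
by apply: measurable_funM; apply: measurable_funB.
Qed.

Lemma action_ge0 rho psi : 0 <= action_density K pi rho psi.
Proof. by rewrite action_densityE graph_form_ge0//; exact: edge_ge0. Qed.

Lemma smooth01_smooth (f g : R -> R) : smooth g ->
  (forall t : R, 0 <= t <= 1 -> f t = g t) -> smooth01 f.
Proof. by move=> [sg] fg; exists g. Qed.

Lemma W2_le_action (s0 s1 : X -> R) (rho psi : R -> X -> R) :
  continuity_pair K pi s0 s1 rho psi ->
  (W2 K pi s0 s1 <= \int[lebesgue_measure]_(t in `[0%R, 1%R])
    (action_density K pi (rho t) (psi t))%:E)%E.
Proof. by move=> cp; apply: ereal_inf_lbound; exists rho, psi. Qed.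

(* The speed of the segment only has to be bounded against test functions: the
   potential realizing it is obtained by inverting the weighted Laplacian. *)
Lemma W2_segment_le (s0 s1 : X -> R) (c : R -> R) (A : R) : 0 <= A ->
  density pi s0 -> density pi s1 -> smooth c -> c 0 = 0 -> c 1 = 1 ->
  (forall t, 0 <= t <= 1 -> 0 <= c t <= 1) ->
  (forall t, 0 < t < 1 ->
    (forall x, 0 < s0 x + c t * (s1 x - s0 x)) /\
    forall phi, (derive1 c t * \sum_x pi x * (s1 x - s0 x) * phi x) ^+ 2 <=
      A * graph_form (edge (fun x => s0 x + c t * (s1 x - s0 x))) phi phi) ->
  (W2 K pi s0 s1 <= A%:E)%E.
Proof.
move=> A0 [s00 s01] [s10 s11] sc c0 c1 c01 H.
pose rho t x := s0 x + c t * (s1 x - s0 x).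
pose f t x := pi x * (derive1 c t * (s1 x - s0 x)).
(* At times 0 and 1 the density may vanish somewhere and the Laplacian may be singular; the
   potential is set to 0 there, and the continuity equation only concerns the open interval. *)
pose psi (t : R) x := (\1_(`]0, 1[ : set R) t : R) * laplace_sol (edge (rho t)) (f t) x.
have srho x : smooth (rho ^~ x).
  have -> : rho ^~ x = fun t => s0 x + (s1 x - s0 x) * c t.
    by apply/funext => t; rewrite /rho mulrC.
  exact: smooth_affine.
have rho0 t x : 0 <= t <= 1 -> 0 <= rho t x.
  move=> /c01/andP[c0t ct1].
  have -> : rho t x = (1 - c t) * s0 x + c t * s1 x by rewrite /rho; ring.
  by rewrite addr_ge0// mulr_ge0// subr_ge0.
have dsum : \sum_x pi x * (s1 x - s0 x) = 0.
  by under eq_bigr do rewrite mulrBr; rewrite sumrB s01 s11 subrr.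
have f0 t : \sum_x f t x = 0.
  rewrite /f; under eq_bigr do rewrite mulrCA.
  by rewrite -mulr_sumr dsum mulr0.
have psiE t x : 0 < t < 1 -> psi t x = laplace_sol (edge (rho t)) (f t) x.
  by move=> t01; rewrite /psi indicE mem_set ?mul1r//= in_itv.
have mI : measurable (`[0, 1] : set R) by [].
have mrho x : measurable_fun (`[0, 1] : set R) (rho ^~ x : R -> R).
  by apply: measurable_funTS; exact: smooth_measurable.
have rhoD (t : R) z : `[0, 1]%classic t -> 0 <= rho t z.
  by rewrite /= in_itv/=; exact: rho0.
have mpsi x : measurable_fun (`[0, 1] : set R) (psi ^~ x : R -> R).
  apply: measurable_funM; first by apply: measurable_funTS; exact: measurable_indic.
  apply: measurable_laplace_sol => [y z|y]; first exact: measurable_edge.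
  apply: measurable_funM => //; apply: measurable_funM => //.
  by apply: measurable_funTS; apply: smooth_measurable; exact: smooth_derive1.
have div t x : 0 < t < 1 -> graph_div (edge (rho t)) (psi t) x = - f t x.
  move=> t01; have [rp _] := H t t01.
  have -> : psi t = laplace_sol (edge (rho t)) (f t).
    by apply/funext => y; rewrite psiE.
  apply: laplace_solP => //.
  - exact: edge_ge0.
  - by apply: edgeC => y; exact/ltW/rp.
  - exact: connect_edge.
have act t : 0 <= t <= 1 -> action_density K pi (rho t) (psi t) <= A.
  have psi0 : ~~ (0 < t < 1) -> psi t = fun=> 0.
    move=> t01; apply/funext => x; rewrite /psi indicE memNset ?mul0r//=.
    by rewrite in_itv/=; exact/negP.
  have [t01 _|t01 _] := boolP (0 < t < 1); last first.
    rewrite action_densityE psi0// /graph_form big1 ?mulr0// => x _.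
    by rewrite big1// => y _; rewrite subrr !mul0r.
  (* The hypothesis is tested with the potential itself: its left side becomes the square of the
     action [a], so [a^2 <= A a] and [a <= A]. *)
  have [rp Hd] := H t t01; have := Hd (psi t).
  rewrite action_densityE; set a := graph_form _ _ _.
  have a0 : 0 <= a by apply: graph_form_ge0; exact: edge_ge0.
  have -> : derive1 c t * \sum_x pi x * (s1 x - s0 x) * psi t x = a.
    have := graph_form_green (psi t) (psi t) (@edgeC (rho t) (fun x => ltW (rp x))).
    rewrite -/a; under eq_bigr do rewrite div//.
    move/(congr1 -%R); rewrite opprK => <-; rewrite mulr_sumr -sumrN.
    by apply: eq_bigr => x _; rewrite /f; ring.
  rewrite -/a; move: a0; rewrite le_eqVlt => /predU1P[<-//|ap].
  by rewrite expr2 ler_pM2r.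
apply: (@le_trans _ _ (\int[lebesgue_measure]_(t in `[0%R, 1%R])
    (action_density K pi (rho t) (psi t))%:E)%E).
  apply: W2_le_action; split.
  - by move=> x; exact: (smooth01_smooth (srho x)).
  - move=> t t01; split => [x|]; first exact: rho0.
    rewrite /rho; under eq_bigr do rewrite mulrDr mulrCA.
    by rewrite big_split/= -mulr_sumr s01 dsum mulr0 addr0.
  - split; apply/funext => x; rewrite /rho ?c0 ?c1; ring.
  - exact: mpsi.
  - move=> x t t01; have := div t x t01.
    rewrite /graph_div /f.
    have -> : derive1 (rho ^~ x) t = derive1 c t * (s1 x - s0 x).
      have -> : rho ^~ x = fun t => s0 x + (s1 x - s0 x) * c t.
        by apply/funext => u; rewrite /rho mulrC.
      rewrite derive1_affine; first by rewrite mulrC.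
      by move=> u; exact: smooth_derivable.
    (* The edge weights contain [pi x], so the divergence equation is the continuity equation
       multiplied by [pi x > 0]. *)
    move=> h; apply: (mulfI (lt0r_neq0 (stationary_gt0 x))); rewrite mulr0 mulrDr.
    apply/eqP; rewrite addr_eq0 -[_ * _ in X in X == _]opprK -h eqr_opp mulr_sumr.
    by apply/eqP; apply: eq_bigr => y _; rewrite /edge; ring.
apply: (@le_trans _ _ (\int[lebesgue_measure]_(t in `[0%R, 1%R]) (cst A%:E t))%E).
  apply: ge0_le_integral => //.
  - by move=> t _; rewrite lee_fin action_ge0.
  - by apply/measurable_EFinP; exact: measurable_action.
rewrite integral_cst//= lebesgue_measure_itv/= lte_fin ltr01 oppr0 adde0.
by rewrite mule1.
Qed.

End Chain.

(** * Transport along smooth curves *)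

Lemma derive1_sum (R : realType) (I : Type) (r : seq I) (F : I -> R -> R) (x : R) :
  (forall i, smooth (F i)) ->
  derive1 (fun x => \sum_(i <- r) F i x) x = \sum_(i <- r) derive1 (F i) x.
Proof.
move=> sF; elim: r => [|i r IH].
  have -> : (fun x => \sum_(i <- [::]) F i x) = fun=> 0.
    by apply/funext => y; rewrite big_nil.
  by rewrite derive1_cst big_nil.
have <- : (fun x => F i x + \sum_(j <- r) F j x) =
    fun x => \sum_(j <- i :: r) F j x.
  by apply/funext => y; rewrite big_cons.
have ss : smooth (fun x => \sum_(j <- r) F j x) by exact: smooth_sum.
rewrite (derive1D (fun t => @smooth_derivable _ _ t (sF i))
  (fun t => @smooth_derivable _ _ t ss)) big_cons.
by rewrite IH.
Qed.

Section Curves.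
Variables (R : realType) (X : finType) (K : X -> X -> R) (pi : X -> R).
Implicit Types (r : X -> R) (phi : X -> R) (g psi : R -> X -> R).
Notation mu := (@lebesgue_measure R).

(** Smoothness holds on the whole line, so that derivatives are two-sided everywhere and curves can
    be composed with clocks; the end points are left free. *)
Record smooth_curve g psi : Prop := SmoothCurve {
  curve_smooth : forall x, smooth (g ^~ x);
  curve_density : forall t : R, 0 <= t <= 1 -> density pi (g t);
  curve_measurable : forall x, measurable_fun (`[0, 1] : set R) (psi ^~ x : R -> R);
  curve_eq : forall x (t : R), 0 < t < 1 -> derive1 (g ^~ x) t
    + \sum_y (psi t y - psi t x) * rho_hat (g t) x y * K x y = 0 }.

Definition energy g psi : \bar R :=
  (\int[mu]_(t in `[0%R, 1%R]) (action_density K pi (g t) (psi t))%:E)%E.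

Lemma W2_le_energy g psi : smooth_curve g psi ->
  (W2 K pi (g 0%R) (g 1%R) <= energy g psi)%E.
Proof.
case=> gs gd gm ge; apply: ereal_inf_lbound; exists g, psi; split => //.
by split => // x; have [sg] := gs x; exists (g ^~ x).
Qed.

(** [smooth01] provides an extension of each coordinate. Replacing the curve by it changes neither
    the energy nor the equation, which is local in the open interval. *)
Lemma W2_lt_energy r0 r1 (w : \bar R) : (W2 K pi r0 r1 < w)%E ->
  exists g psi, [/\ smooth_curve g psi, g 0 = r0, g 1 = r1 & (energy g psi < w)%E].
Proof.
move=> /ereal_inf_lt[_ [rho [psi [[rs rd [r0E r1E] rm re] ->]]] lt].
have /choice[h hE] : forall x, exists h : R -> R,
    smooth h /\ forall t : R, 0 <= t <= 1 -> rho t x = h t.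
  by move=> x; have [h sh hE] := rs x; exists h.
pose g t x := h x t.
have gE t : 0 <= t <= 1 -> rho t = g t.
  by move=> t01; apply/funext => x; rewrite (hE x).2.
exists g, psi; split.
- split.
  + by move=> x; have [] := hE x.
  + by move=> t t01; rewrite -gE//; exact: rd.
  + exact: rm.
  + move=> x t t01; have <- : rho t = g t by apply: gE; case/andP: t01 => /ltW-> /ltW->.
    rewrite -[RHS](re x t t01); congr (_ + _); rewrite !derive1E.
    apply: near_eq_derive; case/andP: t01 => t0 t1.
    near=> u; rewrite gE//; apply/andP; split; apply/ltW; near: u.
      exact: lt_nbhsr.
    exact: lt_nbhsl.
- by rewrite -gE// lexx ler01.
- by rewrite -gE// lexx ler01.
- apply: le_lt_trans lt; rewrite le_eqVlt; apply/orP; left; apply/eqP.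
  by apply: eq_integral => t; rewrite inE/= in_itv/= => t01; rewrite gE.
Unshelve. all: by end_near. Qed.

Hypotheses (hK : markov_kernel K) (hirr : irreducible_kernel K)
  (hpi : prob_vector pi) (hstat : stationary K pi) (hrev : reversible K pi).

Lemma energy_ge0 g psi : (0 <= energy g psi)%E.
Proof. by apply: integral_ge0 => t _; rewrite lee_fin action_ge0. Qed.

Lemma W2_ge0 r0 r1 : (0 <= W2 K pi r0 r1)%E.
Proof.
by apply: le_ereal_inf_tmp => _ [g [psi [_ ->]]]; exact: energy_ge0.
Qed.

Lemma measurable_curve_action g psi : smooth_curve g psi ->
  measurable_fun (`[0, 1] : set R) (fun t : R => action_density K pi (g t) (psi t)).
Proof.
move=> cv; apply: measurable_action => //.
- by move=> t x; rewrite /= in_itv/= => /(curve_density cv)[].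
- by move=> x; apply: measurable_funTS; apply: smooth_measurable; exact: curve_smooth cv x.
- exact: curve_measurable cv.
Qed.

(* Cauchy-Schwarz in time is replaced by [2 d F' - d ^ 2 <= F' ^ 2]. *)
Lemma smooth_sqr_le (F : R -> R) (s : R) (b : R) : smooth F -> 0 <= s <= 1 ->
  (\int[mu]_(t in `[0%R, s]) ((derive1 F t) ^+ 2)%:E <= b%:E)%E ->
  (F s - F 0) ^+ 2 <= b.
Proof.
move=> sF /andP[s0 s1]; set d := F s - F 0 => Ib.
pose F2 t := 2 * d * F t + (- d ^+ 2) * t.
have sdF (t : R) : derivable F t 1 by exact: smooth_derivable.
have dF2 (t : R) : is_derive t 1 F2 (2 * d * derive1 F t - d ^+ 2).
  have h1 := is_deriveM (is_derive_cst (2 * d) t 1) (smooth_is_derive t sF).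
  have h2 := is_deriveM (is_derive_cst (- d ^+ 2) t 1) (is_derive_id t 1).
  apply: (is_derive_eq (is_deriveD h1 h2)).
  by rewrite /GRing.scale/= !mulr0 !addr0 mulr1.
have cdF : continuous (derive1 F).
  by apply: smooth_continuous; exact: smooth_derive1.
have cF2 : continuous (fun t : R => 2 * d * derive1 F t - d ^+ 2).
  move=> t; apply: cvgB; last exact: cvg_cst.
  by apply: cvgM; [exact: cvg_cst | exact: cdF].
have cFF : continuous (fun t : R => derive1 F t ^+ 2).
  by move=> t; apply: cvgM; exact: cdF.
have int (h : R -> R) : continuous h -> mu.-integrable `[0, s] (EFin \o h).
  move=> ch; apply: continuous_compact_integrable; first exact: segment_compact.
  exact: continuous_subspaceT.
have h1 := integral_derivative s0 dF2 cF2.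
have : (\int[mu]_(t in `[0%R, s]) (2 * d * derive1 F t - d ^+ 2)%:E <=
    \int[mu]_(t in `[0%R, s]) ((derive1 F t) ^+ 2)%:E)%E.
  apply: le_integral => //; [exact: (int _ cF2)|exact: (int _ cFF)|].
  move=> t _; rewrite lee_fin; have := sqr_ge0 (derive1 F t - d).
  by move: (derive1 F t) => u; nra.
rewrite h1 => h; have := le_trans h Ib; rewrite lee_fin /F2.
have dE : F s = F 0 + d by rewrite /d; ring.
(* The integral of [2 d F' - d^2] is [(2 - s) d^2], which is at least [d^2] because [s <= 1]. *)
by rewrite dE; have := ler_piMr (sqr_ge0 d) s1; lra.
Qed.

(** The pairing [F] of the curve with [phi] has derivative [Gamma (phi, psi)] by the continuity
    equation and Green's formula, so its square is at most [G] times the action. Intermediate times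
    [s] are included in order to control the whole curve, not only its end. *)
Lemma dual_lower_bound g psi phi (s G E : R) : smooth_curve g psi ->
  0 <= s <= 1 -> 0 <= G ->
  (forall t, 0 < t < s -> graph_form (edge K pi (g t)) phi phi <= G) ->
  (energy g psi <= E%:E)%E ->
  (\sum_x pi x * (g s x - g 0 x) * phi x) ^+ 2 <= G * E.
Proof.
move=> cv /andP[s0 s1] G0 HG HE.
pose F (t : R) := \sum_x pi x * phi x * g t x.
have sF : smooth F.
  apply: smooth_sum => x; apply: (smoothM (smooth_cst _)).
  exact: curve_smooth cv x.
have -> : \sum_x pi x * (g s x - g 0 x) * phi x = F s - F 0.
  by rewrite /F -sumrB; apply: eq_bigr => x _; ring.
have dF t : 0 < t < 1 -> derive1 F t = graph_form (edge K pi (g t)) phi (psi t).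
  move=> t01; have t01' : 0 <= t <= 1 by case/andP: t01 => /ltW -> /ltW ->.
  have g0 := (curve_density cv t01').1.
  rewrite -[RHS]opprK -graph_form_green; last exact: edgeC.
  have -> : derive1 F t = \sum_x pi x * phi x * derive1 (g ^~ x) t.
    rewrite /F derive1_sum; last first.
      by move=> x; apply: (smoothM (smooth_cst _)); exact: curve_smooth cv x.
    apply: eq_bigr => x _.
    have := @derive1_affine _ 0 (pi x * phi x) (g ^~ x)
      (fun t => @smooth_derivable _ _ t (curve_smooth cv x)).
    by under eq_fun do rewrite add0r; move=> ->.
  rewrite -sumrN; apply: eq_bigr => x _.
  have := curve_eq cv x t01; move/eqP; rewrite addr_eq0 => /eqP ->.
  rewrite /graph_div mulrN; congr (- _); rewrite -mulrA mulrCA; congr (_ * _).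
  rewrite mulr_sumr; apply: eq_bigr => y _; rewrite /edge; ring.
apply: smooth_sqr_le => //; first by rewrite s0.
move: s0; rewrite le_eqVlt => /predU1P[s0|s0].
  rewrite -s0 set_itv1 integral_set1 lee_fin mulr_ge0//.
  by rewrite -lee_fin (le_trans (energy_ge0 g psi)).
have mdF : measurable_fun setT (fun t : R => ((derive1 F t) ^+ 2)%:E).
  apply/measurable_EFinP; apply: measurable_funX; apply: smooth_measurable.
  exact: smooth_derive1.
rewrite (integral_itv_bndoo true false); last exact: measurable_funTS.
have ma := measurable_curve_action cv.
have I1 : (`]0, s[ : set R) `<=` `[0, 1]%classic.
  by move=> t /=; rewrite !in_itv/=; lra.
apply: (@le_trans _ _ (\int[mu]_(t in `]0%R, s[)
    (G%:E * (action_density K pi (g t) (psi t))%:E))%E).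
  apply: ge0_le_integral => //.
  - by move=> t _; rewrite lee_fin sqr_ge0.
  - exact: measurable_funTS.
  - apply: emeasurable_funM => //; apply/measurable_EFinP.
    exact: measurable_funS ma.
  - move=> t; rewrite /= in_itv/= => /andP[t0 ts]; rewrite -EFinM lee_fin.
    rewrite dF ?t0 ?(lt_le_trans ts)// action_densityE.
    apply: le_trans (graph_form_CauchySchwarz _ _ _) _; first exact: edge_ge0.
    rewrite ler_wpM2r ?HG ?t0// graph_form_ge0//; exact: edge_ge0.
rewrite ge0_integralZl_EFin//; last 2 first.
- by move=> t _; rewrite lee_fin action_ge0.
- by apply/measurable_EFinP; exact: measurable_funS ma.
rewrite EFinM lee_wpmul2l ?lee_fin//; apply: le_trans HE.
apply: ge0_subset_integral => //; first exact/measurable_EFinP.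
by move=> t _; rewrite lee_fin action_ge0.
Qed.

End Curves.

(** * Reparametrization and gluing of curves *)

Lemma measurable_comp_in (R : realType) d (T : measurableType d) (D E : set R)
    (a : R -> T) (phi : R -> R) : measurable E -> (forall t, D t -> E (phi t)) ->
  measurable_fun E a -> measurable_fun setT phi ->
  measurable_fun D (fun t => a (phi t)).
Proof.
move=> mE DE ma mphi; apply: (@measurable_comp _ _ _ _ _ _ E a D phi) => //.
  by move=> _ [t Dt <-]; exact: DE.
exact: measurable_funTS.
Qed.

Section Reparam.
Variables (R : realType) (X : finType) (K : X -> X -> R) (pi : X -> R).
Implicit Types (r : X -> R) (phi : R -> R) (g psi : R -> X -> R).
Notation mu := (@lebesgue_measure R).
Hypotheses (hK : markov_kernel K) (hirr : irreducible_kernel K)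
  (hpi : prob_vector pi) (hstat : stationary K pi) (hrev : reversible K pi).

Local Notation action := (action_density K pi).

(** Where the clock moves, the equation is the old one multiplied by its speed; where it rests, both
    terms vanish. Clocks may thus rest at 0 or 1, where the old equation is unknown. *)
Lemma curve_eq_reparam g psi phi x (t : R) : smooth_curve K pi g psi ->
  smooth phi -> (derive1 phi t != 0 -> 0 < phi t < 1) ->
  derive1 (fun t => g (phi t) x) t +
  \sum_y (derive1 phi t * psi (phi t) y - derive1 phi t * psi (phi t) x) *
    rho_hat (g (phi t)) x y * K x y = 0.
Proof.
move=> cv sphi H.
have sd (f : R -> R) (u : R) : smooth f -> derivable f u 1 by exact: smooth_derivable.
have -> := derive1_compE (fun t => sd _ t sphi) (fun t => sd _ t (curve_smooth cv x)).
have [->|d0] := eqVneq (derive1 phi t) 0.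
  rewrite mulr0 add0r big1// => y _; by rewrite !mul0r subrr !mul0r.
have := curve_eq cv x (H d0) => /(congr1 ( *%R (derive1 phi t))).
rewrite mulr0 mulrDr => h; rewrite -[RHS]h; congr (_ + _); first by rewrite mulrC.
by rewrite mulr_sumr; apply: eq_bigr => y _; ring.
Qed.

Lemma reparam_curve g psi phi : smooth_curve K pi g psi -> smooth phi ->
  (forall t, 0 <= t <= 1 -> 0 <= phi t <= 1) ->
  (forall t, 0 < t < 1 -> derive1 phi t != 0 -> 0 < phi t < 1) ->
  smooth_curve K pi (fun t => g (phi t))
    (fun t x => derive1 phi t * psi (phi t) x).
Proof.
move=> cv sphi p01 pd; split.
- by move=> x; exact: (smooth_comp sphi (curve_smooth cv x)).
- by move=> t /p01; exact: (curve_density cv).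
- move=> x; apply: measurable_funM.
    by apply: measurable_funTS; apply: smooth_measurable; exact: smooth_derive1.
  apply: (measurable_comp_in _ _ (curve_measurable cv x)) => //.
  exact: smooth_measurable.
- by move=> x t t01; apply: curve_eq_reparam => //; exact: pd.
Qed.

Lemma actionZ r (psi : X -> R) (c : R) :
  action r (fun x => c * psi x) = c ^+ 2 * action r psi.
Proof.
rewrite /action_density mulrCA; congr (_ * _); rewrite mulr_sumr.
apply: eq_bigr => x _; rewrite mulr_sumr; apply: eq_bigr => y _; ring.
Qed.

(** One of the two factors [derive1 phi] is bounded by [M], the other is consumed by the
    substitution. *)
Lemma reparam_energy (a phi : R -> R) (M : R) : smooth phi ->
  (forall t, 0 <= derive1 phi t <= M) ->
  measurable_fun (`[phi 0, phi 1] : set R) a ->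
  (forall t, phi 0 <= t <= phi 1 -> 0 <= a t) ->
  (\int[mu]_(t in `[0%R, 1%R]) (derive1 phi t ^+ 2 * a (phi t))%:E <=
   M%:E * \int[mu]_(t in `[phi 0%R, phi 1%R]) (a t)%:E)%E.
Proof.
move=> sphi dphi ma a0.
have d0 t : 0 <= derive1 phi t by case/andP: (dphi t).
have M0 : 0 <= M by case/andP: (dphi 0) => h; exact: le_trans.
have ph := smooth_ndecr sphi d0.
have p01 t : `[0, 1]%classic t -> phi 0 <= phi t <= phi 1.
  by rewrite /= in_itv/= => /andP[t0 t1]; rewrite !ph.
rewrite -(integral_substitution ler01 sphi d0 (f := fun t => (a t)%:E)); last 2 first.
- exact/measurable_EFinP.
- by move=> t /=; rewrite in_itv/= lee_fin; exact: a0.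
have map : measurable_fun (`[0, 1] : set R) (fun t => a (phi t)).
  apply: (measurable_comp_in _ _ ma) => //.
  exact: smooth_measurable.
have md : measurable_fun (`[0, 1] : set R) (derive1 phi).
  by apply: measurable_funTS; apply: smooth_measurable; exact: smooth_derive1.
rewrite -ge0_integralZl_EFin//; last 2 first.
- by move=> t /p01 h; rewrite -EFinM lee_fin mulr_ge0 ?a0.
- by apply: emeasurable_funM; exact/measurable_EFinP.
apply: ge0_le_integral => //.
- by move=> t /p01 h; rewrite lee_fin mulr_ge0 ?sqr_ge0 ?a0.
- by apply/measurable_EFinP; apply: measurable_funM => //; exact: measurable_funX.
- apply: emeasurable_funM => //; apply: emeasurable_funM; exact/measurable_EFinP.
- move=> t /p01 h; rewrite -!EFinM lee_fin; have := a0 _ h.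
  case/andP: (dphi t); move: (derive1 phi t) (a (phi t)) => u v u0 uM v0.
  by rewrite expr2 -mulrA [v * u]mulrC ler_wpM2r// mulr_ge0.
Qed.

Lemma W2_subcurve g psi (s t : R) : smooth_curve K pi g psi ->
  0 <= s -> s <= t -> t <= 1 ->
  (W2 K pi (g s) (g t) <=
   (t - s)%:E * \int[mu]_(u in `[s, t]) (action (g u) (psi u))%:E)%E.
Proof.
move=> cv s0 st t1; pose phi (u : R) : R := s + (t - s) * u.
have sphi : smooth phi by exact: (smooth_affine _ _ (@smooth_id R)).
have dphi u : derive1 phi u = t - s.
  have -> := derive1_affine s (t - s) (fun u => @smooth_derivable _ _ u (@smooth_id R)).
  by rewrite derive1_id mulr1.
have p01 u : 0 <= u <= 1 -> 0 <= phi u <= 1.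
  move=> /andP[u0 u1]; rewrite /phi addr_ge0 ?mulr_ge0 ?subr_ge0//=.
  by apply: (le_trans _ t1); rewrite -lerBrDl ler_piMr// subr_ge0.
have phi0 : phi 0 = s by rewrite /phi mulr0 addr0.
have phi1 : phi 1 = t by rewrite /phi; ring.
have pd u : 0 < u < 1 -> derive1 phi u != 0 -> 0 < phi u < 1.
  rewrite dphi subr_eq0 => /andP[u0 u1] ts.
  have lt : s < t by rewrite lt_neqAle eq_sym ts.
  rewrite /phi ltr_wpDl ?mulr_gt0 ?subr_gt0//=.
  by apply: (lt_le_trans _ t1); rewrite -ltrBrDl gtr_pMr// subr_gt0.
have := W2_le_energy (reparam_curve cv sphi p01 pd); rewrite phi0 phi1 => h.
apply: (le_trans h); rewrite /energy.
under eq_integral do rewrite actionZ.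
have sub : (`[s, t] : set R) `<=` `[0, 1]%classic by move=> u /=; rewrite !in_itv/=; lra.
have := @reparam_energy (fun u => action (g u) (psi u)) phi (t - s) sphi.
rewrite phi0 phi1; apply.
- by move=> u; rewrite dphi lexx subr_ge0 st.
- exact: (measurable_funS _ sub (measurable_curve_action cv)).
- by move=> u _; exact: action_ge0.
Qed.

(** [integral_substitution] wants a nondecreasing clock, so the reversal is split into the
    translation [t - 1] and a reflection, under which Lebesgue measure is invariant. *)
Lemma integral_onem (a : R -> \bar R) : measurable_fun (`[0, 1] : set R) a ->
  (forall t, 0 <= t <= 1 -> (0 <= a t)%E) ->
  (\int[mu]_(t in `[0%R, 1%R]) a (1 - t)%R = \int[mu]_(t in `[0%R, 1%R]) a t)%E.
Proof.
move=> ma a0; pose phi (t : R) : R := -1 + 1 * t.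
have sphi : smooth phi by exact: (smooth_affine _ _ (@smooth_id R)).
have dphi u : derive1 phi u = 1.
  have -> := derive1_affine (-1) 1 (fun u => @smooth_derivable _ _ u (@smooth_id R)).
  by rewrite derive1_id mulr1.
have phi0 : phi 0 = -1 by rewrite /phi mulr0 addr0.
have phi1 : phi 1 = 0 by rewrite /phi mulr1 addNr.
have NI (u : R) : (-1 <= u <= 0) = (0 <= - u <= 1) by apply/idP/idP; lra.
have maN : measurable_fun (`[-1, 0] : set R) (fun u => a (- u)).
  apply: (measurable_comp_in _ _ ma) => //.
  by move=> t /=; rewrite !in_itv/= NI.
have d0 u : 0 <= derive1 phi u by rewrite dphi.
have := @integral_substitution R phi 0 1 ler01 sphi d0 (fun u => a (- u)).
rewrite phi0 phi1 => /(_ maN) h.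
transitivity (\int[mu]_(t in `[(-1)%R, 0%R]) a (- t)%R)%E.
  rewrite -h.
  - apply: eq_integral => t _; rewrite dphi mule1 /phi; congr a; ring.
  - by move=> t /=; rewrite in_itv/= NI; exact: a0.
pose opp : measurableTypeR R -> measurableTypeR R := -%R.
have -> : `[-1, 0]%classic = opp @^-1` `[0%R, 1%R].
  by apply/seteqP; split => t /=; rewrite !in_itv/= NI.
have mopp : measurable_fun setT opp.
  have mo : measurable_fun setT (-%R : R -> R) by [].
  exact: mo.
have := @ge0_integral_pushforward _ _ _ _ R opp mopp mu _ a _ ma.
rewrite /comp => <-//; last by move=> t; rewrite inE/= in_itv/=; exact: a0.
by apply: eq_measure_integral => //= A mA AS; exact: lebesgue_measureN.
Qed.

Lemma W2_sym_le r0 r1 : (W2 K pi r0 r1 <= W2 K pi r1 r0)%E.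
Proof.
apply/ereal_infP => _ [rho [psi0 [cp ->]]].
rewrite leNgt; apply/negP => lt.
(* The strict inequality lets [W2_lt_energy] supply a competitor that is smooth on the whole line,
   to be run backwards. *)
have : (W2 K pi r1 r0 < W2 K pi r0 r1)%E by apply: le_lt_trans lt; apply: W2_le_action.
move=> {}lt; have [g [psi [cv g0 g1 ge]]] := W2_lt_energy lt.
pose phi (u : R) : R := 1 + -1 * u.
have sphi : smooth phi by exact: (smooth_affine _ _ (@smooth_id R)).
have dphi u : derive1 phi u = -1.
  have -> := derive1_affine 1 (-1) (fun u => @smooth_derivable _ _ u (@smooth_id R)).
  by rewrite derive1_id mulr1.
have cv' := reparam_curve cv sphi.
have p01 u : 0 <= u <= 1 -> 0 <= phi u <= 1 by rewrite /phi; lra.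
have pd u : 0 < u < 1 -> derive1 phi u != 0 -> 0 < phi u < 1.
  by move=> + _; rewrite /phi; lra.
have := W2_le_energy (cv' p01 pd).
have -> : phi 0 = 1 by rewrite /phi; ring.
have -> : phi 1 = 0 by rewrite /phi; ring.
rewrite g0 g1 leNgt => /negP; apply; apply: le_lt_trans ge.
rewrite /energy -[in leRHS]integral_onem; last 2 first.
- by apply/measurable_EFinP; exact: measurable_curve_action.
- by move=> t _; rewrite lee_fin action_ge0.
rewrite le_eqVlt; apply/orP; left; apply/eqP; apply: eq_integral => t _.
by rewrite actionZ dphi sqrrN expr1n mul1r /phi mulN1r.
Qed.

(** Cut a nearly optimal curve at time [l]: the energies of the pieces add up, and rescaling each to
    unit time multiplies it by [l], respectively [1 - l]. *)
Lemma W2_split r0 r1 (w l : R) : (W2 K pi r0 r1 < w%:E)%E -> 0 < l < 1 ->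
  exists (r : X -> R) (e1 e2 : R), [/\ density pi r,
    (W2 K pi r0 r <= (l * e1)%:E)%E, (W2 K pi r r1 <= ((1 - l) * e2)%:E)%E &
    e1 + e2 <= w].
Proof.
move=> /W2_lt_energy[g [psi [cv g0 g1 ge]]] /andP[l0 l1].
have ma := measurable_curve_action cv.
pose a t := (action (g t) (psi t))%:E.
have a0 t : (0 <= a t)%E by rewrite lee_fin action_ge0.
have mE : measurable_fun (`[0, 1] : set R) a by exact/measurable_EFinP.
pose I1 : \bar R := (\int[mu]_(u in `[0%R, l]) a u)%E.
pose I2 : \bar R := (\int[mu]_(u in `[l, 1%R]) a u)%E.
have I10 : (0 <= I1)%E by exact: integral_ge0.
have I20 : (0 <= I2)%E by exact: integral_ge0.
have sub : (`]l, 1] : set R) `<=` `[0, 1]%classic by move=> u /=; rewrite !in_itv/=; lra.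
have II : (I1 + I2 = energy K pi g psi)%E.
  have UE : (`[0, l] : set R) `|` `]l, 1] = `[0, 1]%classic.
    by apply/seteqP; split => u /=; rewrite !in_itv/=; lra.
  rewrite /energy -UE ge0_integral_setU//; last 3 first.
  - by rewrite UE.
  - by move=> u _; exact: a0.
  - by apply/disj_setPS => u /=; rewrite !in_itv/=; lra.
  have -> : I2 = (\int[mu]_(u in `]l, 1%R]) a u)%E.
    rewrite /I2 -integral_itv_obnd_cbnd//; exact: (measurable_funS _ sub mE).
  by [].
have /andP[f1 f2] : (I1 \is a fin_num) && (I2 \is a fin_num).
  have : (I1 + I2 < +oo)%E by rewrite II (lt_trans ge)// ltry.
  rewrite !ge0_fin_numE// => h; apply/andP; split; apply: le_lt_trans h.
    exact: leeDl.
  exact: leeDr.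
exists (g l), (fine I1), (fine I2); split.
- by apply: (curve_density cv); rewrite !ltW.
- rewrite EFinM fineK// -g0 -[l in l%:E]subr0.
  by apply: W2_subcurve => //; exact: ltW.
- rewrite EFinM fineK// -g1.
  by apply: W2_subcurve => //; exact: ltW.
- by rewrite -lee_fin EFinD !fineK// II ltW.
Qed.

(** The first curve is run during [0, l] and the second during [l, 1], which divides the energies by
    [l] and [1 - l]. Smooth clocks cost a factor [c > 1], which is then sent to 1. *)
Lemma W2_glue r0 r1 r2 (E1 E2 l : R) : (W2 K pi r0 r1 < E1%:E)%E ->
  (W2 K pi r1 r2 < E2%:E)%E -> 0 < l < 1 ->
  (W2 K pi r0 r2 <= (E1 / l + E2 / (1 - l))%:E)%E.
Proof.
move=> h1 h2 /andP[l0 l1].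
have E10 : 0 < E1 by rewrite -lte_fin (le_lt_trans _ h1)// W2_ge0.
have E20 : 0 < E2 by rewrite -lte_fin (le_lt_trans _ h2)// W2_ge0.
have [g1 [psi1 [cv1 g10 g11 e1]]] := W2_lt_energy h1.
have [g2 [psi2 [cv2 g20 g21 e2]]] := W2_lt_energy h2.
set T := E1 / l + _.
have T0 : 0 < T by rewrite addr_gt0// divr_gt0// subr_gt0.
suff H c : 1 < c -> (W2 K pi r0 r2 <= (c * T)%:E)%E.
  apply/lee_addgt0Pr => e e0.
  have -> : (T%:E + e%:E = ((1 + e / T) * T)%:E)%E.
    by rewrite -EFinD mulrDl mul1r divfK// gt_eqF.
  by apply: H; rewrite ltrDl divr_gt0.
move=> c1; have [f [sf df f01 fl fr]] := smooth_step c1.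
pose phi1 (t : R) := f (0 + l^-1 * t).
pose phi2 (t : R) := f (- (l / (1 - l)) + (1 - l)^-1 * t).
have sa a b : smooth (fun t : R => a + b * t) by exact: (smooth_affine _ _ (@smooth_id R)).
have sphi1 : smooth phi1 by exact: (smooth_comp (sa _ _) sf).
have sphi2 : smooth phi2 by exact: (smooth_comp (sa _ _) sf).
have dphi a b t : derive1 (fun t => f (a + b * t)) t = derive1 f (a + b * t) * b.
  have -> := derive1_compE (fun t => @smooth_derivable _ _ t (sa a b))
    (fun t => @smooth_derivable _ _ t sf).
  have -> := derive1_affine a b (fun u => @smooth_derivable _ _ u (@smooth_id R)).
  by rewrite derive1_id mulr1.
have dphi1 t : 0 <= derive1 phi1 t <= c / l.
  rewrite dphi; case/andP: (df (0 + l^-1 * t)) => d0 d1.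
  have i0 : 0 <= l^-1 by rewrite invr_ge0 ltW.
  by apply/andP; split; [apply: mulr_ge0|apply: ler_wpM2r].
have dphi2 t : 0 <= derive1 phi2 t <= c / (1 - l).
  rewrite dphi; case/andP: (df (- (l / (1 - l)) + (1 - l)^-1 * t)) => d0 d1.
  have i0 : 0 <= (1 - l)^-1 by rewrite invr_ge0 subr_ge0 ltW.
  by apply/andP; split; [apply: mulr_ge0|apply: ler_wpM2r].
have cl0 : 0 <= c / l by case/andP: (dphi1 0) => h /(le_trans h).
have cl1 : 0 <= c / (1 - l) by case/andP: (dphi2 0) => h /(le_trans h).
have ext1 t : phi1 t = 0 \/ phi1 t = 1 -> derive1 phi1 t = 0.
  by apply: derive1_extremum => //; move=> u; exact: f01.
have ext2 t : phi2 t = 0 \/ phi2 t = 1 -> derive1 phi2 t = 0.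
  by apply: derive1_extremum => //; move=> u; exact: f01.
have in1 t : derive1 phi1 t != 0 -> 0 < phi1 t < 1.
  move=> d0; have /andP[a b] := f01 (0 + l^-1 * t).
  by rewrite !lt_neqAle a b !andbT; apply/andP; split; apply: contra d0 => /eqP h;
    rewrite ext1//; [left|right].
have in2 t : derive1 phi2 t != 0 -> 0 < phi2 t < 1.
  move=> d0; have /andP[a b] := f01 (- (l / (1 - l)) + (1 - l)^-1 * t).
  by rewrite !lt_neqAle a b !andbT; apply/andP; split; apply: contra d0 => /eqP h;
    rewrite ext2//; [left|right].
have p2E t : - (l / (1 - l)) + (1 - l)^-1 * t = (t - l) / (1 - l) by ring.
have dich t : phi2 t = 0 /\ derive1 phi2 t = 0 \/ phi1 t = 1 /\ derive1 phi1 t = 0.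
  have [tl|lt] := leP t l.
    have z : phi2 t = 0 by rewrite /phi2 fl// p2E pmulr_lle0 ?invr_gt0; lra.
    by left; rewrite ext2//; left.
  have z : phi1 t = 1 by rewrite /phi1 fr// add0r mulrC ler_pdivlMr// mul1r ltW.
  by right; rewrite ext1//; right.
have p10 : phi1 0 = 0 by rewrite /phi1 fl// mulr0 addr0.
have p11 : phi1 1 = 1.
  by rewrite /phi1 fr// add0r mulr1 invf_ge1// ltW.
have p20 : phi2 0 = 0.
  by rewrite /phi2 fl// p2E pmulr_lle0 ?invr_gt0; lra.
have p21 : phi2 1 = 1.
  by rewrite /phi2 p2E divff ?fr// gt_eqF// subr_gt0.
(* At every time one of the two clocks rests at the junction [r1], so this sum minus [r1] is the
   active curve; as a sum of smooth functions it requires no matching of derivatives. *)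
pose g t x := g1 (phi1 t) x + (g2 (phi2 t) x + - r1 x).
pose psi t x := derive1 phi1 t * psi1 (phi1 t) x + derive1 phi2 t * psi2 (phi2 t) x.
have gE t : g t = g1 (phi1 t) /\ psi t = (fun x => derive1 phi1 t * psi1 (phi1 t) x)
      /\ derive1 phi2 t = 0 \/
    g t = g2 (phi2 t) /\ psi t = (fun x => derive1 phi2 t * psi2 (phi2 t) x)
      /\ derive1 phi1 t = 0.
  case: (dich t) => -[z dz]; [left|right]; (split; last split => //);
    apply/funext => x; rewrite /g /psi ?z ?dz ?mul0r ?addr0 ?add0r//.
  - by rewrite g20 subrr addr0.
  - by rewrite g11 addrCA subrr addr0.
have sg1 x : smooth (fun t => g1 (phi1 t) x) by exact: (smooth_comp sphi1 (curve_smooth cv1 x)).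
have sg2 x : smooth (fun t => g2 (phi2 t) x) by exact: (smooth_comp sphi2 (curve_smooth cv2 x)).
have cv : smooth_curve K pi g psi.
  split.
  - by move=> x; exact: (smoothD (sg1 x) (smoothD (sg2 x) (smooth_cst _))).
  - move=> t t01; case: (gE t) => -[-> _].
      by apply: (curve_density cv1); exact: f01.
    by apply: (curve_density cv2); exact: f01.
  - move=> x; apply: measurable_funD; apply: measurable_funM;
      try by apply: measurable_funTS; apply: smooth_measurable; exact: smooth_derive1.
    + apply: (measurable_comp_in _ _ (curve_measurable cv1 x)) => //.
        by move=> t _; rewrite /= in_itv/=; exact: f01.
      exact: smooth_measurable.
    + apply: (measurable_comp_in _ _ (curve_measurable cv2 x)) => //.
        by move=> t _; rewrite /= in_itv/=; exact: f01.
      exact: smooth_measurable.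
  - move=> x t t01.
    have sd (h : R -> R) (u : R) : smooth h -> derivable h u 1 by exact: smooth_derivable.
    have sgc : smooth (fun t => g2 (phi2 t) x + - r1 x) by exact: (smoothD (sg2 x) (smooth_cst _)).
    have -> : derive1 (g ^~ x) t = derive1 (fun t => g1 (phi1 t) x) t +
        derive1 (fun t => g2 (phi2 t) x) t.
      have -> := derive1D (fun t => sd _ t (sg1 x)) (fun t => sd _ t sgc).
      have -> := derive1D (fun t => sd _ t (sg2 x)) (fun t => sd _ t (@smooth_cst R (- r1 x))).
      by rewrite derive1_cst addr0.
    have d1E := derive1_compE (fun t => sd _ t sphi1) (fun t => sd _ t (curve_smooth cv1 x)).
    have d2E := derive1_compE (fun t => sd _ t sphi2) (fun t => sd _ t (curve_smooth cv2 x)).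
    case: (gE t) => -[-> [-> dz]].
      rewrite d2E dz mulr0 addr0; apply: curve_eq_reparam => //; exact: in1.
    rewrite d1E dz mulr0 add0r; apply: curve_eq_reparam => //; exact: in2.
have := W2_le_energy cv.
have -> : g 0 = r0 by apply/funext => x; rewrite /g p10 p20 g10 g20 subrr addr0.
have -> : g 1 = r2 by apply/funext => x; rewrite /g p11 p21 g11 g21 addrCA subrr addr0.
move=> h; apply: (le_trans h).
pose a1 t := action (g1 t) (psi1 t); pose a2 t := action (g2 t) (psi2 t).
have aE t : action (g t) (psi t) =
    derive1 phi1 t ^+ 2 * a1 (phi1 t) + derive1 phi2 t ^+ 2 * a2 (phi2 t).
  by case: (gE t) => -[-> [-> ->]]; rewrite actionZ expr0n mul0r ?addr0 ?add0r.
have ma1 := measurable_curve_action cv1.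
have ma2 := measurable_curve_action cv2.
have mc (phi a : R -> R) : smooth phi -> (forall t, 0 <= phi t <= 1) ->
    measurable_fun (`[0, 1] : set R) a ->
    measurable_fun (`[0, 1] : set R) (fun t => (derive1 phi t ^+ 2 * a (phi t))%:E).
  move=> sphi p01 ma; apply/measurable_EFinP; apply: measurable_funM.
    apply: measurable_funX; apply: measurable_funTS; apply: smooth_measurable.
    exact: smooth_derive1.
  apply: (measurable_comp_in _ _ ma) => //.
    by move=> t _; rewrite /= in_itv/=.
  exact: smooth_measurable.
rewrite /energy; under eq_integral do rewrite aE EFinD.
rewrite ge0_integralD//; last 4 first.
- by move=> t _; rewrite lee_fin mulr_ge0 ?sqr_ge0 ?action_ge0.
- exact: (mc phi1 a1 sphi1 (fun t => f01 _) ma1).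
- by move=> t _; rewrite lee_fin mulr_ge0 ?sqr_ge0 ?action_ge0.
- exact: (mc phi2 a2 sphi2 (fun t => f01 _) ma2).
have -> : (c * T)%:E = ((c / l)%:E * E1%:E + (c / (1 - l))%:E * E2%:E)%E.
  by rewrite -!EFinM -EFinD /T; congr EFin; ring.
apply: leeD.
- apply: (@le_trans _ _ ((c / l)%:E * energy K pi g1 psi1)%E); last first.
    by rewrite lee_wpmul2l ?(ltW e1)// lee_fin.
  have := @reparam_energy a1 phi1 (c / l) sphi1 dphi1; rewrite p10 p11; apply; first exact: ma1.
  by move=> t _; exact: action_ge0.
- apply: (@le_trans _ _ ((c / (1 - l))%:E * energy K pi g2 psi2)%E); last first.
    by rewrite lee_wpmul2l ?(ltW e2)// lee_fin.
  have := @reparam_energy a2 phi2 (c / (1 - l)) sphi2 dphi2; rewrite p20 p21; apply; first exact: ma2.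
  by move=> t _; exact: action_ge0.
Qed.

End Reparam.

(** * The transport distance *)

Section Distance.
Variables (R : realType) (X : finType) (K : X -> X -> R) (pi : X -> R).
Implicit Types (r : X -> R).
Hypotheses (hK : markov_kernel K) (hirr : irreducible_kernel K)
  (hpi : prob_vector pi) (hstat : stationary K pi) (hrev : reversible K pi).

Local Notation edge1 := (edge K pi density_one).

Lemma density_one_density : density pi density_one.
Proof.
split=> [x|]; first exact: ler01.
by rewrite -hpi.2; apply: eq_bigr => x _; rewrite /density_one mulr1.
Qed.

Lemma density_mix r r' (l : R) : density pi r -> density pi r' -> 0 <= l <= 1 ->
  density pi (fun x => r x + l * (r' x - r x)).
Proof.
move=> [r0 r1] [r'0 r'1] /andP[l0 l1]; split=> [x|].
  have -> : r x + l * (r' x - r x) = (1 - l) * r x + l * r' x by ring.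
  by rewrite addr_ge0// mulr_ge0// subr_ge0.
have -> : \sum_x pi x * (r x + l * (r' x - r x)) =
    (1 - l) * (\sum_x pi x * r x) + l * \sum_x pi x * r' x.
  by rewrite !mulr_sumr -big_split; apply: eq_bigr => x _ /=; ring.
by rewrite r1 r'1; ring.
Qed.

Lemma edge1_poincare : exists2 C : R, 0 < C &
  forall (phi : X -> R) f, \sum_x f x = 0 ->
  (\sum_x f x * phi x) ^+ 2 <= C * (\sum_x `|f x|) ^+ 2 * graph_form edge1 phi phi.
Proof.
have e0 : forall x y, 0 <= edge1 x y by exact: edge_ge0.
have ec : forall x y, connect (fun a b => 0 < edge1 a b) x y.
  by apply: connect_edge => // x; exact: ltr01.
have [C C0 H] := graph_form_poincare e0 ec.
exists (C + 1) => [|phi f f0]; first by rewrite ltr_wpDl.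
apply: le_trans (H phi f f0) _.
by rewrite ler_wpM2r ?graph_form_ge0// ler_wpM2r ?sqr_ge0// lerDl.
Qed.

Lemma sum_diff r r' : density pi r -> density pi r' ->
  \sum_x pi x * (r' x - r x) = 0.
Proof.
by move=> [_ r1] [_ r'1]; under eq_bigr do rewrite mulrBr; rewrite sumrB r1 r'1 subrr.
Qed.

(** [r] may have zeros, so the segment starts where the form can degenerate. With clock [t^2] the
    speed is [2 t l] and the density is at least [l t^2], so the factor [t^2] cancels between
    squared speed and form and one power of [l] is left. The 16 is [2^2] from the clock times [2^2]
    from the total variation bound. *)
Lemma W2_to_one_le : exists2 C : R, 0 < C & forall r (l : R), density pi r ->
  0 < l <= 1 -> (W2 K pi r (fun x => (r x + l * (density_one x - r x))%R) <= (C * l)%:E)%E.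
Proof.
have [C C0 HC] := edge1_poincare.
exists (16 * C) => [|r l dr /andP[l0 l1]]; first by rewrite mulr_gt0.
have d1 := density_one_density.
have sq : smooth (fun t : R => t * t) by exact: (smoothM (@smooth_id R) (@smooth_id R)).
have dsq (t : R) : derive1 (fun t : R => t * t) t = 2 * t.
  have sd (u : R) := @smooth_derivable _ _ u (@smooth_id R).
  have -> := derive1M sd sd.
  by rewrite derive1_id; ring.
apply: (W2_segment_le hK hirr hpi hstat hrev _ dr _ sq).
- by rewrite !mulr_ge0// ltW.
- by apply: density_mix => //; rewrite (ltW l0).
- by rewrite mulr0.
- by rewrite mulr1.
- by move=> t /andP[t0 t1]; rewrite mulr_ge0//= mulr_ile1.
move=> t /andP[t0 t1]; have tt : 0 < t * t by rewrite mulr_gt0.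
have ltt : 0 < l * (t * t) by rewrite mulr_gt0.
have tt1 : t * t <= 1 by apply: mulr_ile1; exact: ltW.
have ltt1 : l * (t * t) <= 1 by apply: mulr_ile1 => //; exact: ltW.
pose rt x := r x + t * t * (r x + l * (density_one x - r x) - r x).
have rtE x : rt x = (1 - l * (t * t)) * r x + l * (t * t).
  by rewrite /rt /density_one; ring.
have rt0 x : l * (t * t) <= rt x.
  by rewrite rtE lerDr mulr_ge0 ?subr_ge0//; exact: dr.1.
split=> [x|phi]; first exact: lt_le_trans (rt0 x).
rewrite dsq.
have -> : \sum_x pi x * (r x + l * (density_one x - r x) - r x) * phi x =
    l * \sum_x (pi x * (density_one x - r x)) * phi x.
  by rewrite mulr_sumr; apply: eq_bigr => x _; ring.
rewrite -/rt exprMn exprMn.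
have N2 : (\sum_x `|pi x * (density_one x - r x)|) ^+ 2 <= 4.
  have N0 : 0 <= \sum_x `|pi x * (density_one x - r x)| by exact: sumr_ge0.
  have : \sum_x `|pi x * (density_one x - r x)| <= 2.
    have -> : 2 = \sum_x pi x * density_one x + \sum_x pi x * r x.
      by rewrite d1.2 dr.2.
    rewrite -big_split ler_sum// => x _; rewrite normrM ger0_norm ?(hpi.1 x)//.
    rewrite /= -mulrDr ler_wpM2l ?(hpi.1 x)// (le_trans (ler_normB _ _))//.
    by rewrite !ger0_norm// ?(dr.1 x)// /density_one.
  by nra.
have e0 := @edge_ge0 _ _ _ _ hK hirr hpi hstat.
have F0 := graph_form_ge0 phi (e0 density_one).
have h1 : (\sum_x pi x * (density_one x - r x) * phi x) ^+ 2 <=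
    C * 4 * graph_form edge1 phi phi.
  apply: le_trans (HC phi _ (sum_diff dr d1)) _.
  by rewrite ler_wpM2r// ler_wpM2l// ltW.
have h2 : l * (t * t) * graph_form edge1 phi phi <= graph_form (edge K pi rt) phi phi.
  rewrite -graph_formZ; apply: graph_form_mono; apply: edge_mono => //.
  - exact: ltW.
  - by move=> x; rewrite mulr1.
apply: (@le_trans _ _ (16 * C * l * (l * (t * t) * graph_form edge1 phi phi))).
  have -> : 16 * C * l * (l * (t * t) * graph_form edge1 phi phi) =
    (2 * t) ^+ 2 * (l ^+ 2 * (C * 4 * graph_form edge1 phi phi)) by ring.
  rewrite [(2 * t) ^+ 2]exprMn [in leLHS]exprMn -!mulrA.
  do 2!(apply: ler_wpM2l; first exact: ler0n).
  do 4!(apply: ler_wpM2l; first exact: ltW).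
  by rewrite mulrA.
by rewrite ler_wpM2l// !mulr_ge0// ltW.
Qed.

(** The whole segment stays above [l], so its form dominates [l] times that of the constant
    density. *)
Lemma W2_positive_le : exists2 C : R, 0 < C & forall r r' (l : R),
  density pi r -> density pi r' -> 0 < l ->
  (forall x, l <= r x) -> (forall x, l <= r' x) ->
  (W2 K pi r r' <= (C / l * (\sum_x pi x * `|r' x - r x|) ^+ 2)%:E)%E.
Proof.
have [C C0 HC] := edge1_poincare.
exists C => // r r' l dr dr' l0 rl rl'.
have did (t : R) : derive1 (fun t : R => t) t = 1 by rewrite derive1_id.
apply: (W2_segment_le hK hirr hpi hstat hrev _ dr dr' (@smooth_id R)) => //.
  by rewrite mulr_ge0 ?sqr_ge0// divr_ge0// ltW.
move=> t /andP[t0 t1].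
have rt0 x : l <= r x + t * (r' x - r x).
  have := rl x; have := rl' x; move: (r x) (r' x) => a b; nra.
split=> [x|phi]; first exact: lt_le_trans (rt0 x).
rewrite did mul1r.
have e0 := @edge_ge0 _ _ _ _ hK hirr hpi hstat.
apply: le_trans (HC phi _ (sum_diff dr dr')) _.
have -> : \sum_x `|pi x * (r' x - r x)| = \sum_x pi x * `|r' x - r x|.
  by apply: eq_bigr => x _; rewrite normrM ger0_norm ?(hpi.1 x).
set N := \sum_x _.
have -> : C / l * N ^+ 2 * graph_form (edge K pi (fun x => r x + t * (r' x - r x))) phi phi =
  C * N ^+ 2 * (l^-1 * graph_form (edge K pi (fun x => r x + t * (r' x - r x))) phi phi).
  by ring.
apply: ler_wpM2l; first by apply: mulr_ge0; [exact: ltW|exact: sqr_ge0].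
rewrite ler_pdivlMl//.
rewrite -graph_formZ; apply: graph_form_mono; apply: edge_mono => //.
- exact: ltW.
- by move=> x; rewrite mulr1.
Qed.

(** Both densities are joined to the constant one, with [l = 1] in [W2_to_one_le], and the two paths
    are glued at half time. *)
Lemma W2_fin r r' : density pi r -> density pi r' -> W2 K pi r r' \is a fin_num.
Proof.
have l2 : 0 < (2^-1 : R) < 1 by rewrite invr_gt0 ltr0n invf_lt1 ?ltr1n ?ltr0n.
have fin a b e : (W2 K pi a b <= e%:E)%E -> (W2 K pi a b < (`|e| + 1)%:E)%E.
  by move=> h; apply: le_lt_trans h _; rewrite lte_fin (le_lt_trans (ler_norm _))// ltrDl.
have one a : density pi a -> exists e, (W2 K pi a density_one < e%:E)%E.
  move=> da; have [C _ H] := W2_to_one_le; have := H a 1 da.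
  rewrite ltr01 lexx => /(_ isT).
  have -> : (fun x => a x + 1 * (density_one x - a x)) = density_one.
    by apply/funext => x; rewrite mul1r addrCA subrr addr0.
  by move=> /fin h; eexists; exact: h.
move=> dr dr'; have [e1 h1] := one r dr; have [e2 h2] := one r' dr'.
have h2' := le_lt_trans (W2_sym_le hK hirr hpi hstat _ _) h2.
have := W2_glue hK hirr hpi hstat h1 h2' l2.
by move=> h; rewrite ge0_fin_numE ?W2_ge0// (le_lt_trans h)// ltry.
Qed.

(** A real-valued version of [W]; [fine] loses nothing on densities, by [W2_fin]. *)
Definition dist r r' : R := Num.sqrt (fine (W2 K pi r r')).

Lemma dist_ge0 r r' : 0 <= dist r r'.
Proof. exact: sqrtr_ge0. Qed.

Lemma dist_sqr r r' : density pi r -> density pi r' ->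
  W2 K pi r r' = (dist r r' ^+ 2)%:E.
Proof.
move=> dr dr'; rewrite /dist sqr_sqrtr ?fineK ?W2_fin//.
by rewrite fine_ge0// W2_ge0.
Qed.

Lemma dist_W r r' : density pi r -> density pi r' -> W K pi r r' = (dist r r')%:E.
Proof.
by move=> dr dr'; rewrite /W /dist -{1}(fineK (W2_fin dr dr')).
Qed.

Lemma dist_le r r' (w : R) : 0 <= w -> density pi r -> density pi r' ->
  (W2 K pi r r' <= (w ^+ 2)%:E)%E -> dist r r' <= w.
Proof.
move=> w0 dr dr'; rewrite dist_sqr// lee_fin => h.
by rewrite -(@ler_pXn2r _ 2)// nnegrE// dist_ge0.
Qed.

Lemma dist_sym r r' : dist r r' = dist r' r.
Proof.
by rewrite /dist (@le_anti _ _ (W2 K pi r r') (W2 K pi r' r))// !W2_sym_le.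
Qed.

(** Glue at the optimal time [l = w1 / (w1 + w2)], for which
    [w1^2 / l + w2^2 / (1 - l) = (w1 + w2)^2]. The slack [e / 2] makes both lengths positive and the
    bounds strict. *)
Lemma dist_triangle r0 r1 r2 : density pi r0 -> density pi r1 -> density pi r2 ->
  dist r0 r2 <= dist r0 r1 + dist r1 r2.
Proof.
move=> d0 d1 d2; apply/ler_addgt0Pr => e e0.
pose w1 := dist r0 r1 + e / 2; pose w2 := dist r1 r2 + e / 2.
have w10 : 0 < w1 by rewrite ltr_wpDl ?dist_ge0// divr_gt0.
have w20 : 0 < w2 by rewrite ltr_wpDl ?dist_ge0// divr_gt0.
have lt a b w : density pi a -> density pi b -> dist a b < w ->
    (W2 K pi a b < (w ^+ 2)%:E)%E.
  move=> da db ab; rewrite dist_sqr// lte_fin ltr_pXn2r// nnegrE ?dist_ge0//.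
  exact: le_trans (dist_ge0 a b) (ltW ab).
have h1 : (W2 K pi r0 r1 < (w1 ^+ 2)%:E)%E by apply: lt => //; rewrite ltrDl divr_gt0.
have h2 : (W2 K pi r1 r2 < (w2 ^+ 2)%:E)%E by apply: lt => //; rewrite ltrDl divr_gt0.
have l01 : 0 < w1 / (w1 + w2) < 1.
  have w0 : 0 < w1 + w2 by exact: addr_gt0.
  by apply/andP; split; [exact: divr_gt0|rewrite ltr_pdivrMr// mul1r ltrDl].
have := W2_glue hK hirr hpi hstat h1 h2 l01.
have -> : w1 ^+ 2 / (w1 / (w1 + w2)) + w2 ^+ 2 / (1 - w1 / (w1 + w2)) = (w1 + w2) ^+ 2.
  move: w1 w2 w10 w20 {h1 h2 l01} => a b a0 b0.
  have ab : a + b != 0 by rewrite gt_eqF// addr_gt0.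
  have an : a != 0 by rewrite gt_eqF.
  have bn : b != 0 by rewrite gt_eqF.
  have -> : 1 - a / (a + b) = b / (a + b) by field.
  by field; do ?[apply/andP; split].
move=> h; have -> : dist r0 r1 + dist r1 r2 + e = w1 + w2 by rewrite /w1 /w2; lra.
by apply: dist_le => //; rewrite addr_ge0// ltW.
Qed.

(** Both densities are first mixed with the constant one, at cost [e / 4] each; the mixtures are
    bounded below by [l], where [W2_positive_le] costs a further [e / 4]. The radius depends on [e]
    only, not on the densities. *)
Lemma dist_small (e : R) : 0 < e -> exists2 h : R, 0 < h & forall r r',
  density pi r -> density pi r' -> (forall x, `|r x - r' x| < h) -> dist r r' < e.
Proof.
move=> e0; have [C1 C10 H1] := W2_to_one_le; have [C2 C20 H2] := W2_positive_le.
pose l := Num.min 1 ((e / 4) ^+ 2 / C1).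
have l0 : 0 < l by rewrite lt_min ltr01/= divr_gt0// exprn_gt0// divr_gt0.
have l1 : l <= 1 by rewrite ge_min lexx.
have lC : C1 * l <= (e / 4) ^+ 2 by rewrite mulrC -ler_pdivlMr// ge_min lexx orbT.
pose h := e / 4 / Num.sqrt (C2 / l).
have s0 : 0 < Num.sqrt (C2 / l) by rewrite sqrtr_gt0 divr_gt0.
have h0 : 0 < h by rewrite !divr_gt0.
exists h => // r r' dr dr' rr.
pose m a := fun x : X => a x + l * (density_one x - a x).
have l01 : 0 < l <= 1 by rewrite l0.
have d1 := density_one_density.
have dm a : density pi a -> density pi (m a).
  by move=> da; apply: density_mix => //; rewrite ltW.
have e4 : 0 <= e / 4 by rewrite divr_ge0// ltW.
have hm a : density pi a -> dist a (m a) <= e / 4.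
  move=> da; apply: dist_le => //; first exact: dm.
  by apply: le_trans (H1 a l da l01) _; rewrite lee_fin.
have mE a x : m a x = (1 - l) * a x + l by rewrite /m /density_one; ring.
have hmm : dist (m r) (m r') <= e / 4.
  have ml a : density pi a -> forall x, l <= m a x.
    by move=> da x; rewrite mE lerDr mulr_ge0 ?subr_ge0//; exact: da.1.
  apply: dist_le => //; [exact: dm|exact: dm|].
  apply: le_trans (H2 _ _ _ (dm _ dr) (dm _ dr') l0 (ml _ dr) (ml _ dr')) _.
  rewrite lee_fin.
  have N0 : 0 <= \sum_x pi x * `|m r' x - m r x|.
    by apply: sumr_ge0 => x _; rewrite mulr_ge0// (hpi.1 x).
  have Nh : \sum_x pi x * `|m r' x - m r x| <= h.
    rewrite -[h]mul1r -hpi.2 mulr_suml ler_sum// => x _.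
    rewrite ler_wpM2l ?(hpi.1 x)// !mE.
    have -> : (1 - l) * r' x + l - ((1 - l) * r x + l) = (1 - l) * (r' x - r x) by ring.
    rewrite normrM ger0_norm ?subr_ge0// distrC.
    by rewrite (le_trans _ (ltW (rr x)))// ler_piMl// lerBlDr lerDl ltW.
  have -> : (e / 4) ^+ 2 = C2 / l * h ^+ 2.
    have s2 : Num.sqrt (C2 / l) ^+ 2 = C2 / l by rewrite sqr_sqrtr// divr_ge0// ltW.
    have hs : h * Num.sqrt (C2 / l) = e / 4 by rewrite /h divfK// gt_eqF.
    by rewrite -hs exprMn s2 mulrC.
  by rewrite ler_wpM2l ?divr_ge0 ?(ltW C20) ?(ltW l0)// lerXn2r ?nnegrE// ltW.
have t1 := dist_triangle dr (dm _ dr) dr'.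
have t2 := dist_triangle (dm _ dr) (dm _ dr') dr'.
have h3 := hm _ dr'; rewrite dist_sym in h3.
have h4 := hm _ dr; lra.
Qed.

Lemma dist_refl r : density pi r -> dist r r = 0.
Proof.
move=> dr; apply/eqP; rewrite eq_le dist_ge0 andbT leNgt; apply/negP => h.
have [d d0 /(_ r r dr dr) H] := dist_small h.
have /H : forall x, `|r x - r x| < d by move=> x; rewrite subrr normr0.
by rewrite ltxx.
Qed.

End Distance.

(** * Geodesics *)

Lemma natSinv_lt (R : realType) (e : R) : 0 < e -> exists n, n.+1%:R^-1 < e.
Proof.
move=> e0; have [n _ H] := near_infty_natSinv_lt (PosNum e0).
by exists n; apply: H => /=.
Qed.

(** A cluster point in the product topology, from Tychonoff's theorem. The index set will be times
    paired with points, which is uncountable, so no subsequence converges in general; approximation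
    on finitely many coordinates at arbitrarily late [n] is enough. *)
Lemma bounded_cluster (R : realType) (I : choiceType) (u : nat -> I -> R) (M : I -> R) :
  (forall n i, 0 <= u n i <= M i) -> exists f : I -> R, forall (J : finType) (h : R)
    (k : J -> I) N, 0 < h -> exists2 n, (N <= n)%N & forall j, `|u n (k j) - f (k j)| < h.
Proof.
move=> uM.
have cA : compact [set f : prod_topology (fun=> R : topologicalType) |
    forall i : I, `[0, M i]%classic (f i)].
  by apply: (@tychonoff I (fun=> R) (fun i => `[0, M i]%classic)) => i; exact: segment_compact.
have Fu : ProperFilter ((u : nat -> prod_topology (fun=> R : topologicalType)) @ \oo).
  exact: fmap_proper_filter.
have [|f [_ clf]] := cA _ Fu.
  by exists 0%N => // n _ i /=; rewrite in_itv/= uM.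
exists f => J h k N h0.
pose B : set (prod_topology (fun=> R : topologicalType)) :=
  [set g | forall j, `|g (k j) - f (k j)| < h].
have nB : nbhs f B.
  have HB j : nbhs f [set g : prod_topology (fun=> R : topologicalType) |
      `|g (k j) - f (k j)| < h].
    have nb : nbhs (f (k j)) [set y : R | `|y - f (k j)| < h].
      apply/nbhs_ballP; exists h => // y /=.
      by rewrite /ball/= distrC.
    exact: (@proj_continuous I (fun=> R) (k j) f _ nb).
  exact: (@filter_forall _ J (fun j => [set g : prod_topology (fun=> R : topologicalType) |
      `|g (k j) - f (k j)| < h]) (nbhs f) _ HB).
pose A : set (prod_topology (fun=> R : topologicalType)) :=
  [set g | exists2 n, (N <= n)%N & g = u n].
have FA : ((u : nat -> prod_topology (fun=> R : topologicalType)) @ \oo) A.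
  by exists N => // n Nn; exists n.
by have [_ [[n Nn ->] Bn]] := clf A B FA nB; exists n.
Qed.

(** Stability in the convexity inequality: [(1 - l) a^2 + l b^2 = l (1 - l) (a + b)^2 + ((1 - l) a -
    l b)^2]. Near-minimality bounds the last square and [a + b], and
    [a = l (a + b) + ((1 - l) a - l b)]. *)
Lemma split_bound (R : realType) (l e a b d e1 e2 : R) : 0 < l < 1 -> 0 < e ->
  0 <= a -> 0 <= b -> 0 <= d -> a ^+ 2 <= l * e1 -> b ^+ 2 <= (1 - l) * e2 ->
  e1 + e2 <= d ^+ 2 + (e / 2) ^+ 2 -> d <= a + b ->
  a <= l * d + e /\ b <= (1 - l) * d + e.
Proof.
move=> /andP[l0 l1] e0 a0 b0 d0 h1 h2 ee tr.
have l1' : 0 < 1 - l by rewrite subr_gt0.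
have ll : 0 < l * (1 - l) by rewrite mulr_gt0.
have e20 : 0 <= e / 2 by rewrite divr_ge0// ltW.
have g1 : (1 - l) * a ^+ 2 <= (1 - l) * (l * e1) by rewrite ler_pM2l.
have g2 : l * b ^+ 2 <= l * ((1 - l) * e2) by rewrite ler_pM2l.
have g3 : l * (1 - l) * (e1 + e2) <= l * (1 - l) * (d ^+ 2 + (e / 2) ^+ 2).
  by rewrite ler_pM2l.
have E : (1 - l) * a ^+ 2 + l * b ^+ 2 = l * (1 - l) * (a + b) ^+ 2 +
  ((1 - l) * a - l * b) ^+ 2 by ring.
have s0 := sqr_ge0 ((1 - l) * a - l * b).
have m1 : l * (1 - l) * (d ^+ 2) <= l * (1 - l) * (a + b) ^+ 2.
  by rewrite ler_pM2l// lerXn2r ?nnegrE ?addr_ge0.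
have m2 : l * (1 - l) * (e / 2) ^+ 2 <= (e / 2) ^+ 2.
  by rewrite ler_piMl ?sqr_ge0// mulr_ile1 ?(ltW l0) ?(ltW l1) ?(ltW l1')// lerBlDr lerDl ltW.
have k2 : a + b <= d + e / 2.
  rewrite -(@ler_pXn2r _ 2) ?nnegrE ?addr_ge0//.
  have m3 : (a + b) ^+ 2 <= d ^+ 2 + (e / 2) ^+ 2 by rewrite -(ler_pM2l ll); lra.
  by apply: (le_trans m3); have := mulr_ge0 d0 e20; rewrite sqrrD; lra.
have : `|(1 - l) * a - l * b| <= e / 2.
  by rewrite -(@ler_pXn2r _ 2) ?nnegrE// real_normK ?num_real//; lra.
rewrite ler_norml => /andP[n1 n2].
have c1 : l * (a + b) <= l * (d + e / 2) by rewrite ler_pM2l.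
have c2 : (1 - l) * (a + b) <= (1 - l) * (d + e / 2) by rewrite ler_pM2l.
have c3 : l * (e / 2) <= e / 2 by rewrite ler_piMl// ltW.
have c4 : (1 - l) * (e / 2) <= e / 2 by rewrite ler_piMl// lerBlDr lerDl ltW.
split; lra.
Qed.

Section Geodesics.
Variables (R : realType) (X : finType) (K : X -> X -> R) (pi : X -> R).
Implicit Types (r p q : X -> R).
Hypotheses (hK : markov_kernel K) (hirr : irreducible_kernel K)
  (hpi : prob_vector pi) (hstat : stationary K pi) (hrev : reversible K pi).

Local Notation dist := (dist K pi).

Lemma dist_split r0 r1 (l e : R) : density pi r0 -> density pi r1 ->
  0 < l < 1 -> 0 < e -> exists r, [/\ density pi r,
    dist r0 r <= l * dist r0 r1 + e & dist r r1 <= (1 - l) * dist r0 r1 + e].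
Proof.
move=> d0 d1 l01 e0; have lt : (W2 K pi r0 r1 < (dist r0 r1 ^+ 2 + (e / 2) ^+ 2)%:E)%E.
  by rewrite (dist_sqr hK hirr)// lte_fin ltrDl exprn_gt0// divr_gt0.
have [r [e1 [e2 [dr h1 h2 ee]]]] := W2_split hK hirr hpi hstat lt l01.
rewrite (dist_sqr hK hirr)// lee_fin in h1; rewrite (dist_sqr hK hirr)// lee_fin in h2.
have tr := dist_triangle hK hirr hpi hstat hrev d0 dr d1.
by have [] := @split_bound R l e _ _ _ e1 e2 l01 e0 (dist_ge0 K pi r0 r)
  (dist_ge0 K pi r r1) (dist_ge0 K pi r0 r1) h1 h2 ee tr; exists r.
Qed.

(** Peel off a first step of fraction [1 / (n + 2)]: the remaining distance divided by the remaining
    [n + 1] steps is again the same average, and half of [e] is spent at each of the two stages. *)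
Lemma dist_chain n p q (e : R) : density pi p -> density pi q -> 0 < e ->
  exists c : nat -> X -> R, [/\ c 0%N = p, c n.+1 = q, forall i, density pi (c i) &
    forall i, (i <= n)%N -> dist (c i) (c i.+1) <= dist p q / n.+1%:R + e].
Proof.
elim: n p q e => [|n IH] p q e dp dq e0.
  exists (fun i => if i == 0%N then p else q); split=> //.
    by move=> i; case: ifP.
  by move=> i; rewrite leqn0 => /eqP -> /=; rewrite divr1 lerDl ltW.
have n2 : 0 < (n.+2%:R : R) by rewrite ltr0n.
have l01 : 0 < (n.+2%:R^-1 : R) < 1 by rewrite invr_gt0 n2 invf_lt1// ltr1n.
have e2 : 0 < e / 2 by rewrite divr_gt0.
have [m [dm h1 h2]] := dist_split dp dq l01 e2.
have [c [c0 c1 cd cs]] := IH m q (e / 2) dm dq e2.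
exists (fun i => if i is j.+1 then c j else p); split=> //; first by case.
case=> [_|i /cs h].
  by rewrite c0 mulrC; apply: (le_trans h1); rewrite lerD2l; lra.
apply: (le_trans h).
have n1 : 0 < (n.+1%:R : R) by rewrite ltr0n.
have : dist m q / n.+1%:R <= dist p q / n.+2%:R + e / 2.
  rewrite ler_pdivrMr//; apply: (le_trans h2).
  have -> : 1 - n.+2%:R^-1 = n.+1%:R / n.+2%:R :> R.
    rewrite -[n.+1%:R](addrK 1) natr1 mulrBl divff ?mul1r//; exact: lt0r_neq0.
  have : e / 2 <= e / 2 * n.+1%:R by rewrite ler_pMr// ler1n.
  have -> : n.+1%:R / n.+2%:R * dist p q = dist p q / n.+2%:R * n.+1%:R by ring.
  by rewrite mulrDl lerD2l.
by move: (_ / _) (_ / n.+2%:R) => a b; lra.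
Qed.

Lemma dist_chain_le (c : nat -> X -> R) N (a : R) : (forall i, density pi (c i)) ->
  (forall i, (i < N)%N -> dist (c i) (c i.+1) <= a) ->
  forall i j, (i <= j <= N)%N -> dist (c i) (c j) <= (j - i)%:R * a.
Proof.
move=> cd cs i j /andP[]; elim: j => [|j IH].
  by rewrite leqn0 => /eqP -> _; rewrite (dist_refl hK hirr)// mul0r.
rewrite leq_eqVlt => /predU1P[<- _|ij jN].
  by rewrite (dist_refl hK hirr)// subnn mul0r.
apply: le_trans (dist_triangle hK hirr hpi hstat hrev (cd i) (cd j) (cd j.+1)) _.
rewrite subSn// -natr1 mulrDl mul1r lerD//; last exact: cs.
by apply: IH => //; exact: ltnW.
Qed.

Lemma approx_geodesic p q (e : R) : density pi p -> density pi q -> 0 < e ->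
  exists g : R -> X -> R, [/\ g 0 = p, g 1 = q, forall t, density pi (g t) &
    forall s t, 0 <= s -> s <= t -> t <= 1 -> dist (g s) (g t) <= (t - s) * dist p q + e].
Proof.
move=> dp dq e0; set d := dist p q.
have d0 : 0 <= d by exact: dist_ge0.
have d2 : 0 < d + 2 by rewrite ltr_wpDl.
have [n nE] := natSinv_lt (divr_gt0 e0 d2).
set v : R := n.+1%:R^-1 in nE.
have N0 : 0 < (n.+1%:R : R) by rewrite ltr0n.
have v0 : 0 < v by rewrite invr_gt0.
have v1 : v <= 1 by rewrite invf_le1// ler1n.
(* With [v = 1 / (n + 1)], an excess of [v^2] per step adds up to at most [v]. Rounding times down
   to the grid costs at most one more step, and [v (d + 2) <= e] absorbs everything. *)
have [c [c0 c1 cd cs]] := dist_chain n dp dq (exprn_gt0 2 v0).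
exists (fun t => c (Num.truncn (n.+1%:R * t))); split=> //.
- by rewrite mulr0 truncn0.
- by rewrite mulr1 natrK.
move=> s t s0 st t1.
have Ns0 : 0 <= n.+1%:R * s by rewrite mulr_ge0.
have Nt0 : 0 <= n.+1%:R * t by rewrite mulr_ge0// (le_trans s0).
have ij : (Num.truncn (n.+1%:R * s) <= Num.truncn (n.+1%:R * t))%N.
  by apply: le_truncn; rewrite ler_wpM2l.
have jN : (Num.truncn (n.+1%:R * t) <= n.+1)%N.
  by rewrite -[leqRHS](natrK (R := R)); apply: le_truncn; rewrite ler_piMr.
have {}ij' : (Num.truncn (n.+1%:R * s) <= Num.truncn (n.+1%:R * t) <= n.+1)%N by rewrite ij.
have cs' i : (i < n.+1)%N -> dist (c i) (c i.+1) <= d / n.+1%:R + v ^+ 2 by exact: cs.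
have := dist_chain_le cd cs' ij'.
move=> h; apply: (le_trans h); rewrite natrB//.
have /andP[_ i1] := truncn_itv Ns0; have /andP[j1 _] := truncn_itv Nt0.
rewrite -[(Num.truncn _).+1%:R]natr1 in i1.
have vN : n.+1%:R * v = 1 by rewrite divff// gt_eqF.
have dv : d / n.+1%:R = d * v by [].
have ve : v * (d + 2) <= e by rewrite -ler_pdivlMr// ltW.
rewrite dv; clear - i1 j1 vN ve v0 v1 d0 t1 s0 st.
move: (Num.truncn _)%:R (Num.truncn _)%:R i1 j1 => j i; move: n.+1%:R vN => N.
move: v d v0 v1 d0 ve => v d v0 v1 d0 ve vN i1 j1.
have a0 : 0 <= d * v + v ^+ 2 by rewrite addr_ge0 ?sqr_ge0// mulr_ge0// ltW.
apply: (@le_trans _ _ ((N * t - N * s + 1) * (d * v + v ^+ 2))).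
  by rewrite ler_wpM2r//; lra.
have -> : (N * t - N * s + 1) * (d * v + v ^+ 2) =
   (N * v) * ((t - s) * d) + (N * v) * (t - s) * v + d * v + v ^+ 2 by ring.
rewrite vN !mul1r.
have h1 : (t - s) * v <= 1 * v by rewrite ler_wpM2r//; lra.
have h2 : v ^+ 2 <= v by rewrite expr2 ler_piMl// ltW.
lra.
Qed.

Lemma density_le p x : density pi p -> p x <= (pi x)^-1.
Proof.
move=> [p0 p1]; have px := stationary_gt0 hK hirr hpi hstat x.
rewrite -[leRHS]mul1r ler_pdivlMr// -p1 (bigD1 x)//= mulrC lerDl sumr_ge0// => y _.
by rewrite mulr_ge0 ?(hpi.1 y).
Qed.

Lemma density_limit p : (forall h : R, 0 < h -> exists2 q, density pi q &
  forall x, `|q x - p x| < h) -> density pi p.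
Proof.
move=> H; split=> [x|].
  apply/ler_addgt0Pr => e e0; have [q [q0 _]] := H e e0.
  by move=> /(_ x); rewrite ltr_norml => /andP[_]; have := q0 x; lra.
apply/eqP; rewrite -subr_eq0 -normr_eq0 eq_le normr_ge0 andbT.
apply/ler_addgt0Pr => e e0; have [q [_ q1] qp] := H e e0.
rewrite add0r -{1}q1 -sumrB; apply: le_trans (ler_norm_sum _ _ _) _.
rewrite -[leRHS]mul1r -hpi.2 mulr_suml ler_sum// => x _.
by rewrite -mulrBr normrM ger0_norm ?(hpi.1 x)// ler_wpM2l ?(hpi.1 x)// distrC ltW.
Qed.

Lemma geodesic_exists p q : density pi p -> density pi q ->
  exists g, [/\ constant_speed_geodesic K pi g, g 0 = p & g 1 = q].
Proof.
move=> dp dq; have [d dE] : exists d, d = dist p q by exists (dist p q).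
have /choice[g gP] : forall n, exists g : R -> X -> R, [/\ g 0 = p, g 1 = q,
    forall t, density pi (g t) & forall s t, 0 <= s -> s <= t -> t <= 1 ->
      dist (g s) (g t) <= (t - s) * d + n.+1%:R^-1].
  by rewrite dE => n; apply: approx_geodesic => //; rewrite invr_gt0.
pose u n (i : R * X) := g n i.1 i.2.
have [|f fP] := @bounded_cluster R (R * X)%type u (fun i => (pi i.2)^-1).
  move=> n [t x]; have [_ _ gd _] := gP n.
  by rewrite /u/= (gd t).1 density_le.
pose G t x := f (t, x).
(* Two times are handled at once, so that a single late [g n] approximates the limit at both. *)
have near s t (h : R) N : 0 < h -> exists2 n, (N <= n)%N &
    forall x, `|g n s x - G s x| < h /\ `|g n t x - G t x| < h.
  move=> h0; have [n Nn H] := fP (bool * X)%type h (fun j => (if j.1 then s else t, j.2)) N h0.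
  by exists n => // x; split; [exact: (H (true, x))|exact: (H (false, x))].
have Gd t : density pi (G t).
  apply: density_limit => h h0; have [n _ H] := near t t h 0%N h0.
  by exists (g n t) => [|x]; [have [] := gP n|have [] := H x].
have Gend t r : (forall n, g n t = r) -> G t = r.
  move=> gr; apply/funext => x; apply/eqP; rewrite -subr_eq0 -normr_eq0 eq_le normr_ge0 andbT.
  apply/ler_addgt0Pr => e e0; have [n _ H] := near t t e 0%N e0.
  by rewrite add0r distrC -(gr n) ltW//; have [] := H x.
have G0 : G 0 = p by apply: Gend => n; have [] := gP n.
have G1 : G 1 = q by apply: Gend => n; have [] := gP n.
have tri := @dist_triangle R X K pi hK hirr hpi hstat hrev.
have Gle s t : 0 <= s -> s <= t -> t <= 1 -> dist (G s) (G t) <= (t - s) * d.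
  move=> s0 st t1; apply/ler_addgt0Pr => e e0.
  have e3 : 0 < e / 3 by rewrite divr_gt0.
  have [h h0 hP] := dist_small hK hirr hpi hstat hrev e3.
  have [N NE] := natSinv_lt e3.
  have [n Nn H] := near s t h N h0.
  have [_ _ gd gle] := gP n.
  have h1 : dist (G s) (g n s) < e / 3 by apply: hP => // x; rewrite distrC; have [] := H x.
  have h2 : dist (g n t) (G t) < e / 3 by apply: hP => // x; have [] := H x.
  have h3 := gle s t s0 st t1.
  have h4 : n.+1%:R^-1 < e / 3.
    by apply: le_lt_trans NE; rewrite lef_pV2 ?posrE ?ltr0n// ler_nat.
  have h5 := tri _ _ _ (Gd s) (gd s) (Gd t).
  have h6 := tri _ _ _ (gd s) (gd t) (Gd t).
  move: h1 h2 h3 h4 h5 h6; move: (n.+1%:R^-1) ((t - s) * d) (dist _ _) (dist _ _) (dist _ _) (dist _ _) (dist _ _).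
  by clear - e0; move=> *; lra.
exists G; split=> //; split=> // s t /andP[s0 s1] /andP[t0 t1].
rewrite G0 G1 !(dist_W hK hirr hpi hstat hrev)// -EFinM; congr EFin.
wlog st : s t s0 s1 t0 t1 / s <= t.
  move=> H; have [st|/ltW ts] := leP s t; first exact: H.
  by rewrite (dist_sym hK hirr hpi hstat) distrC; exact: H.
rewrite distrC ger0_norm ?subr_ge0// -dE; apply/eqP; rewrite eq_le Gle//=.
(* The reverse inequality is forced: the pieces before [s] and after [t] have length at most [s d]
   and [(1 - t) d], and the total is at least [d]. *)
have h1 := Gle 0 s (lexx _) s0 s1; have h2 := Gle t 1 t0 t1 (lexx _).
rewrite G0 subr0 in h1; rewrite G1 in h2.
have h3 := tri _ _ _ dp (Gd s) dq; have h4 := tri _ _ _ (Gd s) (Gd t) dq.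
rewrite -dE in h3; move: h1 h2 h3 h4.
by move: (dist p (G s)) (dist (G t) q) (dist (G s) (G t)) (dist (G s) q) => *; lra.
Qed.

End Geodesics.

(** * HWI, logarithmic Sobolev and Poincare inequalities *)

Lemma graph_formC (R : realType) (X : finType) (c : X -> X -> R) phi psi :
  graph_form c phi psi = graph_form c psi phi.
Proof.
by congr (_ * _); apply: eq_bigr => x _; apply: eq_bigr => y _; congr (_ * _); exact: mulrC.
Qed.

(** The tangent line at [a] of the convex function [x ln x], whose slope is [ln a + 1]; [b = 0] is
    allowed. *)
Lemma entropy_tangent_term (R : realType) (a b : R) : 0 < a -> 0 <= b ->
  a * ln a - b * ln b <= (a - b) * ln a + (a - b).
Proof.
move=> a0; rewrite le_eqVlt => /predU1P[<-|b0].
  by rewrite mul0r !subr0 lerDl ltW.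
have ab : -1 < a / b - 1 by rewrite ltrBrDl subrr divr_gt0.
have := le_ln1Dx ab; rewrite addrC subrK ln_div ?posrE// => h.
have : b * (ln a - ln b) <= a - b.
  apply: le_trans (ler_wpM2l (ltW b0) h) _.
  by rewrite mulrBr mulr1 mulrCA divff ?mulr1// gt_eqF.
by lra.
Qed.

(** [c = 1 / (1 - a)] bounds the second derivative [1 / (1 + v)] on the interval. The derivative of
    the difference [D] has the sign of [v], so the mean value theorem gives [D u >= D 0 = 0]. *)
Lemma entropy_quadratic_term (R : realType) (a u : R) : a < 1 -> `|u| <= a ->
  (1 + u) * ln (1 + u) <= u + u ^+ 2 / (2 * (1 - a)).
Proof.
move=> a1 ua; pose c := (1 - a)^-1.
have c0 : 0 < c by rewrite invr_gt0 subr_gt0.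
have c1 : 1 <= c.
  by rewrite invf_ge1 ?subr_gt0// lerBlDr lerDl (le_trans _ ua).
pose D v : R := v + c / 2 * v ^+ 2 - (1 + v) * ln (1 + v).
pose D' v : R := c * v - ln (1 + v).
have dD (v : R) : `|v| <= a -> is_derive v 1 D (D' v).
  move=> va; have v1 : 0 < 1 + v.
    by move: va; rewrite ler_norml => /andP[+ _]; lra.
  have d1 : is_derive v 1 (fun v : R => 1 + v) 1.
    by have := is_deriveD (is_derive_cst (1:R) v 1) (is_derive_id v 1); rewrite add0r.
  have d2 : is_derive v 1 (fun v : R => ln (1 + v)) (1 + v)^-1.
    have := @is_derive1_comp R (@ln R) (fun v : R => 1 + v) v _ _ (is_derive1_ln v1) d1.
    by rewrite mulr1.
  have d3 := is_deriveM d1 d2.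
  have d4 := is_deriveM (is_derive_cst (c / 2) v 1) (is_deriveX 2 (is_derive_id v 1)).
  apply: is_derive_eq (is_deriveB (is_deriveD (is_derive_id v 1) d4) d3) _.
  rewrite /D' /GRing.scale/= mulr0 addr0 divff ?gt_eqF//.
  by rewrite !mulr1 expr1; lra.
have D0 : D 0 = 0 by rewrite /D [1 + 0]addr0 ln1 mulr0 subr0 add0r expr0n mulr0.
have lnle v : `|v| <= a -> 0 <= D' v * v.
  move=> va; have v1 : 1 - a <= 1 + v.
    by move: va; rewrite ler_norml => /andP[+ _]; lra.
  have v0 : 0 < 1 + v by rewrite (lt_le_trans _ v1)// subr_gt0.
  have [v0'|v0'] := leP 0 v.
    rewrite mulr_ge0// subr_ge0; apply: le_trans (le_ln1Dx _) _; first by lra.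
    by rewrite -{1}[v]mul1r ler_wpM2r.
  rewrite mulr_le0// ?(ltW v0')// subr_le0.
  have h := @le_ln1Dx R ((1 + v)^-1 - 1).
  rewrite [1 + (_ - 1)]addrC subrK lnV ?posrE// in h.
  have : - ln (1 + v) <= (1 + v)^-1 - 1.
    by apply: h; rewrite ltrBrDl subrr invr_gt0.
  have -> : (1 + v)^-1 - 1 = (1 + v)^-1 * - v.
    by field; rewrite gt_eqF.
  have : (1 + v)^-1 * - v <= c * - v.
    rewrite ler_wpM2r ?oppr_ge0 ?(ltW v0')//.
    by rewrite lef_pV2// posrE subr_gt0.
  by lra.
have cD l r : l <= r -> -a <= l -> r <= a -> {within `[l, r], continuous D}.
  move=> lr al ra; apply: derivable_within_continuous => v; rewrite in_itv/= => /andP[lv vr].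
  by have [] : is_derive v 1 D (D' v) by apply: dD; rewrite ler_norml; lra.
suff : 0 <= D u by rewrite /D /c invfM; lra.
move: ua; rewrite ler_norml => /andP[au ua].
have [u0|u0] := leP 0 u.
  have [||v] := @MVT_segment R D D' 0 u u0.
  - by move=> v; rewrite in_itv/= => /andP[v0 vu]; apply: dD; rewrite ler_norml; lra.
  - by apply: cD => //; lra.
  rewrite in_itv/= D0 !subr0 => /andP[v0 vu] ->.
  have h : 0 <= D' v * v by apply: lnle; rewrite ler_norml; lra.
  have [->|vn] := eqVneq v 0; first by rewrite /D' addr0 ln1 mulr0 subrr mul0r.
  have vp : 0 < v by rewrite lt0r vn.
  by rewrite mulr_ge0// -(pmulr_lge0 _ vp).
have [||v] := @MVT_segment R D D' u 0 (ltW u0).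
- by move=> v; rewrite in_itv/= => /andP[v0 vu]; apply: dD; rewrite ler_norml; lra.
- by apply: cD => //; lra.
rewrite in_itv/= D0 !sub0r => /andP[v0 vu] Dv; rewrite -oppr_le0 Dv.
have h : 0 <= D' v * v by apply: lnle; rewrite ler_norml; lra.
have [->|vn] := eqVneq v 0; first by rewrite /D' addr0 ln1 mulr0 subrr mul0r.
have vp : v < 0 by rewrite lt_neqAle vn.
by rewrite mulr_le0_ge0 ?oppr_ge0 ?(ltW u0)// -(nmulr_lge0 _ vp).
Qed.

Section Inequalities.
Variables (R : realType) (X : finType) (K : X -> X -> R) (pi : X -> R).
Implicit Types (r p q : X -> R).
Hypotheses (hK : markov_kernel K) (hirr : irreducible_kernel K)
  (hpi : prob_vector pi) (hstat : stationary K pi) (hrev : reversible K pi).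

Local Notation dist := (dist K pi).
Local Notation Gamma r := (graph_form (edge K pi r)).
Local Notation lnf r := (fun x => ln (r x)).

Lemma Gamma_ge0 r phi : 0 <= Gamma r phi phi.
Proof. by apply: graph_form_ge0; exact: edge_ge0. Qed.

Lemma Gamma_mono (m : R) r r' phi : 0 <= m -> (forall x, 0 <= r' x) ->
  (forall x, m * r' x <= r x) -> m * Gamma r' phi phi <= Gamma r phi phi.
Proof.
by move=> m0 r0 rr; rewrite -graph_formZ; apply: graph_form_mono; exact: edge_mono.
Qed.

(** Sum of the tangent inequalities; the linear remainder drops out because both densities have mass
    1. *)
Lemma entropy_tangent r r' : density pi r -> density pi r' -> (forall x, 0 < r x) ->
  entropy pi r - entropy pi r' <= \sum_x pi x * (r x - r' x) * ln (r x).
Proof.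
move=> dr dr' r0.
have -> : \sum_x pi x * (r x - r' x) * ln (r x) =
    \sum_x pi x * ((r x - r' x) * ln (r x) + (r x - r' x)).
  under [RHS]eq_bigr do rewrite mulrDr mulrA.
  by rewrite big_split/= (sum_diff dr' dr) addr0.
rewrite /entropy -sumrB ler_sum// => x _; rewrite -!mulrA -mulrBr ler_wpM2l ?(hpi.1 x)//.
by apply: entropy_tangent_term => //; exact: dr'.1.
Qed.

Lemma entropy_one : entropy pi density_one = 0.
Proof. by rewrite /entropy big1// => x _; rewrite /density_one ln1 mulr0. Qed.

Lemma entropy_ge0 r : density pi r -> 0 <= entropy pi r.
Proof.
move=> dr; have d1 := density_one_density hpi.
have := entropy_tangent d1 dr (fun=> ltr01); rewrite entropy_one sub0r.
by rewrite big1 ?oppr_le0// => x _; rewrite /density_one ln1 mulr0.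
Qed.

(** The discrete chain rule that motivates the logarithmic mean: the gradient of [r] is the mobility
    times the gradient of [ln r]. *)
Lemma dirichlet_ln r phi : (forall x, 0 < r x) ->
  dirichlet K pi r phi = Gamma r (lnf r) phi.
Proof.
move=> r0; rewrite dirichletE /graph_form; apply: (congr1 ( *%R 2^-1)).
apply: eq_bigr => x _; apply: eq_bigr => y _.
rewrite edge_one /edge /rho_hat.
have -> : r y - r x = - (r x - r y) by rewrite opprB.
by rewrite -(log_meanMln (r0 x) (r0 y)); ring.
Qed.

(** A curve of small energy stays uniformly close to its start. Duality is applied to the indicator
    of [x], whose form is bounded along any curve because densities are at most [1 / pi]. *)
Lemma curve_near : exists2 C : R, 0 < C & forall g psi (s E : R) x,
  smooth_curve K pi g psi -> 0 <= s <= 1 -> (energy K pi g psi <= E%:E)%E ->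
  (g s x - g 0 x) ^+ 2 <= C * E.
Proof.
pose e x (y : X) : R := (y == x)%:R.
pose M := 1 + \sum_x (pi x)^-1.
have pi0 := stationary_gt0 hK hirr hpi hstat.
have M0 : 0 < M by rewrite ltr_pwDl// sumr_ge0// => x _; rewrite invr_ge0 ltW.
have Mpi x : (pi x)^-1 <= M.
  rewrite /M (bigD1 x)//= addrCA lerDl addr_ge0// sumr_ge0// => y _.
  by rewrite invr_ge0 ltW.
pose G x := M * Gamma density_one (e x) (e x).
have G0 x : 0 <= G x by rewrite mulr_ge0 ?Gamma_ge0// ltW.
pose C x := (pi x)^-1 ^+ 2 * G x.
have C0 x : 0 <= C x by rewrite mulr_ge0 ?sqr_ge0.
exists (1 + \sum_x C x) => [|g psi s E x cv s01 HE].
  by rewrite ltr_pwDl// sumr_ge0.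
have E0 : 0 <= E by rewrite -lee_fin (le_trans (energy_ge0 hK hirr hpi hstat g psi)).
have := @dual_lower_bound R X K pi hK hirr hpi hstat hrev g psi (e x) s (G x) E cv s01 (G0 x).
move=> /(_ _ HE) h.
have {}h : (\sum_y pi y * (g s y - g 0 y) * e x y) ^+ 2 <= G x * E.
  apply: h => t /andP[t0 ts]; rewrite /G -ler_pdivrMl//.
  have dt : density pi (g t).
    by apply: (curve_density cv); rewrite (ltW t0) (le_trans (ltW ts))//; case/andP: s01.
  apply: Gamma_mono; [by rewrite invr_ge0 ltW|exact: dt.1|move=> y].
  rewrite /density_one ler_pdivrMl// mulr1.
  by apply: le_trans (Mpi y); apply: (density_le hK hirr hpi hstat).
have : (pi x * (g s x - g 0 x)) ^+ 2 <= G x * E.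
  apply: le_trans h; rewrite (bigD1 x)//= big1 ?addr0.
    by rewrite /e eqxx mulr1.
  by move=> y yx; rewrite /e (negbTE yx) mulr0.
rewrite exprMn -ler_pdivlMl ?exprn_gt0// -exprVn mulrA -/(C x) => {}h.
apply: (le_trans h); rewrite ler_wpM2r// (bigD1 x)//= addrCA lerDl.
by rewrite addr_ge0// sumr_ge0.
Qed.

Lemma dist_energy r r' (e : R) : density pi r -> density pi r' -> 0 < e ->
  exists g psi, [/\ smooth_curve K pi g psi, g 0 = r, g 1 = r' &
    (energy K pi g psi <= (dist r r' ^+ 2 + e)%:E)%E].
Proof.
move=> dr dr' e0; have lt : (W2 K pi r r' < (dist r r' ^+ 2 + e)%:E)%E.
  by rewrite (dist_sqr hK hirr)// lte_fin ltrDl.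
by have [g [psi [cv g0 g1 /ltW ge]]] := W2_lt_energy lt; exists g, psi.
Qed.

Lemma dist_eq0 r r' : density pi r -> density pi r' -> dist r r' = 0 -> r = r'.
Proof.
move=> dr dr' d0; apply/funext => x; apply/eqP; rewrite eq_sym -subr_eq0 -sqrf_eq0.
rewrite eq_le sqr_ge0 andbT; have [C C0 H] := curve_near.
apply/ler_addgt0Pr => e e0; rewrite add0r.
have [g [psi [cv g0 g1]]] := dist_energy dr dr' (divr_gt0 e0 C0).
rewrite d0 expr0n add0r => ge; have := H g psi 1 (e / C) x cv _ ge.
by rewrite ler01 lexx g0 g1 mulrCA divff ?mulr1 ?gt_eqF// => ->.
Qed.

Lemma sqrt_mean_le (a G d eta : R) : 0 <= G -> 0 <= d -> 0 <= eta ->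
  a ^+ 2 <= (1 + eta) * G * d ^+ 2 -> `|a| <= (1 + eta) * Num.sqrt G * d.
Proof.
move=> G0 d0 e0 h; rewrite -(@ler_pXn2r _ 2) ?nnegrE ?mulr_ge0 ?sqrtr_ge0 ?addr_ge0//.
rewrite real_normK ?num_real//; apply: (le_trans h).
rewrite !exprMn sqr_sqrtr// ler_wpM2r ?sqr_ge0// ler_wpM2r//.
by rewrite expr2 ler_peMl ?addr_ge0// lerDl.
Qed.

(* Near a positive density the kinetic form is almost constant, so that [dist]
   is locally controlled from below by duality. *)
Lemma dual_dist r phi (eta : R) : density pi r -> (forall x, 0 < r x) -> 0 < eta ->
  exists2 d : R, 0 < d & forall r', density pi r' -> dist r r' < d ->
  `|\sum_x pi x * (r' x - r x) * phi x| <= (1 + eta) * Num.sqrt (Gamma r phi phi) * dist r r'.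
Proof.
move=> dr r0 eta0; have [C C0 H] := curve_near.
have [m m0 mr] : exists2 m : R, 0 < m & forall x, m <= r x.
  pose S := 1 + \sum_x (r x)^-1.
  have S0 : 0 < S by rewrite ltr_pwDl// sumr_ge0// => x _; rewrite invr_ge0 ltW.
  exists S^-1 => [|x]; first by rewrite invr_gt0.
  rewrite -[leRHS]invrK lef_pV2 ?posrE ?invr_gt0//.
  rewrite /S (bigD1 x)//= addrCA lerDl addr_ge0// sumr_ge0// => y _.
  by rewrite invr_ge0 ltW.
(* Energy below [E0] confines the curve to distance [eta * m <= eta * r x] from [r], so its form
   stays below [1 + eta] times that of [r]. *)
pose E0 := (eta * m) ^+ 2 / C.
have E00 : 0 < E0 by rewrite divr_gt0// exprn_gt0// mulr_gt0.
exists (Num.sqrt E0) => [|r' dr' dE]; first by rewrite sqrtr_gt0.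
have d2 : dist r r' ^+ 2 < E0.
  by rewrite -(sqr_sqrtr (ltW E00)) ltr_pXn2r// nnegrE ?sqrtr_ge0 ?dist_ge0.
have F0 := Gamma_ge0 r phi.
have eta1 : 0 <= 1 + eta by rewrite addr_ge0// ltW.
have G0 : 0 <= (1 + eta) * Gamma r phi phi by exact: mulr_ge0.
apply: sqrt_mean_le => //; [exact: dist_ge0|exact: ltW|].
apply/ler_addgt0Pr => e e0.
(* The first bound keeps the energy of the near-optimal curve below [E0]; the second makes its
   excess cost at most [e] after multiplication by the form. *)
pose e1 := Num.min (E0 - dist r r' ^+ 2) (e / ((1 + eta) * Gamma r phi phi + 1)).
have e10 : 0 < e1 by rewrite lt_min subr_gt0 d2/= divr_gt0// ltr_wpDl.
have [g [psi [cv g0 g1 ge]]] := dist_energy dr dr' e10.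
have E1le : dist r r' ^+ 2 + e1 <= E0 by rewrite -lerBrDl ge_min lexx.
have ge0 : (energy K pi g psi <= E0%:E)%E by apply: (le_trans ge); rewrite lee_fin.
have := @dual_lower_bound R X K pi hK hirr hpi hstat hrev g psi phi 1 _ _ cv _ G0 _ ge.
rewrite g0 g1 ler01 lexx => /(_ isT) h.
apply: le_trans (h _) _; last first.
  rewrite mulrDr lerD2l.
  have e1e : e1 * ((1 + eta) * Gamma r phi phi + 1) <= e.
    by rewrite -ler_pdivlMr ?ltr_wpDl// ge_min lexx orbT.
  by apply: le_trans e1e; rewrite mulrC mulrDr mulr1 lerDl ltW.
move=> t /andP[t0 t1]; have t01 : 0 <= t <= 1 by rewrite !ltW.
have dt := curve_density cv t01.
have eta1' : 0 < 1 + eta by rewrite addr_gt0.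
rewrite -ler_pdivrMl//.
apply: Gamma_mono; [by rewrite invr_ge0|exact: dt.1|move=> x].
rewrite ler_pdivrMl//.
have := H g psi t E0 x cv t01 ge0; rewrite g0 /E0 mulrCA divff ?mulr1 ?gt_eqF//.
move=> hx; have : `|g t x - r x| <= eta * m.
  by rewrite -(@ler_pXn2r _ 2) ?nnegrE ?mulr_ge0 ?(ltW eta0) ?(ltW m0)// real_normK// num_real.
move=> /ler_normlW; have : eta * m <= eta * r x by rewrite ler_pM2l.
by lra.
Qed.

Lemma sqrte_dist r : density pi r -> W K pi r density_one = (dist r density_one)%:E.
Proof. by move=> dr; apply: (dist_W hK hirr) => //; exact: density_one_density. Qed.

Lemma HWI_positive kappa r : Ric_ge K pi kappa -> density pi r -> (forall x, 0 < r x) ->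
  entropy pi r <= dist r density_one * Num.sqrt (Gamma r (lnf r) (lnf r))
    - kappa / 2 * dist r density_one ^+ 2.
Proof.
move=> ric dr r0; have d1 := density_one_density hpi.
have [g [cg g0 g1]] := geodesic_exists hK hirr hpi hstat hrev dr d1.
have gd := cg.1; have gW := cg.2.
rewrite -lerBDr opprK.
set H := entropy pi r; set I := Num.sqrt _.
have [d dE] : exists d, d = dist r density_one by exists (dist r density_one).
rewrite -dE; have d0 : 0 <= d by rewrite dE dist_ge0.
have I0 : 0 <= I by exact: sqrtr_ge0.
apply/ler_addgt0Pr => e e0.
have dI0 : 0 <= d * I by exact: mulr_ge0.
(* The final error [e] is shared equally: [eta] controls the loss in duality, and a small [t]
   controls the quadratic part of the curvature term, which remains after division by [t]. *)
pose eta := e / 2 / (d * I + 1).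
have eta0 : 0 < eta by rewrite !divr_gt0// ltr_wpDl.
have [del del0 Hd] := dual_dist (lnf r) dr r0 eta0.
pose B := `|kappa / 2| * d ^+ 2.
have B0 : 0 <= B by rewrite mulr_ge0 ?sqr_ge0.
have [t t0 [t1 td tB]] : exists2 t : R, 0 < t & [/\ t <= 1, t * d < del & t * B <= e / 2].
  pose t := Num.min 1 (Num.min (del / (d + 1)) (e / 2 / (B + 1))).
  have t0 : 0 < t by rewrite !lt_min ltr01 !divr_gt0// ltr_wpDl.
  exists t => //; split; first by rewrite ge_min lexx.
    have : t * (d + 1) <= del by rewrite -ler_pdivlMr ?ltr_wpDl// !ge_min lexx !orbT.
    by rewrite mulrDr mulr1; apply: lt_le_trans; rewrite ltrDl.
  have : t * (B + 1) <= e / 2 by rewrite -ler_pdivlMr ?ltr_wpDl// !ge_min lexx !orbT.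
  by apply: le_trans; rewrite ler_wpM2l ?lerDl// ltW.
have t01 : 0 <= t <= 1 by rewrite (ltW t0).
have dgt := gd t t01.
have dt : dist r (g t) = t * d.
  have := gW 0 t; rewrite lexx ler01 => /(_ isT t01).
  rewrite g0 g1 !(dist_W hK hirr hpi hstat hrev)// -EFinM => -[->].
  by rewrite sub0r normrN gtr0_norm// dE.
have := ric g cg t t01; rewrite g0 g1 (dist_W hK hirr hpi hstat hrev)// entropy_one mulr0 addr0.
rewrite -EFin_expe -EFinM -EFinB lee_fin -dE -/H => hric.
have h1 := Hd (g t) dgt; rewrite dt in h1; have {}h1 := h1 td.
have h2 := entropy_tangent dr dgt r0; rewrite -/H in h2.
have h3 : \sum_x pi x * (r x - g t x) * ln (r x) <= (1 + eta) * I * (t * d).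
  apply: le_trans h1; apply: le_trans (ler_norm _) _; rewrite -normrN -sumrN.
  by rewrite le_eqVlt; apply/orP; left; apply/eqP; congr `|_|; apply: eq_bigr => x _; ring.
have h4 : eta * (d * I) <= e / 2.
  have : eta * (d * I + 1) <= e / 2 by rewrite /eta divfK// gt_eqF// ltr_wpDl.
  by apply: le_trans; rewrite ler_wpM2l ?lerDl// ltW.
have h5 : kappa / 2 * t * d ^+ 2 <= e / 2.
  apply: le_trans tB; rewrite /B mulrAC [leLHS]mulrC ler_wpM2l ?(ltW t0)//.
  by rewrite ler_wpM2r ?sqr_ge0// ler_norm.
have h6 : t * H <= t * ((1 + eta) * I * d - kappa / 2 * (1 - t) * d ^+ 2).
  by move: h2 h3 hric; move: (entropy pi (g t)) (\sum_x _) => a b; lra.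
rewrite ler_pM2l// in h6.
by move: h4 h5 h6; clear; move: (H) (I) (d ^+ 2) => a b c; lra.
Qed.

Lemma fisherE r : (forall x, 0 < r x) -> fisher K pi r = (Gamma r (lnf r) (lnf r))%:E.
Proof. by move=> r0; rewrite /fisher (introT forallP r0) dirichlet_ln. Qed.

Lemma Ric_HWI kappa : Ric_ge K pi kappa -> HWI K pi kappa.
Proof.
move=> ric r dr; rewrite sqrte_dist// -EFin_expe -EFinM.
have [r0|/existsNP[x /negP]] := pselect (forall x, 0 < r x).
  rewrite (fisherE r0) /= -EFinM -EFinB lee_fin; exact: HWI_positive.
rewrite -leNgt => rx.
have -> : fisher K pi r = +oo%E.
  by rewrite /fisher; case: forallP => // /(_ x); rewrite ltNge rx.
(* Positivity matters since 0 times [+oo] is 0 here; the distance is positive because [r] has a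
   nonpositive value and hence is not the constant density. *)
have d0 : 0 < dist r density_one.
  rewrite lt_neqAle dist_ge0 andbT eq_sym; apply/eqP => d0.
  have := dist_eq0 dr (density_one_density hpi) d0.
  by move=> h; move: rx; rewrite h /density_one ler10.
by rewrite /= gt0_muley ?lte_fin// addye// leey.
Qed.

Lemma Ric_MLSI lambda : 0 < lambda -> Ric_ge K pi lambda -> MLSI K pi lambda.
Proof.
move=> l0 ric r dr.
have [r0|/existsNP[x /negP]] := pselect (forall x, 0 < r x); last first.
  rewrite -leNgt => rx.
  have -> : fisher K pi r = +oo%E.
    by rewrite /fisher; case: forallP => // /(_ x); rewrite ltNge rx.
  by rewrite gt0_muley ?leey// lte_fin divr_gt0// mulr_gt0.
rewrite fisherE// -EFinM lee_fin; apply: le_trans (HWI_positive ric dr r0) _.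
set d := dist _ _; have F0 := Gamma_ge0 r (lnf r); move: F0.
move: (Gamma r _ _) (d) => I a I0; rewrite -{2}(sqr_sqrtr I0).
move: (Num.sqrt I) => s; rewrite div1r ler_pdivlMl ?mulr_gt0//.
by have := sqr_ge0 (s - lambda * a); nra.
Qed.

Lemma Talagrand_Poincare lambda : 0 < lambda -> modified_Talagrand K pi lambda ->
  Poincare K pi lambda.
Proof.
move=> l0 tal phi phi0; set N := L2norm2 pi phi; set E := dirichlet K pi phi phi.
have d1 := density_one_density hpi.
have N0 : 0 <= N by apply: sumr_ge0 => x _; rewrite mulr_ge0 ?sqr_ge0 ?(hpi.1 x).
have EE : E = Gamma density_one phi phi by rewrite /E dirichletE.
have E0 : 0 <= E by rewrite EE Gamma_ge0.
pose M := 1 + \sum_x `|phi x|.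
have M0 : 0 < M by rewrite ltr_pwDl// sumr_ge0.
have phiM x : `|phi x| < M.
  by rewrite /M (bigD1 x)//= addrCA ltrDl ltr_pwDl// sumr_ge0.
(* Two of the three factors come from squaring the duality bound, the third from the quadratic bound
   on the entropy. *)
have main (eta : R) : 0 < eta -> N <= (1 + eta) ^+ 3 * (E / lambda).
  move=> eta0.
  have [del del0 Hd] := dual_dist phi d1 (fun=> ltr01) eta0.
  have [h h0 Hh] := dist_small hK hirr hpi hstat hrev del0.
  (* The bound by [h / 2] keeps the perturbation where [dual_dist] applies; the bound by
     [eta / (1 + eta)] gives [1 / (1 - a) <= 1 + eta]. *)
  pose a := Num.min (h / 2) (eta / (1 + eta)).
  have a0 : 0 < a by rewrite lt_min !divr_gt0// addr_gt0.
  have ah : a < h by rewrite gt_min; apply/orP; left; lra.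
  have aeta : a <= eta / (1 + eta) by rewrite ge_min lexx orbT.
  have a1 : a < 1.
    by apply: (le_lt_trans aeta); rewrite ltr_pdivrMr ?addr_gt0// mul1r ltrDr.
  have ceta : (1 - a)^-1 <= 1 + eta.
    rewrite -[leRHS]invrK lef_pV2 ?posrE ?subr_gt0 ?invr_gt0 ?addr_gt0//.
    have -> : (1 + eta)^-1 = 1 - eta / (1 + eta) by field; rewrite gt_eqF// addr_gt0.
    by rewrite lerD2l lerN2.
  have [s s0 sphi] : exists2 s : R, 0 < s & forall x, `|s * phi x| <= a.
    exists (a / M) => [|x]; first by rewrite divr_gt0.
    have aM : 0 < a / M by rewrite divr_gt0.
    by rewrite normrM gtr0_norm// mulrAC ler_pdivrMr// ler_pM2l// ltW.
  pose r x := 1 + s * phi x.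
  have dr : density pi r.
    split=> [x|]; first by move: (sphi x); rewrite ler_norml /r => /andP[]; lra.
    have -> : \sum_x pi x * r x = \sum_x pi x + s * \sum_x phi x * pi x.
      by rewrite mulr_sumr -big_split; apply: eq_bigr => x _; rewrite /r/=; ring.
    by rewrite hpi.2 phi0 mulr0 addr0.
  have dd : dist density_one r < del.
    apply: Hh => // x; rewrite /density_one /r opprD addNKr normrN.
    by apply: le_lt_trans ah; exact: sphi.
  have h1 := Hd r dr dd; rewrite -EE in h1.
  have sE : \sum_x pi x * (r x - density_one x) * phi x = s * N.
    by rewrite /N /L2norm2 mulr_sumr; apply: eq_bigr => x _; rewrite /r /density_one; ring.
  rewrite sE ger0_norm ?mulr_ge0 ?(ltW s0)// in h1.
  have HE : entropy pi r <= s ^+ 2 * N * (1 + eta) / 2.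
    apply: (@le_trans _ _ (\sum_x pi x * (s * phi x + (s * phi x) ^+ 2 / (2 * (1 - a))))).
      apply: ler_sum => x _; rewrite -mulrA ler_wpM2l ?(hpi.1 x)//.
      exact: entropy_quadratic_term.
    have -> : \sum_x pi x * (s * phi x + (s * phi x) ^+ 2 / (2 * (1 - a))) =
        s * (\sum_x phi x * pi x) + s ^+ 2 / 2 * (1 - a)^-1 * N.
      rewrite /N /L2norm2 !mulr_sumr -big_split; apply: eq_bigr => x _ /=.
      by rewrite invfM; ring.
    rewrite phi0 mulr0 add0r.
    have : s ^+ 2 / 2 * N * (1 - a)^-1 <= s ^+ 2 / 2 * N * (1 + eta).
      by rewrite ler_wpM2l// mulr_ge0// divr_ge0// sqr_ge0.
    by lra.
  have := tal r dr; rewrite sqrte_dist// lee_fin (dist_sym hK hirr hpi hstat) => h2.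
  have D0 := dist_ge0 K pi density_one r.
  have H0 := entropy_ge0 dr.
  have h3 : dist density_one r ^+ 2 <= 2 / lambda * entropy pi r.
    rewrite -(@sqr_sqrtr _ (2 / lambda * _)) ?mulr_ge0 ?invr_ge0 ?(ltW l0)//.
    by rewrite lerXn2r ?nnegrE ?sqrtr_ge0.
  have h4 : (s * N) ^+ 2 <= (1 + eta) ^+ 2 * E * dist density_one r ^+ 2.
    have -> : (1 + eta) ^+ 2 * E * dist density_one r ^+ 2 =
       ((1 + eta) * Num.sqrt E * dist density_one r) ^+ 2 by rewrite !exprMn (sqr_sqrtr E0).
    have sN : 0 <= s * N := mulr_ge0 (ltW s0) N0.
    by rewrite lerXn2r// nnegrE// (le_trans sN).
  have h5 : dist density_one r ^+ 2 <= s ^+ 2 * N * ((1 + eta) / lambda).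
    apply: (le_trans h3).
    have : 2 / lambda * entropy pi r <= 2 / lambda * (s ^+ 2 * N * (1 + eta) / 2).
      by rewrite ler_wpM2l// divr_ge0// ltW.
    by lra.
  have [->|Nn] := eqVneq N 0.
    have eta1 : 0 <= 1 + eta by rewrite addr_ge0// ltW.
    by apply: mulr_ge0; [exact: exprn_ge0|rewrite divr_ge0// ltW].
  have Np : 0 < N by rewrite lt0r Nn.
  rewrite -(@ler_pM2l _ (s ^+ 2 * N)) ?mulr_gt0 ?exprn_gt0//.
  have -> : s ^+ 2 * N * N = (s * N) ^+ 2 by ring.
  apply: (le_trans h4).
  have -> : s ^+ 2 * N * ((1 + eta) ^+ 3 * (E / lambda)) =
    (1 + eta) ^+ 2 * E * (s ^+ 2 * N * ((1 + eta) / lambda)) by ring.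
  by rewrite ler_wpM2l// mulr_ge0 ?sqr_ge0.
rewrite mulrC div1r; apply/ler_addgt0Pr => e e0.
pose A := E / lambda; have A0 : 0 <= A by rewrite divr_ge0// ltW.
pose eta := Num.min 1 (e / (7 * A + 1)).
have A1 : 0 < 7 * A + 1 by rewrite ltr_wpDl// mulr_ge0.
have eta0 : 0 < eta by rewrite lt_min ltr01 divr_gt0.
apply: le_trans (main eta eta0) _; rewrite -/A.
have eta1 : eta <= 1 by rewrite ge_min lexx.
have h : eta * (7 * A + 1) <= e.
  by rewrite -ler_pdivlMr// /eta ge_min lexx orbT.
(* For [eta <= 1] the expansion has remainder at most [(3 + 3 + 1) eta]. *)
have c3 : (1 + eta) ^+ 3 <= 1 + 7 * eta by clear -eta0 eta1; nra.
have : (1 + eta) ^+ 3 * A <= (1 + 7 * eta) * A by rewrite ler_wpM2r.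
by move: h eta0; clear; lra.
Qed.

End Inequalities.

(** * Talagrand inequality *)

Lemma sqrt_le_add (R : realType) (a b e : R) : 0 <= b -> 0 <= e ->
  a <= b + e ^+ 2 -> Num.sqrt a <= Num.sqrt b + e.
Proof.
move=> b0 e0 h; have s0 := sqrtr_ge0 b.
rewrite -[leRHS]ger0_norm ?addr_ge0// -sqrtr_sqr ler_wsqrtr//.
by apply: (le_trans h); rewrite sqrrD sqr_sqrtr// lerD2r lerDl mulrn_wge0// mulr_ge0.
Qed.

Section Talagrand.
Variables (R : realType) (X : finType) (K : X -> X -> R) (pi : X -> R).
Implicit Types (r p q : X -> R).
Hypotheses (hK : markov_kernel K) (hirr : irreducible_kernel K)
  (hpi : prob_vector pi) (hstat : stationary K pi) (hrev : reversible K pi).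

Local Notation dist := (dist K pi).
Local Notation Gamma r := (graph_form (edge K pi r)).
Local Notation lnf r := (fun x => ln (r x)).

(** * One explicit Euler step of the heat equation *)

Definition generator r x := \sum_y K x y * r y - r x.

Lemma generatorE r x : pi x * generator r x = graph_div (edge K pi density_one) r x.
Proof.
rewrite /graph_div /generator -[r x in LHS]mul1r -(hK.2 x) mulr_suml -sumrB mulr_sumr.
by apply: eq_bigr => y _; rewrite edge_one; ring.
Qed.

Lemma sum_generator r phi : (forall x, 0 < r x) ->
  \sum_x pi x * generator r x * phi x = - Gamma r (lnf r) phi.
Proof.
move=> r0; rewrite -dirichlet_ln// dirichletE graph_formC -graph_form_green.
  by apply: eq_bigr => x _; rewrite generatorE mulrC.
by apply: edgeC => // x; exact: ler01.
Qed.

Definition heat_step r (h : R) x := r x + h * generator r x.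

Lemma heat_stepE r h x : heat_step r h x = (1 - h) * r x + h * \sum_y K x y * r y.
Proof. by rewrite /heat_step /generator; ring. Qed.

(** For [h <= 1] the step is a convex combination of [r] and its average under [K]. *)
Lemma heat_step_ge r h (m : R) : 0 <= h <= 1 -> (forall x, m <= r x) ->
  forall x, m <= heat_step r h x.
Proof.
move=> /andP[h0 h1] mr x; rewrite heat_stepE.
have Km : m <= \sum_y K x y * r y.
  rewrite -[m]mul1r -(hK.2 x) mulr_suml ler_sum// => y _.
  by rewrite ler_wpM2l ?kernel_ge0.
have -> : m = (1 - h) * m + h * m by ring.
by rewrite lerD// ler_wpM2l ?subr_ge0.
Qed.

Lemma heat_step_density r h : 0 <= h <= 1 -> density pi r -> density pi (heat_step r h).
Proof.
move=> h01 [r0 r1]; split=> [x|]; first exact: heat_step_ge.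
rewrite /heat_step; under eq_bigr do rewrite mulrDr mulrCA.
rewrite big_split/= r1 -mulr_sumr.
suff -> : \sum_x pi x * generator r x = 0 by rewrite mulr0 addr0.
under eq_bigr do rewrite generatorE; apply: sum_graph_div.
by apply: edgeC => // x; exact: ler01.
Qed.

(** The velocity of the segment, paired with [phi], is [- h * Gamma r (ln r, phi)]; Cauchy-Schwarz
    bounds it in the form of [r]. The points of the segment are shorter heat steps, hence at least
    [(1 - h) r], which costs the factor [1 / (1 - h)]. *)
Lemma heat_step_dist r h : 0 < h < 1 -> density pi r -> (forall x, 0 < r x) ->
  dist r (heat_step r h) ^+ 2 <= h ^+ 2 * Gamma r (lnf r) (lnf r) / (1 - h).
Proof.
move=> /andP[h0 h1] dr r0; have h01 : 0 <= h <= 1 by rewrite !ltW.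
have dh := heat_step_density h01 dr.
set I := Gamma r _ _; have I0 : 0 <= I by exact: Gamma_ge0.
have h1' : 0 < 1 - h by rewrite subr_gt0.
have A0 : 0 <= h ^+ 2 * I / (1 - h).
  by rewrite divr_ge0 ?(ltW h1')// mulr_ge0 ?sqr_ge0.
rewrite -lee_fin -(dist_sqr hK hirr)//.
apply: (W2_segment_le hK hirr hpi hstat hrev A0 dr dh (@smooth_id R)) => //.
move=> t /andP[t0 t1].
have rE x : r x + t * (heat_step r h x - r x) = heat_step r (t * h) x.
  by rewrite /heat_step; ring.
have th x : (1 - h) * r x <= r x + t * (heat_step r h x - r x).
  rewrite rE heat_stepE.
  have : 0 <= t * h * \sum_y K x y * r y.
    apply: mulr_ge0; first by apply: mulr_ge0; exact: ltW.
    by apply: sumr_ge0 => y _; rewrite mulr_ge0 ?kernel_ge0// ltW.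
  have : (1 - h) * r x <= (1 - t * h) * r x.
    by rewrite ler_wpM2r ?(ltW (r0 x))// lerD2l lerN2 ler_piMl ?ltW.
  by lra.
split=> [x|phi]; first by rewrite (lt_le_trans _ (th x))// mulr_gt0.
rewrite derive1_id mul1r.
have -> : \sum_x pi x * (heat_step r h x - r x) * phi x = - (h * Gamma r (lnf r) phi).
  rewrite -mulrN -sum_generator// mulr_sumr; apply: eq_bigr => x _.
  by rewrite /heat_step; ring.
rewrite sqrrN exprMn.
have h2 := @graph_form_CauchySchwarz R X (edge K pi r) (lnf r) phi (edge_ge0 hK hirr hpi hstat r).
have h3 : (1 - h) * Gamma r phi phi <=
    Gamma (fun x => r x + t * (heat_step r h x - r x)) phi phi.
  by apply: Gamma_mono => //; [exact: ltW|move=> x; exact: ltW].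
apply: (@le_trans _ _ (h ^+ 2 * (I * Gamma r phi phi))).
  exact: (ler_wpM2l (sqr_ge0 h) h2).
rewrite (mulrA (h ^+ 2) I) -(mulrA (h ^+ 2 * I)); apply: ler_wpM2l.
  exact: (mulr_ge0 (sqr_ge0 h) I0).
by rewrite ler_pdivlMl.
Qed.

(** The tangent inequality at the new point involves the logarithm of the new density. Replacing it
    by [ln r] costs order [h^2], because [ln] is Lipschitz with constant [1 / m] above [m] and the
    step preserves that bound. *)
Lemma heat_step_entropy r (m : R) : density pi r -> 0 < m -> (forall x, m <= r x) ->
  exists2 C : R, 0 <= C & forall h, 0 < h < 1 ->
  entropy pi (heat_step r h) <= entropy pi r - h * Gamma r (lnf r) (lnf r) + C * h ^+ 2.
Proof.
move=> dr m0 mr; have r0 x : 0 < r x := lt_le_trans m0 (mr x).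
exists (\sum_x pi x * (generator r x ^+ 2 / m)) => [|h /andP[h0 h1]].
  by apply: sumr_ge0 => x _; rewrite mulr_ge0 ?(hpi.1 x)// divr_ge0 ?sqr_ge0// ltW.
have h01 : 0 <= h <= 1 by rewrite !ltW.
have dh := heat_step_density h01 dr; have mh := heat_step_ge h01 mr.
have rh0 x : 0 < heat_step r h x := lt_le_trans m0 (mh x).
have h2 := entropy_tangent hpi dh dr rh0.
rewrite -lerBlDl.
apply: (le_trans (y := \sum_x pi x * (heat_step r h x - r x) * ln (heat_step r h x) +
  h * Gamma r (lnf r) (lnf r))); first lra.
have -> : h * Gamma r (lnf r) (lnf r) = \sum_x - (h * (pi x * generator r x * ln (r x))).
  by rewrite sumrN -mulr_sumr sum_generator// mulrN opprK.
rewrite -big_split mulr_suml ler_sum// => x _ /=.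
have -> : pi x * (heat_step r h x - r x) * ln (heat_step r h x)
   - h * (pi x * generator r x * ln (r x)) =
   h * pi x * (generator r x * (ln (heat_step r h x) - ln (r x))).
  by rewrite /heat_step; ring.
have -> : pi x * (generator r x ^+ 2 / m) * h ^+ 2 =
   h * pi x * (generator r x * (h * generator r x / m)) by ring.
rewrite ler_wpM2l ?mulr_ge0 ?(hpi.1 x) ?(ltW h0)//.
have lnl (a b : R) : m <= a -> m <= b -> a <= b -> ln b - ln a <= (b - a) / m.
  move=> ma mb ab; have a0 := lt_le_trans m0 ma; have b0 := lt_le_trans m0 mb.
  rewrite -ln_div ?posrE//.
  have h3 : -1 < b / a - 1 by rewrite ltrBrDl subrr divr_gt0.
  have := le_ln1Dx h3; rewrite addrC subrK => /le_trans; apply.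
  have -> : b / a - 1 = (b - a) / a by rewrite mulrBl divff// gt_eqF.
  by rewrite ler_wpM2l ?subr_ge0// lef_pV2.
have sE : heat_step r h x - r x = h * generator r x by rewrite /heat_step addrC addKr.
have [g0|g0] := leP 0 (generator r x).
  rewrite ler_wpM2l// -sE; apply: lnl => //.
  by rewrite -subr_ge0 sE mulr_ge0// ltW.
rewrite ler_wnM2l ?(ltW g0)// -sE -lerN2 opprB -mulNr opprB; apply: lnl => //.
by rewrite -subr_le0 sE mulr_ge0_le0 ?ltW.
Qed.

(** A one-sided bound from the tangent at [r] alone, so [r'] may vanish somewhere; it is the lower
    semicontinuity that a minimizing sequence needs. *)
Lemma entropy_lip r (m : R) : density pi r -> 0 < m -> (forall x, m <= r x) ->
  exists2 C : R, 0 <= C & forall r' (h : R), density pi r' -> (forall x, `|r' x - r x| < h) ->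
  entropy pi r <= entropy pi r' + C * h.
Proof.
move=> dr m0 mr; have r0 x : 0 < r x := lt_le_trans m0 (mr x).
exists (\sum_x pi x * `|ln (r x)|) => [|r' h dr' rr].
  by apply: sumr_ge0 => x _; rewrite mulr_ge0 ?(hpi.1 x).
have := entropy_tangent hpi dr dr' r0; rewrite lerBlDl => /le_trans; apply.
rewrite lerD2l mulr_suml ler_sum// => x _; rewrite -!mulrA ler_wpM2l ?(hpi.1 x)//.
apply: (le_trans (ler_norm _)); rewrite normrM mulrC ler_wpM2l// ltW// distrC.
exact: rr.
Qed.

(** Direct method: a cluster point of a minimizing sequence keeps the closed constraints, and at
    late close indices the functional at the limit exceeds the infimum by at most three errors
    [d / 3]. *)
Lemma perturbed_entropy_min (lambda m e : R) r : 0 < lambda -> 0 < m ->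
  density pi r -> (forall x, m <= r x) -> 0 < e < 1 ->
  let F s := Num.sqrt (2 / lambda * entropy pi s) + (1 - e) * dist r s in
  exists s, [/\ density pi s, forall x, m <= s x &
    forall s', density pi s' -> (forall x, m <= s' x) -> F s <= F s'].
Proof.
move=> l0 m0 dr mr e01 F; pose A s := density pi s /\ forall x, m <= s x.
have e1 : 0 <= 1 - e <= 1.
  by case/andP: e01 => e0 e1; rewrite subr_ge0 (ltW e1) lerBlDr lerDl ltW.
have /andP[e10 e11] := e1.
have F0 s : 0 <= F s by rewrite addr_ge0 ?sqrtr_ge0// mulr_ge0 ?dist_ge0.
pose S := [set F s | s in A].
have hS : has_inf S.
  split; first by exists (F r), r.
  by exists 0 => _ [s _ <-].
have /choice[u uP] : forall n, exists s, A s /\ F s < inf S + n.+1%:R^-1.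
  move=> n; have n0 : 0 < n.+1%:R^-1 :> R by rewrite invr_gt0.
  by have [_ [s As <-] h] := inf_adherent n0 hS; exists s.
have [|f fP] := @bounded_cluster R X u (fun x => (pi x)^-1).
  by move=> n x; have [[du _] _] := uP n; rewrite du.1 (density_le hK hirr hpi hstat).
have near (h : R) N : 0 < h -> exists2 n, (N <= n)%N & forall x, `|u n x - f x| < h.
  by move=> h0; exact: (fP X h id N h0).
have df : density pi f.
  apply: (density_limit hpi) => h /(near _ 0%N)[n _ H].
  by exists (u n) => //; have [[]] := uP n.
have mf x : m <= f x.
  apply/ler_addgt0Pr => d /(near _ 0%N)[n _ /(_ x)].
  by rewrite ltr_norml => /andP[_]; have [[_ /(_ x)]] := uP n; lra.
exists f; split=> // s ds ms; have As : A s by [].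
apply: (@le_trans _ _ (inf S)); last first.
  by apply: ge_inf; [exact: hS.2|exists s].
apply/ler_addgt0Pr => d d0; have d3 : 0 < d / 3 by rewrite divr_gt0.
have [C C0 HC] := entropy_lip df m0 mf.
have [h h0 Hh] := dist_small hK hirr hpi hstat hrev d3.
(* The error is squared because it is added under the square root; see [sqrt_le_add]. *)
pose h1 := (d / 3) ^+ 2 / (2 / lambda * C + 1).
have L0 : 0 <= 2 / lambda * C by rewrite mulr_ge0// divr_ge0// ltW.
have L1 : 0 < 2 / lambda * C + 1 by rewrite ltr_wpDl.
have h10 : 0 < h1 by rewrite divr_gt0// exprn_gt0.
have [N NE] := natSinv_lt d3.
have hh : 0 < Num.min h h1 by rewrite lt_min h0.
have [n Nn H] := near _ N hh.
have [[du mu] Fu] := uP n.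
have n3 : n.+1%:R^-1 < d / 3.
  by apply: le_lt_trans NE; rewrite lef_pV2 ?posrE ?ltr0n// ler_nat.
have k1 : dist (u n) f < d / 3.
  by apply: Hh => // x; apply: lt_le_trans (H x) _; rewrite ge_min lexx.
have k2 : entropy pi f <= entropy pi (u n) + C * h1.
  by apply: HC => // x; apply: lt_le_trans (H x) _; rewrite ge_min lexx orbT.
have k3 : Num.sqrt (2 / lambda * entropy pi f) <=
    Num.sqrt (2 / lambda * entropy pi (u n)) + d / 3.
  apply: sqrt_le_add; [|exact: ltW|].
    by rewrite mulr_ge0 ?divr_ge0 ?(entropy_ge0 hpi)// ltW.
  apply: (@le_trans _ _ (2 / lambda * (entropy pi (u n) + C * h1))).
    by rewrite ler_wpM2l// divr_ge0// ltW.
  rewrite mulrDr lerD2l mulrA.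
  have : h1 * (2 / lambda * C + 1) = (d / 3) ^+ 2 by rewrite divfK// gt_eqF.
  by rewrite mulrDr mulr1 => <-; rewrite mulrC lerDl ltW.
have k4 := dist_triangle hK hirr hpi hstat hrev dr du df.
have k5 : (1 - e) * dist r f <= (1 - e) * dist r (u n) + d / 3.
  apply: (@le_trans _ _ ((1 - e) * (dist r (u n) + dist (u n) f))).
    by rewrite ler_wpM2l.
  rewrite mulrDr lerD2l (le_trans _ (ltW k1))// ler_piMl ?dist_ge0//.
move: Fu k3 k5 n3; rewrite /F.
move: (n.+1%:R^-1) (Num.sqrt _) (Num.sqrt _) (inf S) ((1 - e) * _) ((1 - e) * _).
by clear -d0; move=> *; lra.
Qed.

(* A minimizer of [sqrt (2 H / lambda) + (1 - e) dist r] can only be the constant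
   density: elsewhere a heat step decreases the first term at a rate which, by
   the logarithmic Sobolev inequality, exceeds its length. *)
Lemma heat_step_descends (lambda e m : R) r s : 0 < lambda -> 0 < m -> 0 < e < 1 ->
  MLSI K pi lambda -> density pi r -> density pi s -> (forall x, m <= s x) ->
  (forall s', density pi s' -> (forall x, m <= s' x) ->
    Num.sqrt (2 / lambda * entropy pi s) + (1 - e) * dist r s <=
    Num.sqrt (2 / lambda * entropy pi s') + (1 - e) * dist r s') ->
  Gamma s (lnf s) (lnf s) = 0.
Proof.
move=> l0 m0 /andP[e0 e1] mlsi dr ds ms smin.
have s0 x : 0 < s x := lt_le_trans m0 (ms x).
have [I IE] : exists I, Gamma s (lnf s) (lnf s) = I by eexists.
have I0 : 0 <= I by rewrite -IE; exact: Gamma_ge0.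
rewrite IE; apply/eqP; rewrite eq_le I0 andbT leNgt; apply/negP => Ip.
have [C C0 HC] := heat_step_entropy ds m0 ms.
have [h [h0 h1 hCI]] : exists h, [/\ 0 < h, h < 1 & h * (2 * (C + I)) <= e * I].
  have CI : 0 < 2 * (C + I) by rewrite mulr_gt0// ltr_wpDl.
  exists (Num.min (1 / 2) (e * I / (2 * (C + I)))); split.
  - by rewrite lt_min !divr_gt0// mulr_gt0.
  - by rewrite gt_min; apply/orP; left; lra.
  - by rewrite -ler_pdivlMr// ge_min lexx orbT.
have h01 : 0 < h < 1 by rewrite h0.
have h01' : 0 <= h <= 1 by rewrite !ltW.
have hs := smin _ (heat_step_density h01' ds) (heat_step_ge h01' ms).
have k1 := heat_step_dist h01 ds s0; rewrite IE in k1.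
have k2 := HC h h01; rewrite IE in k2.
have k3 := dist_triangle hK hirr hpi hstat hrev dr ds (heat_step_density h01' ds).
have k4 : entropy pi s <= I / (2 * lambda).
  by have := mlsi s ds; rewrite fisherE// -EFinM lee_fin IE div1r mulrC.
have d0 := dist_ge0 K pi s (heat_step s h).
have H0 := entropy_ge0 hpi ds.
have H1 := entropy_ge0 hpi (heat_step_density h01' ds).
set a := Num.sqrt (2 / lambda * entropy pi s) in hs.
set b := Num.sqrt (2 / lambda * entropy pi (heat_step s h)) in hs.
have a0 : 0 <= a by exact: sqrtr_ge0.
have b0 : 0 <= b by exact: sqrtr_ge0.
have l2 : 0 <= 2 / lambda by rewrite divr_ge0// ltW.
have aE : a ^+ 2 = 2 / lambda * entropy pi s by rewrite sqr_sqrtr// mulr_ge0.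
have bE : b ^+ 2 = 2 / lambda * entropy pi (heat_step s h) by rewrite sqr_sqrtr// mulr_ge0.
set D := dist s (heat_step s h) in k1 k3 d0.
have ab : a - b <= (1 - e) * D.
  have : (1 - e) * dist r (heat_step s h) <= (1 - e) * (dist r s + D).
    by rewrite ler_wpM2l// subr_ge0 ltW.
  by move: hs; clear; move: a b (dist _ _) (dist _ _) D => *; lra.
pose q := Num.sqrt I; have q0 : 0 <= q by exact: sqrtr_ge0.
have qE : q ^+ 2 = I by rewrite sqr_sqrtr.
have aq : a <= q / lambda.
  rewrite -(@ler_pXn2r _ 2) ?nnegrE ?divr_ge0 ?(ltW l0)// aE expr_div_n qE.
  have -> : I / lambda ^+ 2 = 2 / lambda * (I / (2 * lambda)).
    by field; rewrite gt_eqF.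
  by rewrite ler_wpM2l.
have h1' : 0 < 1 - h by rewrite subr_gt0.
have Dq : D <= h * q / (1 - h).
  have hq : 0 <= h * q by rewrite mulr_ge0// ltW.
  have hqh : 0 <= h * q / (1 - h) by rewrite divr_ge0// ltW.
  rewrite -(@ler_pXn2r _ 2)//.
  apply: (le_trans k1); rewrite [leRHS]exprMn exprMn qE; apply: ler_wpM2l.
    by apply: mulr_ge0 => //; exact: sqr_ge0.
  by rewrite exprVn lef_pV2 ?posrE ?exprn_gt0// expr2 ler_piMl ?(ltW h1')// gerBl ltW.
have abq : a - b <= (1 - e) * (h * q / (1 - h)).
  by apply: (le_trans ab); rewrite ler_wpM2l// subr_ge0 ltW.
(* Instead of differentiating a square root, [a - b] is multiplied by
   [a + b <= 2 a <= 2 q / lambda], the last bound being the logarithmic Sobolev inequality. For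
   [a < b] the left side is at most 0. *)
have sq : a ^+ 2 - b ^+ 2 <= 2 * (q / lambda) * ((1 - e) * (h * q / (1 - h))).
  have Q0 : 0 <= (1 - e) * (h * q / (1 - h)).
    by rewrite mulr_ge0 ?subr_ge0 ?(ltW e1)// divr_ge0 ?(ltW h1')// mulr_ge0// ltW.
  have [ba|ba] := leP b a.
    have -> : a ^+ 2 - b ^+ 2 = (a + b) * (a - b) by ring.
    apply: ler_pM => //; [exact: addr_ge0|by rewrite subr_ge0|].
    by move: aq ba; clear; move: a b (q / lambda) => *; lra.
  apply: (@le_trans _ _ 0).
    by rewrite subr_le0 lerXn2r ?nnegrE// ltW.
  by apply: mulr_ge0 => //; rewrite mulr_ge0// divr_ge0// ltW.
have ab2 : 2 / lambda * (h * I - C * h ^+ 2) <= a ^+ 2 - b ^+ 2.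
  by rewrite aE bE -mulrBr ler_wpM2l//; move: k2; clear; move: (entropy _ _) (entropy _ _) => *; lra.
have : 2 / lambda * (h * I - C * h ^+ 2) <= 2 / lambda * (h * ((1 - e) * I / (1 - h))).
  apply: (le_trans ab2); apply: (le_trans sq); rewrite -qE.
  by rewrite le_eqVlt; apply/orP; left; apply/eqP; ring.
rewrite ler_pM2l ?divr_gt0//.
have -> : h * I - C * h ^+ 2 = h * (I - C * h) by ring.
(* What remains is [(I - C h) (1 - h) <= (1 - e) I], that is [e I <= h (C + I) - C h^2], whereas [h]
   was chosen with [h (C + I) <= e I / 2]. *)
rewrite ler_pM2l// ler_pdivlMr// => fin.
have e1' : 0 < 1 - e by rewrite subr_gt0.
have Ch : 0 <= C * h * h by rewrite !mulr_ge0// ltW.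
have := mulr_gt0 e0 Ip.
move: fin hCI Ch; move: (h) => k; move: h0 => _.
by move=> *; nra.
Qed.

Lemma Gamma_ln_eq0 r : density pi r -> (forall x, 0 < r x) ->
  Gamma r (lnf r) (lnf r) = 0 -> r = density_one.
Proof.
move=> dr r0 G0.
have rc x y : r x = r y.
  have [C C0 HC] := graph_form_pair (edge_ge0 hK hirr hpi hstat r)
    (connect_edge hK hirr hpi hstat r0 x y).
  have := HC (lnf r); rewrite G0 mulr0 => h.
  have : (ln (r x) - ln (r y)) ^+ 2 == 0 by rewrite eq_le h sqr_ge0.
  by rewrite sqrf_eq0 subr_eq0 => /eqP; apply: ln_inj; rewrite posrE.
apply/funext => x; have := dr.2.
under eq_bigr do rewrite (rc _ x).
by rewrite -mulr_suml hpi.2 mul1r.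
Qed.

(** Once the minimizer is known to be the constant density, its value is compared with the value at
    [r] itself, where the distance term vanishes; then [e] tends to 0. *)
Lemma Talagrand_positive (lambda m : R) r : 0 < lambda -> 0 < m -> MLSI K pi lambda ->
  density pi r -> (forall x, m <= r x) ->
  dist r density_one <= Num.sqrt (2 / lambda * entropy pi r).
Proof.
move=> l0 m0 mlsi dr mr; set T := Num.sqrt _.
have T0 : 0 <= T by exact: sqrtr_ge0.
have main (e : R) : 0 < e < 1 -> (1 - e) * dist r density_one <= T.
  move=> e01; have [s [ds ms smin]] := perturbed_entropy_min l0 m0 dr mr e01.
  have s1 : s = density_one.
    apply: Gamma_ln_eq0 => // [x|]; first exact: lt_le_trans (ms x).
    exact: (@heat_step_descends lambda e m r s).
  have := smin r dr mr; rewrite s1 (dist_refl hK hirr hpi hstat hrev)// mulr0 addr0.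
  by apply: le_trans; rewrite lerDr sqrtr_ge0.
set D := dist _ _ in main *; have D0 : 0 <= D by exact: dist_ge0.
apply/ler_addgt0Pr => d d0.
pose e := Num.min (1 / 2) (d / (D + 1)).
have D1 : 0 < D + 1 by rewrite ltr_wpDl.
have e0 : 0 < e by rewrite lt_min !divr_gt0.
have e1 : e < 1 by rewrite gt_min; apply/orP; left; lra.
have := main e; rewrite e0 e1 => /(_ isT).
have : e * (D + 1) <= d by rewrite -ler_pdivlMr// ge_min lexx orbT.
by move: e0; move: (e) (D) (T); clear => *; lra.
Qed.

(** The tangent inequality at the mixture [a] has terms [(a - r) ln a], where [a - r] is a
    nonnegative multiple of [1 - a], which has the sign opposite to [ln a]. *)
Lemma entropy_mix_le r (h : R) : density pi r -> 0 < h < 1 ->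
  entropy pi (fun x => r x + h * (density_one x - r x)) <= entropy pi r.
Proof.
move=> dr /andP[h0 h1]; have d1 := density_one_density hpi.
set a := fun x => _; have h01 : 0 <= h <= 1 by rewrite !ltW.
have da : density pi a by exact: density_mix.
have a0 x : 0 < a x.
  have -> : a x = (1 - h) * r x + h by rewrite /a /density_one; ring.
  by rewrite ltr_wpDl// mulr_ge0 ?(dr.1 x)// subr_ge0 ltW.
rewrite -subr_le0; apply: le_trans (entropy_tangent hpi da dr a0) _.
apply: sumr_le0 => x _; rewrite -mulrA mulr_ge0_le0 ?(hpi.1 x)//.
have -> : a x - r x = h / (1 - h) * (1 - a x).
  by rewrite /a /density_one; field; rewrite gt_eqF// subr_gt0.
rewrite -mulrA mulr_ge0_le0 ?divr_ge0 ?subr_ge0 ?(ltW h0) ?(ltW h1)//.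
have [ax|ax] := leP (a x) 1.
  by rewrite mulr_ge0_le0 ?subr_ge0 ?ln_le0.
by rewrite mulr_le0_ge0 ?subr_le0 ?(ltW ax)// ltW// ln_gt0.
Qed.

(** Mixing with the constant density makes [r] at least [t], moves it by less than [d] in the
    distance and does not raise the entropy, so the positive case applies up to [d]. *)
Lemma MLSI_Talagrand lambda : 0 < lambda -> MLSI K pi lambda ->
  modified_Talagrand K pi lambda.
Proof.
move=> l0 mlsi r dr; rewrite (sqrte_dist hK hirr)// lee_fin.
have d1 := density_one_density hpi.
apply/ler_addgt0Pr => d d0.
have [h h0 Hh] := dist_small hK hirr hpi hstat hrev d0.
pose M := 2 + \sum_x (pi x)^-1.
have pi0 := stationary_gt0 hK hirr hpi hstat.
have M0 : 0 < M by rewrite ltr_pwDl// sumr_ge0// => x _; rewrite invr_ge0 ltW.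
have rM x : `|density_one x - r x| < M.
  apply: (@le_lt_trans _ _ (1 + (pi x)^-1)).
    apply: (le_trans (ler_normB _ _)).
    rewrite /density_one normr1 lerD2l ger0_norm ?(dr.1 x)//.
    exact: (density_le hK hirr hpi hstat).
  rewrite /M (bigD1 x)//= addrA ltr_wpDr ?ltrD2r ?ltr1n// sumr_ge0// => y _.
  by rewrite invr_ge0 ltW.
pose t := Num.min (1 / 2) (h / M).
have t0 : 0 < t by rewrite lt_min !divr_gt0.
have t1 : t < 1 by rewrite gt_min; apply/orP; left; lra.
have tM : t * M <= h by rewrite -ler_pdivlMr// ge_min lexx orbT.
have t01 : 0 < t < 1 by rewrite t0.
have t01' : 0 <= t <= 1 by rewrite !ltW.
have da := density_mix dr d1 t01'.
have k1 : dist r (fun x => r x + t * (density_one x - r x)) < d.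
  apply: Hh => // x; rewrite opprD addNKr normrN normrM gtr0_norm//.
  by apply: lt_le_trans tM; rewrite ltr_pM2l.
have k2 : dist (fun x => r x + t * (density_one x - r x)) density_one <=
    Num.sqrt (2 / lambda * entropy pi r).
  apply: (@le_trans _ _ (Num.sqrt (2 / lambda *
      entropy pi (fun x => r x + t * (density_one x - r x))))).
    apply: (@Talagrand_positive lambda t) => // x.
    have -> : r x + t * (density_one x - r x) = (1 - t) * r x + t.
      by rewrite /density_one; ring.
    by rewrite lerDr mulr_ge0 ?(dr.1 x)// subr_ge0 ltW.
  rewrite ler_wsqrtr// ler_wpM2l ?divr_ge0 ?(ltW l0)//.
  exact: entropy_mix_le.
apply: le_trans (dist_triangle hK hirr hpi hstat hrev dr da d1) _.
by rewrite addrC lerD// ltW.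
Qed.

End Talagrand.

Theorem theorem1p5 (R : realType) (X : finType) (K : X -> X -> R) (pi : X -> R)
    (hK : markov_kernel K) (hirr : irreducible_kernel K)
    (hpi : prob_vector pi) (hstat : stationary K pi)
    (hrev : reversible K pi) :
  [/\ forall kappa : R, Ric_ge K pi kappa -> HWI K pi kappa,
      forall lambda : R, 0 < lambda -> Ric_ge K pi lambda -> MLSI K pi lambda,
      forall lambda : R, 0 < lambda ->
        MLSI K pi lambda -> modified_Talagrand K pi lambda &
      forall lambda : R, 0 < lambda ->
        modified_Talagrand K pi lambda -> Poincare K pi lambda].
Proof.
split=> [kappa|lambda l0|lambda l0|lambda l0].
- exact: Ric_HWI.
- exact: Ric_MLSI.
- exact: MLSI_Talagrand.
- exact: Talagrand_Poincare.
Qed.
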